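(* Let $V(x,y)=q(x,y)=\sum_{j\ne0}q_j(x)e^{2\pi i\lambda_jy}$ satisfy Hypotheses (V) with $q_{\rm av}\equiv0$, let $q_\epsilon(x)=q(x,x/\epsilon)$ and $\Lambda_{\rm eff}(x)=\frac1{4\pi^2}\sum_{j\ne0}\frac{|q_j(x)|^2}{\lambda_j^2}$. Let $\kappa\in\mathbb{C}$ with $\kappa\neq\frac i2\int_{\mathbb{R}}\Lambda_{\rm eff}$. Then $$t^{q_\epsilon}(\epsilon^2\kappa)\ \longrightarrow\ t^\star\Big(\kappa;\int_{\mathbb{R}}\Lambda_{\rm eff}\Big)=\frac{\kappa}{\kappa-\frac i2\int_{\mathbb{R}}\Lambda_{\rm eff}}\qquad\text{as }\epsilon\to0^+,$$ where $t^\star(\kappa;m)=\frac{\kappa}{\kappa-\frac{i}{2}m}$ is the transmission coefficient of the Schrödinger operator $H_{-m\delta}=-\partial_X^2-m\,\delta(X)$ with attractive Dirac delta potential well of total mass $m>0$.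
   Context: Function spaces: for $\beta>0$, $L^\infty_\beta$ is the space of measurable $g:\mathbb{R}\to\mathbb{C}$ with $|g|_{L^\infty_\beta}=\operatorname{ess\,sup}_x e^{\beta|x|}|g(x)|<\infty$, and $|g|_{W^{n,\infty}_\beta}=\sum_{l=0}^n|\partial_x^l g|_{L^\infty_\beta}$. Hypotheses (V) (with $q_{\rm av}\equiv 0$): $V(x,y)=\sum_{j\in\mathbb{Z}\setminus\{0\}}q_j(x)e^{2\pi i\lambda_jy}$ is real-valued, $\overline{q_j}=q_{-j}$, $\lambda_{-j}=-\lambda_j$; there are $\theta,\beta>0$ with $\inf_{j\ne k}|\lambda_j-\lambda_k|\ge\theta$ and $\inf_{j\neq 0}|\lambda_j|\ge\theta$ ($\lambda_j$ real); and $\sum_{j\ne0}|q_j|_{W^{3,\infty}_\beta}<\infty$. Jost solutions and transmission coefficient: for real-valued $U\in L^\infty_\beta$ and $|\Im k|<\beta/2$, $f^U_\pm(x;k)$ are the unique solutions of $f^U_+(x;k)=e^{ikx}+\int_x^\infty\frac{\sin(k(y-x))}{k}U(y)f^U_+(y;k)\,dy$, $f^U_-(x;k)=e^{-ikx}-\int_{-\infty}^x\frac{\sin(k(y-x))}{k}U(y)f^U_-(y;k)\,dy$ (with $\sin(kz)/k=z$ at $k=0$). With $\mathcal{W}[h_1,h_2]=h_1h_2'-h_2h_1'$, $t^U$ is defined by $\mathcal{W}[f^U_+,f^U_-](k)=-2ik/t^U(k)$; it is meromorphic, removable singularities being filled by continuity. For $\kappa$ fixed, $\epsilon^2\kappa$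 lies in the strip $|\Im k|<\beta/2$ once $\epsilon$ is small. *)

(* Defs.v *)
From HB Require Import structures.
From mathcomp Require Import all_boot all_order all_algebra.
From mathcomp Require Import complex.
From mathcomp Require Import all_classical all_reals all_analysis.
From mathcomp Require Import ess_sup_inf.
Set Implicit Arguments.
Unset Strict Implicit.
Unset Printing Implicit Defensive.
Import Order.TTheory GRing.Theory Num.Theory.
Import numFieldNormedType.Exports.
Local Open Scope classical_set_scope.
Local Open Scope ring_scope.
Local Open Scope complex_scope.

Local Notation Re := complex.Re.
Local Notation Im := complex.Im.

Section ComplexFunctions.
Variable R : realType.

Definition cmod (z : R[i]) : R := Normc.normc z.

Definition cexp (z : R[i]) : R[i] :=
  (expR (Re z))%:C * (cos (Im z) +i* sin (Im z)).

Definition csin (z : R[i]) : R[i] :=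
  (cexp ('i * z) - cexp (- ('i * z))) / ('i *+ 2).

Definition cderive (f : R -> R[i]) (x : R) : R[i] :=
  derive1 (fun y => Re (f y)) x +i* derive1 (fun y => Im (f y)) x.

Definition cmeasurable (f : R -> R[i]) : Prop :=
  measurable_fun [set: R] (fun x => Re (f x)) /\
  measurable_fun [set: R] (fun x => Im (f x)).

Definition cintegrable (mu : {measure set (measurableTypeR R) -> \bar R}) (D : set R)
    (f : R -> R[i]) : Prop :=
  mu.-integrable D (fun x => (Re (f x))%:E) /\
  mu.-integrable D (fun x => (Im (f x))%:E).

Definition cintegral (mu : {measure set (measurableTypeR R) -> \bar R}) (D : set R)
    (f : R -> R[i]) : R[i] :=
  Rintegral mu D (fun x => Re (f x)) +i* Rintegral mu D (fun x => Im (f x)).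

End ComplexFunctions.

Section FunctionSpaces.
Variable R : realType.
Let leb : {measure set (measurableTypeR R) -> \bar R} := @lebesgue_measure R.

Definition test_function (phi : R -> R) : Prop :=
  (forall n x, derivable (derive1n n phi) x 1) /\
  (exists M : R, forall x, M < `|x| -> phi x = 0).

Definition clocally_integrable (g : R -> R[i]) : Prop :=
  locally_integrable [set: R] (fun x => Re (g x)) /\
  locally_integrable [set: R] (fun x => Im (g x)).

Definition is_weak_derivative (g h : R -> R[i]) : Prop :=
  [/\ clocally_integrable g, clocally_integrable h
    & forall phi, test_function phi ->
      cintegral leb setT (fun x => (derive1 phi x)%:C * g x) =
      - cintegral leb setT (fun x => (phi x)%:C * h x)].

(* A representative of the weak derivative, which is unique up to a null set;
   it is used only where one exists. *)
Definition weak_derivative (g : R -> R[i]) : R -> R[i] :=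
  xget (fun=> 0) [set h | is_weak_derivative g h].

Definition weak_derivative_n (l : nat) (g : R -> R[i]) : R -> R[i] :=
  iter l weak_derivative g.

Definition Linfty_norm (beta : R) (g : R -> R[i]) : \bar R :=
  ess_sup leb (fun x => (expR (beta * `|x|) * cmod (g x))%:E).

Definition Winfty_norm (n : nat) (beta : R) (g : R -> R[i]) : \bar R :=
  (\sum_(l < n.+1) Linfty_norm beta (weak_derivative_n l g))%E.

Definition in_Winfty (n : nat) (beta : R) (g : R -> R[i]) : Prop :=
  [/\ cmeasurable g,
      forall l, (l < n)%N ->
        is_weak_derivative (weak_derivative_n l g) (weak_derivative_n l.+1 g)
    & (Winfty_norm n beta g < +oo)%E].

End FunctionSpaces.

Section Potential.
Variable R : realType.

Definition nonzero_ints : set int := [set j | j != 0].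

(* Sum over the nonzero integers as the limit of the symmetric partial sums.
   The series it is used for converges absolutely for almost every x, so that
   the order of summation does not matter. *)
Definition nonzero_sum (u : int -> R[i]) (s : R[i]) : Prop :=
  (fun N : nat => \sum_(1 <= n < N.+1) (u n%:Z + u (- n%:Z)) : R[i]^o)
    @ \oo --> (s : R[i]^o).

Definition hypotheses_V (q : int -> R -> R[i]) (lambda : int -> R)
    (V : R -> R -> R) : Prop :=
  [/\ forall x y : R,
        nonzero_sum
          (fun j => q j x * cexp ('i * (2 * pi * lambda j * y)%:C))
          (V x y)%:C,
      forall j : int, j != 0 -> forall x : R, conjc (q j x) = q (- j) x,
      forall j : int, j != 0 -> lambda (- j) = - lambda j
    & exists theta beta : R,
      [/\ 0 < theta /\ 0 < beta,
          forall j k : int, j != 0 -> k != 0 -> j != k ->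
            theta <= `|lambda j - lambda k|,
          forall j : int, j != 0 -> theta <= `|lambda j|,
          forall j : int, j != 0 -> in_Winfty 3 beta (q j)
        & (\esum_(j in nonzero_ints) Winfty_norm 3 beta (q j) < +oo)%E]].

Definition q_eps (V : R -> R -> R) (eps : R) : R -> R :=
  fun x => V x (x / eps).

Definition Lambda_eff (q : int -> R -> R[i]) (lambda : int -> R) (x : R) : R :=
  (4 * pi ^+ 2)^-1 *
  fine (\esum_(j in nonzero_ints)
    (cmod (q j x) ^+ 2 / lambda j ^+ 2)%:E)%E.

Definition total_Lambda_eff (q : int -> R -> R[i]) (lambda : int -> R) : R :=
  Rintegral (@lebesgue_measure R) setT (Lambda_eff q lambda).

End Potential.

Definition point_mass (R : realType) :
    {measure set (measurableTypeR R) -> \bar R} :=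
  @dirac _ (measurableTypeR R) (0 : R) R.

(* The potential is the signed measure U(y) mu(dy): mu is the Lebesgue measure
   for a potential function U, and mu = point_mass with the constant function
   U = - m gives the point interaction - m * delta. *)
Section Transmission.
Variable R : realType.
Variables (mu : {measure set (measurableTypeR R) -> \bar R}) (U : R -> R).

Definition jost_kernel (k : R[i]) (z : R) : R[i] :=
  if k == 0 then z%:C else csin (k * z%:C) / k.

Definition is_jost_plus (k : R[i]) (f : R -> R[i]) : Prop :=
  forall x : R,
    let F := fun y => jost_kernel k (y - x) * (U y)%:C * f y in
    cintegrable mu `[x, +oo[%classic F /\
    f x = cexp ('i * k * x%:C) + cintegral mu `[x, +oo[%classic F.

Definition is_jost_minus (k : R[i]) (f : R -> R[i]) : Prop :=
  forall x : R,
    let F := fun y => jost_kernel k (y - x) * (U y)%:C * f y in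
    cintegrable mu `]-oo, x]%classic F /\
    f x = cexp (- ('i * k * x%:C)) - cintegral mu `]-oo, x]%classic F.

Definition jost_plus (k : R[i]) : R -> R[i] :=
  xget (fun=> 0) [set f | is_jost_plus k f].

Definition jost_minus (k : R[i]) : R -> R[i] :=
  xget (fun=> 0) [set f | is_jost_minus k f].

Definition wronskian (h1 h2 : R -> R[i]) (x : R) : R[i] :=
  h1 x * cderive h2 x - h2 x * cderive h1 x.

(* The Wronskian of two solutions does not depend on the point (nonzero in the
   case of the point interaction at 0, where the derivatives jump) at which it
   is evaluated; the point 1 is arbitrary. *)
Definition jost_wronskian (k : R[i]) : R[i] :=
  wronskian (jost_plus k) (jost_minus k) 1.

Definition transmission_quotient (k : R[i]) : R[i] :=
  - ('i *+ 2 * k) / jost_wronskian k.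

(* Where the Wronskian vanishes the value is the continuous extension, if there
   is one (a removable singularity); at a pole the value is irrelevant. *)
Definition transmission (k : R[i]) : R[i] :=
  if jost_wronskian k != 0 then transmission_quotient k
  else lim ((transmission_quotient k' : R[i]^o) @[k' --> (k : R[i]^o)^']).

End Transmission.

Definition tstar (R : realType) (kappa : R[i]) (m : R) : R[i] :=
  kappa / (kappa - 'i / 2 * m%:C).

(* Main.v *)
Require Import Defs.
From HB Require Import structures.
From mathcomp Require Import all_boot all_order all_algebra.
From mathcomp Require Import complex.
From mathcomp Require Import all_classical all_reals all_analysis.
From mathcomp Require Import ring lra.
From mathcomp Require Import measurable_realfun ess_sup_inf.
Set Implicit Arguments.
Unset Strict Implicit.
Unset Printing Implicit Defensive.
Import Order.TTheory GRing.Theory Num.Theory.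
Import numFieldNormedType.Exports.
Local Open Scope classical_set_scope.
Local Open Scope ring_scope.
Local Open Scope complex_scope.

(* Three integrations by parts of each mode q_j(x) e^(2 i pi lambda_j x / eps)
   give U = q_eps = p' - r with p = O(eps) and r = O(eps^3), uniformly with
   exponential decay.  If f'' = (U - k^2) f, then g = f' - p f satisfies
   g' = - p g - (p^2 + r + k^2) f, which no longer contains U.  For k = O(eps^2)
   this yields the Wronskian
     W(k) = - 2 i k - \int p^2 + O(eps^3).
   The leading part of p is eps times a sum of oscillating modes, whose cross
   products average out, so that \int p^2 = eps^2 (\int Lambda_eff + o(1)).
   Dividing by eps^2 at k = eps^2 kappa gives the limit of t = - 2 i k / W.
   For the point interaction the Jost solutions are explicit. *)

(** * Indefinite Lebesgue integrals *)

(** The potential [q_eps] keeps size O(1) as eps -> 0, so expanding the Jost solutions in powers of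
    U offers no small parameter; only the antiderivative p is small. At k = O(eps^2) the Wronskian
    itself has size eps^2, so errors must be O(eps^3). As r enters the Wronskian linearly, two
    integrations by parts would leave a remainder as large as the main term; the third one consumes
    the third derivative provided by [in_Winfty 3]. The derivatives in the hypotheses are weak and U
    is only measurable. Hence each mode is replaced by a representative with true primitives, by a
    du Bois-Reymond argument, and differential equations are kept in the integrated form
    [primitive], for which a product rule is proved. The Jost solutions are chosen by [xget]: they
    become usable only after existence and uniqueness for the Volterra equation, with constants
    uniform in k and U. The exponential rates are fixed once: with beta = 8 eta the potential decays
    at rate 8 eta, kernel and solution grow at rate eta each, and rate 6 eta is left for the
    moments. *)

Section RealIntegrals.
Variable R : realType.
Notation mu := (@lebesgue_measure R).
Implicit Types (D : set R) (f g h w F G : R -> R) (a b x y M K : R).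

Lemma ae_mono (P Q : R -> Prop) : (forall x, P x -> Q x) ->
  {ae mu, forall x, P x} -> {ae mu, forall x, Q x}.
Proof.
move=> PQ; apply: filterS => //; exact: (ae_filter_ringOfSetsType mu).
Qed.

Lemma ae_and (P Q : R -> Prop) : {ae mu, forall x, P x} ->
  {ae mu, forall x, Q x} -> {ae mu, forall x, P x /\ Q x}.
Proof. exact: (@filterI _ _ (ae_filter_ringOfSetsType mu)). Qed.

Lemma integrable_EFinZl D f M : measurable D ->
  mu.-integrable D (EFin \o f) -> mu.-integrable D (EFin \o (fun x => M * f x)).
Proof.
move=> mD intf; have := @integrableZl _ (measurableTypeR R) R mu D mD M _ intf.
by apply: eq_integrable.
Qed.

Lemma integrable_EFinD D f g : measurable D ->
  mu.-integrable D (EFin \o f) -> mu.-integrable D (EFin \o g) ->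
  mu.-integrable D (EFin \o (fun x => f x + g x)).
Proof.
move=> mD intf intg; have := @integrableD _ (measurableTypeR R) R mu D mD _ _ intf intg.
by apply: eq_integrable.
Qed.

(** This is dominated convergence for the constant sequence [f]: that theorem asks for the
    domination only almost everywhere, and its conclusion includes the integrability of the
    limit. *)
Lemma ae_dominated_integrable D f g : measurable D -> measurable_fun D f ->
  mu.-integrable D (EFin \o g) ->
  {ae mu, forall x, D x -> `|f x| <= g x} ->
  mu.-integrable D (EFin \o f).
Proof.
move=> mD mf ig fg.
have mf' := (measurable_EFinP D f).2 mf.
have [] // := @dominated_convergence _ (measurableTypeR R) R mu D mD (fun=> fun x => (f x)%:E)
  (fun x => (f x)%:E) (fun x => (g x)%:E) (fun=> mf') mf' _ ig.
- by apply: aeW => x Dx; exact: cvg_cst.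
- move: fg; apply: ae_mono => x fg n Dx /=.
  by rewrite lee_fin; exact: fg.
Qed.

Lemma ae_eq_Rintegral D f g : measurable D -> measurable_fun D f ->
  measurable_fun D g -> {ae mu, forall x, D x -> f x = g x} ->
  \int[mu]_(x in D) f x = \int[mu]_(x in D) g x.
Proof.
move=> mD mf mg fg; rewrite /Rintegral; congr fine.
apply: ae_eq_integral => //; [exact/measurable_EFinP|exact/measurable_EFinP|].
by move: fg; apply: ae_mono => x fg Dx /=; rewrite fg.
Qed.

(** Replacing f by the minimum of f and g changes it only on a null set and makes the inequality
    hold everywhere, where the pointwise comparison applies. *)
Lemma ae_le_Rintegral D f g : measurable D ->
  mu.-integrable D (EFin \o f) -> mu.-integrable D (EFin \o g) ->
  {ae mu, forall x, D x -> f x <= g x} ->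
  \int[mu]_(x in D) f x <= \int[mu]_(x in D) g x.
Proof.
move=> mD intf intg fg.
have mf : measurable_fun D f by apply/measurable_EFinP; case/integrableP: intf.
have mg : measurable_fun D g by apply/measurable_EFinP; case/integrableP: intg.
pose h x := Num.min (f x) (g x).
have mh : measurable_fun D h by exact: measurable_minr.
have fh : {ae mu, forall x, D x -> f x = h x}.
  by move: fg; apply: ae_mono => x fg Dx; rewrite /h min_l// fg.
rewrite (ae_eq_Rintegral mD mf mh fh); apply: le_Rintegral => //.
  apply: (@ae_dominated_integrable D _ (fun x => `|f x|)) => //.
    exact: integrable_norm.
  by move: fh; apply: ae_mono => x fh Dx; rewrite -fh.
by move=> x _; rewrite /h ge_min lexx orbT.
Qed.

Lemma ae_dominated_Rintegral D f g : measurable D -> measurable_fun D f ->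
  mu.-integrable D (EFin \o g) ->
  {ae mu, forall x, D x -> `|f x| <= g x} ->
  `|\int[mu]_(x in D) f x| <= \int[mu]_(x in D) g x.
Proof.
move=> mD mf ig fg.
have intf := ae_dominated_integrable mD mf ig fg.
apply: (@le_trans _ _ (\int[mu]_(x in D) `|f x|)).
  exact: (@le_normr_Rintegral _ (measurableTypeR R)).
by apply: ae_le_Rintegral => //; exact: integrable_norm.
Qed.

Lemma dominated_cvg_Rintegral D (f_ : nat -> R -> R) f g : measurable D ->
  (forall n, measurable_fun D (f_ n)) -> measurable_fun D f ->
  {ae mu, forall x, D x -> f_ ^~ x @ \oo --> f x} ->
  mu.-integrable D (EFin \o g) ->
  (forall n, {ae mu, forall x, D x -> `|f_ n x| <= g x}) ->
  (fun n => \int[mu]_(x in D) f_ n x) @ \oo --> \int[mu]_(x in D) f x.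
Proof.
move=> mD mf_ mf f_f ig f_g.
have intf_ n : mu.-integrable D (EFin \o f_ n).
  exact: ae_dominated_integrable (ig) (f_g n).
have f_g' : {ae mu, forall x n, D x -> `|(f_ n x)%:E| <= (g x)%:E}%E.
  have /(@ae_foralln _ (measurableTypeR R)) : forall n, {ae mu, forall x, D x -> `|f_ n x| <= g x}.
    exact: f_g.
  by apply: ae_mono => x H n Dx /=; rewrite lee_fin H.
have f_f' : {ae mu, forall x, D x -> (f_ n x)%:E @[n --> \oo] --> (f x)%:E}.
  by move: f_f; apply: ae_mono => x H Dx; apply: cvg_EFin; [exact: nearW|exact: H].
have [intf _ cv] := @dominated_convergence _ (measurableTypeR R) R mu D mD
  (fun n x => (f_ n x)%:E) (fun x => (f x)%:E) (fun x => (g x)%:E)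
  (fun n => (measurable_EFinP _ _).2 (mf_ n)) ((measurable_EFinP _ _).2 mf)
  f_f' ig f_g'.
rewrite /Rintegral.
apply: fine_cvg; rewrite fineK//; exact: integrable_fin_num.
Qed.

(** The left endpoint is an arbitrary bound, so that one splitting serves the segments and the
    half-lines []-oo, b]] on which the Jost integrals live. *)
Lemma Rintegral_split f (c : itv_bound R) a b : (c <= BRight a)%O -> a <= b ->
  mu.-integrable [set` Interval c (BRight b)] (EFin \o f) ->
  \int[mu]_(x in [set` Interval c (BRight b)]) f x =
  \int[mu]_(x in [set` Interval c (BRight a)]) f x + \int[mu]_(x in `[a, b]) f x.
Proof.
move=> ca ab intf.
have abi : (BRight a <= BRight b :> itv_bound R)%O by rewrite bnd_simp.
have := @Rintegral_itvB R f c (BRight b) a intf ca abi.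
rewrite [in X in _ = X -> _]Rintegral_itv_obnd_cbnd; first by move=> <-; ring.
by apply: integrableS intf => //; exact: subset_itv.
Qed.

(** The bound holds almost everywhere because the potential is controlled through an essential
    supremum; it suffices to make primitives locally Lipschitz, hence continuous. *)
Definition ae_locally_bounded f :=
  forall a b, exists M : R, {ae mu, forall x, a <= x <= b -> `|f x| <= M}.

(* F' = f in the integrated form, since the potential is only measurable. *)
Definition primitive F f :=
  [/\ measurable_fun setT f, ae_locally_bounded f &
      forall a b, a <= b -> F b - F a = \int[mu]_(x in `[a, b]) f x].

Lemma cst_integrable_itv a b M :
  mu.-integrable `[a, b] (EFin \o cst M).
Proof.
apply: continuous_compact_integrable; first exact: segment_compact.
by move=> x; exact: cvg_cst.
Qed.

Lemma locally_bounded_integrable f a b : measurable_fun setT f ->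
  ae_locally_bounded f -> mu.-integrable `[a, b] (EFin \o f).
Proof.
move=> mf bf; have [M fM] := bf a b.
apply: (@ae_dominated_integrable _ _ (cst M)) => //.
- exact: measurable_funTS.
- exact: cst_integrable_itv.
Qed.

Lemma Rintegral_itv_le f a b M : measurable_fun setT f -> a <= b ->
  {ae mu, forall x, a <= x <= b -> `|f x| <= M} ->
  `|\int[mu]_(x in `[a, b]) f x| <= M * (b - a).
Proof.
move=> mf ab fM.
have -> : M * (b - a) = \int[mu]_(x in `[a, b]) (cst M x).
  rewrite (@Rintegral_cst _ (measurableTypeR R))//= lebesgue_measure_itv/= lte_fin.
  move: ab; rewrite le_eqVlt => /predU1P[->|->//].
  by rewrite ltxx/= subrr.
apply: ae_dominated_Rintegral => //.
- exact: measurable_funTS.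
- exact: cst_integrable_itv.
Qed.

Lemma primitive_lipschitz F f a b : primitive F f -> exists M : R, 0 <= M /\
  (forall x y, a <= x <= b -> a <= y <= b -> `|F x - F y| <= M * `|x - y|).
Proof.
move=> [mf bf Ff]; have [M fM] := bf a b; exists `|M|; split => //.
have key x y : a <= x -> x <= y -> y <= b -> `|F y - F x| <= `|M| * (y - x).
  move=> ax xy yb; rewrite Ff//; apply: Rintegral_itv_le => //.
  move: fM; apply: ae_mono => t H /andP[xt ty].
  apply: (le_trans (H _) (ler_norm _)).
  by rewrite (le_trans ax)//= (le_trans ty).
move=> x y /andP[ax xb] /andP[ay yb].
have [xy|yx] := leP x y.
  by rewrite (distrC (F x)) (distrC x) (@ger0_norm _ (y - x)) ?subr_ge0// key.
by have /ltW yx' := yx; rewrite (@ger0_norm _ (x - y)) ?subr_ge0// key.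
Qed.

Lemma lipschitz_continuous F :
  (forall a b, exists M : R, 0 <= M /\
    (forall x y, a <= x <= b -> a <= y <= b -> `|F x - F y| <= M * `|x - y|)) ->
  continuous F.
Proof.
move=> lF x; have [M [M0 HM]] := lF (x - 1) (x + 1).
apply/cvgrPdist_le => e e0; near=> y.
have xy : `|x - y| <= Num.min 1 (e / (M + 1)).
  near: y; apply: cvgr_dist_le; first exact: cvg_id.
  by rewrite lt_min ltr01/= divr_gt0// ltr_wpDl.
move: xy; rewrite le_min => /andP[xy1 xye].
apply: (le_trans (HM _ _ _ _)).
- by rewrite gerBl lerDl ler01.
- by move: xy1; rewrite ler_norml => /andP[? ?]; apply/andP; split; lra.
apply: (@le_trans _ _ (M * (e / (M + 1)))); first by rewrite ler_wpM2l.
rewrite mulrA ler_pdivrMr ?ltr_wpDl// mulrC ler_wpM2l ?(ltW e0)//.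
by rewrite lerDl.
Unshelve. all: by end_near. Qed.

Lemma primitive_continuous F f : primitive F f -> continuous F.
Proof. by move=> pF; apply: lipschitz_continuous => a b; exact: primitive_lipschitz pF. Qed.

Lemma continuous_measurable f : continuous f -> measurable_fun setT f.
Proof. by move=> cf; exact: continuous_measurable_fun. Qed.

Lemma continuous_locally_bounded f : continuous f -> ae_locally_bounded f.
Proof.
move=> cf a b; have [ab|ba] := leP a b; last first.
  exists 0; apply: aeW => x /andP[ax xb].
  by move: (le_lt_trans (le_trans ax xb) ba); rewrite ltxx.
have cnf : {within `[a, b], continuous (fun x => `|f x|)}.
  apply: continuous_subspaceT => x; apply: continuous_comp => //.
    exact: cf.
  exact: norm_continuous.
have [c _ H] := EVT_max ab cnf.
by exists `|f c|; apply: aeW => x xab; apply: H; rewrite in_itv.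
Qed.

Lemma primitive_derive F f :
  (forall x, is_derive x 1 F (f x)) -> continuous f -> primitive F f.
Proof.
move=> dF cf; split.
- exact: continuous_measurable.
- exact: continuous_locally_bounded.
move=> a b; rewrite le_eqVlt => /predU1P[->|ab].
  by rewrite subrr set_itv1 Rintegral_set1.
rewrite /Rintegral (@continuous_FTC2 _ _ F)//.
- exact: continuous_subspaceT.
- have cF x : {for x, continuous F}.
    by apply: differentiable_continuous; apply/derivable1_diffP; case: (dF x).
  split => [x _| |].
  + by case: (dF x).
  + exact/cvg_at_right_filter/cF.
  + exact/cvg_at_left_filter/cF.
- by move=> x _; rewrite derive1E; case: (dF x).
Qed.

Lemma primitiveD F f G g : primitive F f -> primitive G g ->
  primitive (fun x => F x + G x) (fun x => f x + g x).
Proof.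
move=> [mf bf Ff] [mg bg Gg]; split; first exact: measurable_funD.
- move=> a b; have [M fM] := bf a b; have [K gK] := bg a b.
  exists (M + K); move: (ae_and fM gK); apply: ae_mono => x [fx gx] xab.
  by rewrite (le_trans (ler_normD _ _))// lerD ?fx ?gx.
- move=> a b ab; rewrite opprD addrACA Ff// Gg// RintegralD//;
    exact: locally_bounded_integrable.
Qed.

Lemma primitiveZ c F f : primitive F f ->
  primitive (fun x => c * F x) (fun x => c * f x).
Proof.
move=> [mf bf Ff]; split; first exact: measurable_funM.
- move=> a b; have [M fM] := bf a b.
  exists (`|c| * M); move: fM; apply: ae_mono => x fx xab.
  by rewrite normrM ler_wpM2l// fx.
- move=> a b ab; rewrite -mulrBr Ff// RintegralZl//.
  exact: locally_bounded_integrable.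
Qed.

Lemma eq_primitive F G f g : F =1 G -> f =1 g -> primitive F f -> primitive G g.
Proof. by move=> /funext-> /funext->. Qed.

Lemma primitiveN F f : primitive F f ->
  primitive (fun x => - F x) (fun x => - f x).
Proof.
by move/(@primitiveZ (-1)); apply: eq_primitive => x; rewrite mulN1r.
Qed.

Lemma primitiveB F f G g : primitive F f -> primitive G g ->
  primitive (fun x => F x - G x) (fun x => f x - g x).
Proof. by move=> pF pG; apply: primitiveD => //; exact: primitiveN. Qed.

Lemma primitive_cst c : primitive (cst c) (cst 0).
Proof.
by apply: primitive_derive => x; exact: cvg_cst.
Qed.

Lemma ae_eq_primitive F f g : measurable_fun setT g ->
  {ae mu, forall x, f x = g x} -> primitive F f -> primitive F g.
Proof.
move=> mg fg [mf bf Ff]; split => //.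
- move=> a b; have [M fM] := bf a b; exists M.
  by move: (ae_and fg fM); apply: ae_mono => x [<-].
- move=> a b ab; rewrite Ff//; apply: ae_eq_Rintegral => //;
    try exact: measurable_funTS.
  by move: fg; apply: ae_mono => x ->.
Qed.

Lemma locally_boundedM f g : ae_locally_bounded f -> ae_locally_bounded g ->
  ae_locally_bounded (fun x => f x * g x).
Proof.
move=> bf bg a b; have [M fM] := bf a b; have [K gK] := bg a b.
exists (M * K); move: (ae_and fM gK); apply: ae_mono => x [fx gx] xab.
by rewrite normrM ler_pM ?fx ?gx.
Qed.

Lemma locally_boundedD f g : ae_locally_bounded f -> ae_locally_bounded g ->
  ae_locally_bounded (fun x => f x + g x).
Proof.
move=> bf bg a b; have [M fM] := bf a b; have [K gK] := bg a b.
exists (M + K); move: (ae_and fM gK); apply: ae_mono => x [fx gx] xab.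
by rewrite (le_trans (ler_normD _ _))// lerD ?fx ?gx.
Qed.

(** Bisecting an interval doubles the number of pieces but divides each quadratic bound by 4, so
    every bisection gains a factor 2. After n bisections [|D a b|] is at most K (b - a)^2 / 2^n, for
    every n. *)
Lemma additive_quadratic_eq0 (D : R -> R -> R) a b K :
  (forall x y z, a <= x -> x <= y -> y <= z -> z <= b -> D x z = D x y + D y z) ->
  (forall x y, a <= x -> x <= y -> y <= b -> `|D x y| <= K * (y - x) ^+ 2) ->
  a <= b -> D a b = 0.
Proof.
move=> Dadd Dle ab.
have halving n : forall x y, a <= x -> x <= y -> y <= b ->
    `|D x y| * 2 ^+ n <= K * (y - x) ^+ 2.
  elim: n => [|n IH] x y ax xy yb; first by rewrite expr0 mulr1 Dle.
  pose z := (x + y) / 2.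
  have xz : x <= z by rewrite /z; lra.
  have zy : z <= y by rewrite /z; lra.
  rewrite (Dadd x z y)//.
  have /(IH x z ax xz) h1 : z <= b by exact: le_trans yb.
  have /(IH z y) : a <= z by exact: le_trans xz.
  move=> /(_ zy yb) h2.
  have -> : K * (y - x) ^+ 2 = 2 * (K * (z - x) ^+ 2 + K * (y - z) ^+ 2).
    by rewrite /z; field.
  apply: (@le_trans _ _ ((`|D x z| + `|D z y|) * 2 ^+ n.+1)).
    by rewrite ler_wpM2r ?exprn_ge0// ler_normD.
  by rewrite exprS mulrCA ler_pM2l// mulrDl lerD.
apply/eqP/negPn/negP => D0.
have {}D0 : 0 < `|D a b| by rewrite normr_gt0.
pose n := Num.bound (K * (b - a) ^+ 2 / `|D a b|).
have : K * (b - a) ^+ 2 / `|D a b| < n%:R.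
  have /archi_boundP : 0 <= K * (b - a) ^+ 2 / `|D a b|.
    by rewrite divr_ge0// (le_trans _ (Dle a b _ ab _)).
  by [].
rewrite ltr_pdivrMr// => h.
have := halving n a b (lexx _) ab (lexx _).
rewrite leNgt => /negP; apply; apply: (lt_le_trans h).
by rewrite mulrC ler_wpM2l// -natrX ler_nat ltnW// ltn_expl.
Qed.

(* On an interval [x, y] the defect F G - \int (f G + F g) is additive in the
   interval and O((y - x)^2), hence zero. *)
Lemma primitiveM F f G g : primitive F f -> primitive G g ->
  primitive (fun x => F x * G x) (fun x => f x * G x + F x * g x).
Proof.
move=> pF pG; have [mf bf Ff] := pF; have [mg bg Gg] := pG.
have cF := primitive_continuous pF; have cG := primitive_continuous pG.
have mF := continuous_measurable cF; have mG := continuous_measurable cG.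
have bF := continuous_locally_bounded cF.
have bG := continuous_locally_bounded cG.
have mh : measurable_fun setT (fun x => f x * G x + F x * g x).
  by apply: measurable_funD; exact: measurable_funM.
have bh : ae_locally_bounded (fun x => f x * G x + F x * g x).
  by apply: locally_boundedD; exact: locally_boundedM.
split => // a b ab; apply/eqP; rewrite -subr_eq0; apply/eqP.
have [M fM] := bf a b; have [K gK] := bg a b.
have [LF [LF0 HF]] := primitive_lipschitz a b pF.
have [LG [LG0 HG]] := primitive_lipschitz a b pG.
have int_h x y : mu.-integrable `[x, y]
    (EFin \o (fun x => f x * G x + F x * g x)).
  exact: locally_bounded_integrable.
apply: (@additive_quadratic_eq0 (fun x y => F y * G y - F x * G x -
   \int[mu]_(t in `[x, y]) (f t * G t + F t * g t)) a b
   (`|M| * LG + LF * `|K|)) => //.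
  move=> x y z ax xy yz zb.
  by rewrite (@Rintegral_split _ (BLeft x) y z) ?bnd_simp//; ring.
move=> x y ax xy yb.
have int_c : mu.-integrable `[x, y] (EFin \o (fun t => f t * G x + F y * g t)).
  apply: locally_bounded_integrable.
    by apply: measurable_funD; exact: measurable_funM.
  apply: locally_boundedD; apply: locally_boundedM => //;
    apply: continuous_locally_bounded; exact: cst_continuous.
(* The increment is written as (F y - F x) G x + F y (G y - G x), so each density is multiplied by a
   frozen end value. A frozen value differs from the value at t by a Lipschitz constant times y - x,
   and integrating over [x, y] supplies the second factor y - x. *)
have -> : F y * G y - F x * G x = \int[mu]_(t in `[x, y]) (f t * G x + F y * g t).
  rewrite RintegralD//; first last.
  - apply: locally_bounded_integrable; first exact: measurable_funM.
    apply: locally_boundedM => //; apply: continuous_locally_bounded; exact: cst_continuous.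
  - apply: locally_bounded_integrable; first exact: measurable_funM.
    apply: locally_boundedM => //; apply: continuous_locally_bounded; exact: cst_continuous.
  rewrite RintegralZr//; last exact: locally_bounded_integrable.
  rewrite RintegralZl//; last exact: locally_bounded_integrable.
  by rewrite -Ff// -Gg//; ring.
rewrite -RintegralB//.
rewrite expr2 mulrA; apply: Rintegral_itv_le => //.
  apply: measurable_funB => //.
  by apply: measurable_funD; exact: measurable_funM.
move: (ae_and fM gK); apply: ae_mono => t [ft gt] /andP[xt ty].
have tab : a <= t <= b by rewrite (le_trans ax)//= (le_trans ty).
have xab : a <= x <= b by rewrite ax/= (le_trans xy).
have yab : a <= y <= b by rewrite yb (le_trans ax).
have -> : f t * G x + F y * g t - (f t * G t + F t * g t) =
  f t * (G x - G t) + (F y - F t) * g t by ring.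
apply: (le_trans (ler_normD _ _)); rewrite !normrM mulrDl lerD//.
  rewrite -mulrA ler_pM// ?(le_trans (ft tab) (ler_norm _))//.
  apply: (le_trans (HG _ _ xab tab)); rewrite ler_wpM2l//.
  by rewrite distrC ger0_norm ?subr_ge0// lerB.
rewrite mulrAC ler_pM// ?(le_trans (gt tab) (ler_norm _))//.
apply: (le_trans (HF _ _ yab tab)); rewrite ler_wpM2l//.
by rewrite ger0_norm ?subr_ge0// lerB.
Qed.

(** This is the way back from the integrated form to genuine derivatives, in which the Wronskian is
    defined. Near x, F is the constant F (x - 1) plus the integral of f from x - 1, so the
    fundamental theorem applies at a continuity point. *)
Lemma primitive_is_derive F f x : primitive F f -> {for x, continuous f} ->
  is_derive x 1 F (f x).
Proof.
move=> pF cf; have [mf bf Ff] := pF.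
pose a := x - 1; pose G y := \int[mu]_(t in `[a, y]) f t.
have intf : mu.-integrable `[a, x + 1] (EFin \o f).
  exact: locally_bounded_integrable.
have [||dG G'] := @continuous_FTC1_closed _ f a x (x + 1) _ intf _ cf.
- by rewrite ltrDl.
- by rewrite /a gtrBl.
have dG1 : is_derive x 1 G (f x).
  by apply: (DeriveDef dG); rewrite -derive1E; exact: G'.
have dG' : is_derive x 1 (cst (F a) + G) (f x).
  by apply: is_derive_eq; exact: add0r.
apply: near_eq_is_derive dG'; near=> y.
have /ltW ay : a < y by near: y; apply: lt_nbhsr; rewrite /a gtrBl.
have -> : (cst (F a) + G) y = F a + (F y - F a) by rewrite (Ff a y ay).
by rewrite addrC subrK.
Unshelve. all: by end_near. Qed.

Lemma integrable_primitive f : measurable_fun setT f -> ae_locally_bounded f ->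
  (forall x, mu.-integrable `]-oo, x] (EFin \o f)) ->
  primitive (fun x => \int[mu]_(y in `]-oo, x]) f y) f.
Proof.
move=> mf bf intf; split => // a b ab.
by rewrite (@Rintegral_split _ -oo%O a b)//; ring.
Qed.

(** Over [x - n, x] the integral is w x - w (x - n), which is at most w x; monotone convergence
    passes to the half-line. Dropping w (x - n) avoids computing the limit of w at minus
    infinity. *)
Lemma tail_integrable (w w' : R -> R) x : (forall y, is_derive y 1 w (w' y)) ->
  continuous w' -> (forall y, 0 <= w' y) -> (forall y, 0 <= w y) ->
  mu.-integrable `]-oo, x] (EFin \o w') /\ \int[mu]_(y in `]-oo, x]) w' y <= w x.
Proof.
move=> dw cw w'0 w0.
have pw := primitive_derive dw cw; have [mw' bw' Ww'] := pw.
have cvw : (\int[mu]_(y in `[(x - n%:R)%R, x]) (w' y)%:E)%E @[n --> \oo] -->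
    (\int[mu]_(y in `]-oo, x]) (w' y)%:E)%E.
  rewrite itvNy_bnd_bigcup_BLeft.
  apply: ge0_nondecreasing_set_cvg_integral => //.
  - move=> n m nm; apply/subsetPset; apply: subset_itvr.
    by rewrite bnd_simp lerB// ler_nat.
  - by move=> i; apply/measurable_EFinP; exact: measurable_funTS.
  - by move=> i y _; rewrite lee_fin.
have int_le : (\int[mu]_(y in `]-oo, x]) (w' y)%:E <= (w x)%:E)%E.
  apply: (cvge_le _ cvw); apply: nearW => n.
  have : mu.-integrable `[x - n%:R, x] (EFin \o w').
    exact: locally_bounded_integrable.
  move=> /integrable_fin_num-/(_ _)/fineK => <-//.
  by rewrite lee_fin -/(Rintegral _ _ _) -Ww' ?gerBl// gerBl.
split; last by rewrite /Rintegral -lee_fin fineK// ge0_fin_numE ?(le_lt_trans int_le)// ?ltry// integral_ge0// => y _; rewrite lee_fin.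
apply/integrableP; split; first by apply/measurable_EFinP; exact: measurable_funTS.
under eq_integral do rewrite /= ger0_norm//.
by rewrite (le_lt_trans int_le)// ltry.
Qed.

Lemma tail_dominated h (w w' : R -> R) M x : measurable_fun setT h ->
  (forall y, is_derive y 1 w (w' y)) ->
  continuous w' -> (forall y, 0 <= w' y) -> (forall y, 0 <= w y) ->  0 <= M ->
  {ae mu, forall y, y <= x -> `|h y| <= M * w' y} ->
  mu.-integrable `]-oo, x] (EFin \o h) /\
  `|\int[mu]_(y in `]-oo, x]) h y| <= M * w x.
Proof.
move=> mh dw cw w'0 w0 M0 hM.
have [intw lew] := tail_integrable x dw cw w'0 w0.
have intMw : mu.-integrable `]-oo, x] (EFin \o (fun y => M * w' y)).
  exact: integrable_EFinZl.
have hM' : {ae mu, forall y, `]-oo, x]%classic y -> `|h y| <= M * w' y}.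
  by move: hM; apply: ae_mono => y H; rewrite /= in_itv/= => /H.
split.
  by apply: (ae_dominated_integrable _ _ intMw) => //; exact: measurable_funTS.
apply: (le_trans (ae_dominated_Rintegral _ _ intMw _)) => //.
  exact: measurable_funTS.
by rewrite RintegralZl// ler_wpM2l.
Qed.

Lemma expR_linear_small (c e x : R) : 0 < c -> 0 < e -> exists2 z, z <= x & expR (c * z) <= e.
Proof.
move=> c0 e0; exists (Num.min x (ln e / c)); first by rewrite ge_min lexx.
rewrite -{2}(@lnK _ e) ?posrE// ler_expR -ler_pdivlMl// mulrC.
by rewrite ge_min lexx orbT.
Qed.

(** Writing F x as F z plus an integral over [z, x] and sending z to minus infinity removes F z. The
    a priori constant K and rate c therefore disappear from the conclusion: a crude decay bound on F
    is upgraded to one dictated by its derivative. This is the engine of the later bootstrap. *)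
Lemma primitive_tail_le F f (w w' : R -> R) M K c x0 : primitive F f -> 0 < c ->
  (forall y, y <= x0 -> `|F y| <= K * expR (c * y)) ->
  (forall y, is_derive y 1 w (w' y)) -> continuous w' -> (forall y, 0 <= w y) ->
  0 <= M ->
  {ae mu, forall y, y <= x0 -> `|f y| <= M * w' y} ->
  forall x, x <= x0 -> `|F x| <= M * w x.
Proof.
move=> pF c0 FK dw cw w0 M0 fM x xx0; have [mf bf Ff] := pF.
have [mw' bw' Ww'] := primitive_derive dw cw.
apply/ler_addgt0Pl => e e0.
have K0 : 0 <= K.
  by rewrite -(pmulr_lge0 _ (expR_gt0 (c * x0))) (le_trans _ (FK _ (lexx _))).
have [z zx ze] := @expR_linear_small c (e / (K + 1)) x c0 (divr_gt0 e0 (ltr_wpDl K0 ltr01)).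
have -> : F x = F z + (F x - F z) by ring.
apply: (le_trans (ler_normD _ _)); apply: lerD.
  apply: (le_trans (FK _ (le_trans zx xx0))).
  apply: (@le_trans _ _ (K * (e / (K + 1)))); first by rewrite ler_wpM2l.
  rewrite mulrA ler_pdivrMr ?ltr_wpDl// mulrC ler_wpM2l ?(ltW e0)//.
  by rewrite lerDl.
rewrite Ff//.
have intw : mu.-integrable `[z, x] (EFin \o w') by exact: locally_bounded_integrable.
apply: (@le_trans _ _ (\int[mu]_(t in `[z, x]) (M * w' t))).
  apply: ae_dominated_Rintegral => //; first exact: measurable_funTS.
    exact: integrable_EFinZl.
  move: fM; apply: ae_mono => y H; rewrite /= in_itv/= => /andP[_ yx].
  by rewrite H// (le_trans yx).
by rewrite RintegralZl// -Ww'// ler_wpM2l// gerBl.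
Qed.

End RealIntegrals.

(** * Complex-valued functions *)

Section ComplexIntegrals.
Variable R : realType.
Notation mu := (@lebesgue_measure R).
Local Notation Re := complex.Re.
Local Notation Im := complex.Im.
Implicit Types (z u v : R[i]) (F f G g h : R -> R[i]) (a b x y M K : R).

(** Equivalent to the modulus and still submultiplicative, but it splits into the two real parts, so
    that real integral estimates apply to each part. The price is the factor 2 in the bounds on
    complex integrals. *)
Definition l1norm z : R := `|Re z| + `|Im z|.

Lemma ReM z u : Re (z * u) = Re z * Re u - Im z * Im u.
Proof. by case: z u => a b [c d]. Qed.
Lemma ImM z u : Im (z * u) = Re z * Im u + Im z * Re u.
Proof. by case: z u => a b [c d]. Qed.
Lemma ReD z u : Re (z + u) = Re z + Re u.
Proof. by case: z u => a b [c d]. Qed.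
Lemma ImD z u : Im (z + u) = Im z + Im u.
Proof. by case: z u => a b [c d]. Qed.
Lemma ReN z : Re (- z) = - Re z. Proof. by case: z. Qed.
Lemma ImN z : Im (- z) = - Im z. Proof. by case: z. Qed.

Lemma complex_eq z u : Re z = Re u -> Im z = Im u -> z = u.
Proof. by case: z u => a b [c d] /= -> ->. Qed.

Lemma l1norm_ge0 z : 0 <= l1norm z. Proof. by rewrite addr_ge0. Qed.

Lemma l1normD z u : l1norm (z + u) <= l1norm z + l1norm u.
Proof. by rewrite /l1norm ReD ImD addrACA lerD// ler_normD. Qed.

Lemma l1normN z : l1norm (- z) = l1norm z.
Proof. by rewrite /l1norm ReN ImN !normrN. Qed.

Lemma l1normB z u : l1norm (z - u) <= l1norm z + l1norm u.
Proof. by rewrite -(l1normN u) l1normD. Qed.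

Lemma l1normM z u : l1norm (z * u) <= l1norm z * l1norm u.
Proof.
rewrite /l1norm ReM ImM mulrDl !mulrDr.
apply: (@le_trans _ _ ((`|Re z| * `|Re u| + `|Im z| * `|Im u|) +
   (`|Re z| * `|Im u| + `|Im z| * `|Re u|))); last by rewrite le_eqVlt; apply/orP; left; apply/eqP; ring.
by rewrite -!normrM lerD// (le_trans (ler_normD _ _))// normrN.
Qed.

Lemma l1norm_real a : l1norm a%:C = `|a|.
Proof. by rewrite /l1norm/= normr0 addr0. Qed.

Lemma l1norm_i : l1norm 'i = 1.
Proof. by rewrite /l1norm/= normr0 add0r normr1. Qed.

Lemma l1norm_eq0 z : l1norm z <= 0 -> z = 0.
Proof.
move=> z0; have := normr_ge0 (Re z); have := normr_ge0 (Im z); move: z0.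
rewrite /l1norm => h1 h2 h3; apply: complex_eq => /=; apply/eqP; rewrite -normr_le0; lra.
Qed.

Lemma ler_Re_l1norm z : `|Re z| <= l1norm z. Proof. by rewrite lerDl. Qed.
Lemma ler_Im_l1norm z : `|Im z| <= l1norm z. Proof. by rewrite lerDr. Qed.

Definition cprimitive F f :=
  primitive (fun x => Re (F x)) (fun x => Re (f x)) /\
  primitive (fun x => Im (F x)) (fun x => Im (f x)).

Lemma eq_cprimitive F G f g : F =1 G -> f =1 g -> cprimitive F f -> cprimitive G g.
Proof. by move=> /funext-> /funext->. Qed.

Lemma cprimitiveD F f G g : cprimitive F f -> cprimitive G g ->
  cprimitive (fun x => F x + G x) (fun x => f x + g x).
Proof.
move=> [rF iF] [rG iG]; split.
  by apply: eq_primitive (primitiveD rF rG) => x; rewrite ReD.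
by apply: eq_primitive (primitiveD iF iG) => x; rewrite ImD.
Qed.

Lemma cprimitiveN F f : cprimitive F f ->
  cprimitive (fun x => - F x) (fun x => - f x).
Proof.
move=> [rF iF]; split.
  by apply: eq_primitive (primitiveN rF) => x; rewrite ReN.
by apply: eq_primitive (primitiveN iF) => x; rewrite ImN.
Qed.

Lemma cprimitiveM F f G g : cprimitive F f -> cprimitive G g ->
  cprimitive (fun x => F x * G x) (fun x => f x * G x + F x * g x).
Proof.
move=> [rF iF] [rG iG]; split.
  apply: eq_primitive (primitiveB (primitiveM rF rG) (primitiveM iF iG)) => x.
    by rewrite ReM.
  by rewrite ReD !ReM; ring.
apply: eq_primitive (primitiveD (primitiveM rF iG) (primitiveM iF rG)) => x.
  by rewrite ImM.
by rewrite ImD !ImM; ring.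
Qed.

Lemma cprimitive_cst z : cprimitive (cst z) (cst 0).
Proof. by split; exact: primitive_cst. Qed.

Lemma cprimitiveZ z F f : cprimitive F f ->
  cprimitive (fun x => z * F x) (fun x => z * f x).
Proof.
move=> pF; apply: eq_cprimitive (cprimitiveM (cprimitive_cst z) pF) => x //.
by rewrite /= mul0r add0r.
Qed.

Lemma cprimitive_real (P p : R -> R) : primitive P p ->
  cprimitive (fun x => (P x)%:C) (fun x => (p x)%:C).
Proof. by move=> pP; split => //=; exact: primitive_cst. Qed.

Lemma cprimitive_cmeasurable F f : cprimitive F f -> cmeasurable F.
Proof.
by move=> [rF iF]; split; apply: continuous_measurable;
  [exact: primitive_continuous rF|exact: primitive_continuous iF].
Qed.

Lemma cmeasurableD f g : cmeasurable f -> cmeasurable g ->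
  cmeasurable (fun x => f x + g x).
Proof.
move=> [rf jf] [rg jg]; split.
  by under eq_fun do rewrite ReD; exact: measurable_funD.
by under eq_fun do rewrite ImD; exact: measurable_funD.
Qed.

Lemma cmeasurableN f : cmeasurable f -> cmeasurable (fun x => - f x).
Proof.
move=> [rf jf]; split.
  by under eq_fun do rewrite ReN; exact: measurableT_comp.
by under eq_fun do rewrite ImN; exact: measurableT_comp.
Qed.

Lemma cmeasurableM f g : cmeasurable f -> cmeasurable g ->
  cmeasurable (fun x => f x * g x).
Proof.
move=> [rf jf] [rg jg]; split.
  under eq_fun do rewrite ReM.
  by apply: measurable_funB; exact: measurable_funM.
under eq_fun do rewrite ImM.
by apply: measurable_funD; exact: measurable_funM.
Qed.

Lemma cmeasurable_cst z : cmeasurable (cst z : R -> R[i]).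
Proof. by split; exact: measurable_cst. Qed.

Lemma cmeasurable_real (p : R -> R) : measurable_fun setT p ->
  cmeasurable (fun x => (p x)%:C).
Proof. by move=> mp; split => //=; exact: measurable_cst. Qed.

Lemma measurable_l1norm f : cmeasurable f ->
  measurable_fun setT (fun x => l1norm (f x)).
Proof.
by move=> [rf jf]; apply: measurable_funD; exact: measurableT_comp.
Qed.

Lemma cintegralD D f g : measurable D -> cintegrable mu D f -> cintegrable mu D g ->
  cintegrable mu D (fun x => f x + g x) /\
  cintegral mu D (fun x => f x + g x) = cintegral mu D f + cintegral mu D g.
Proof.
move=> mD [rf jf] [rg jg]; split.
  split.
    apply: eq_integrable (integrable_EFinD mD rf rg) => //.
    by move=> x _; rewrite /= ReD.
  apply: eq_integrable (integrable_EFinD mD jf jg) => //.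
  by move=> x _; rewrite /= ImD.
rewrite /cintegral; apply: complex_eq; rewrite ?ReD ?ImD /=.
  by rewrite -RintegralD//; apply: eq_Rintegral => x _; rewrite ReD.
by rewrite -RintegralD//; apply: eq_Rintegral => x _; rewrite ImD.
Qed.

Lemma cintegralZ D z f : measurable D -> cintegrable mu D f ->
  cintegrable mu D (fun x => z * f x) /\
  cintegral mu D (fun x => z * f x) = z * cintegral mu D f.
Proof.
move=> mD [rf jf].
have i1 (a b : R) := integrable_EFinD mD (integrable_EFinZl a mD rf)
  (integrable_EFinZl b mD jf).
split.
  split.
    apply: eq_integrable (i1 (Re z) (- Im z)) => //.
    by move=> x _; rewrite /= ReM mulNr.
  apply: eq_integrable (i1 (Im z) (Re z)) => //.
  by move=> x _; rewrite /= ImM addrC.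
rewrite /cintegral; apply: complex_eq; rewrite ?ReM ?ImM /=.
  rewrite -RintegralZl// -(RintegralZl (Im z))// -RintegralB//;
    try exact: integrable_EFinZl.
  by apply: eq_Rintegral => x _; rewrite ReM.
rewrite -RintegralZl// -(RintegralZl (Im z))// -RintegralD//;
  try exact: integrable_EFinZl.
by apply: eq_Rintegral => x _; rewrite ImM.
Qed.

Lemma cintegralB D f g : measurable D -> cintegrable mu D f -> cintegrable mu D g ->
  cintegrable mu D (fun x => f x - g x) /\
  cintegral mu D (fun x => f x - g x) = cintegral mu D f - cintegral mu D g.
Proof.
move=> mD jf jg; have [jNg eNg] := cintegralZ (-1) mD jg.
have -> : (fun x => f x - g x) = (fun x => f x + -1 * g x).
  by apply/funext => x; rewrite mulN1r.
by have [? ->] := cintegralD mD jf jNg; split; rewrite // eNg mulN1r.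
Qed.

Lemma eq_cintegral (D : set R) f g : measurable D -> (forall x, D x -> f x = g x) ->
  (cintegrable mu D f -> cintegrable mu D g) /\
  cintegral mu D f = cintegral mu D g.
Proof.
move=> mD fg; split.
  by move=> [rf jf]; split; [apply: eq_integrable rf|apply: eq_integrable jf] => // x /set_mem Dx;
    rewrite /= fg.
by rewrite /cintegral; congr (_ +i* _); apply: eq_Rintegral => x /set_mem Dx;
  rewrite /= fg.
Qed.

Lemma l1norm_cintegral_le D f (g : R -> R) : measurable D -> cmeasurable f ->
  mu.-integrable D (EFin \o g) ->
  {ae mu, forall x, D x -> l1norm (f x) <= g x} ->
  cintegrable mu D f /\ l1norm (cintegral mu D f) <= 2 * \int[mu]_(x in D) g x.
Proof.
move=> mD [rf jf] ig fg.
have h1 : {ae mu, forall x, D x -> `|Re (f x)| <= g x}.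
  by apply: ae_mono fg => x H Dx; exact: le_trans (ler_Re_l1norm _) (H Dx).
have h2 : {ae mu, forall x, D x -> `|Im (f x)| <= g x}.
  by apply: ae_mono fg => x H Dx; exact: le_trans (ler_Im_l1norm _) (H Dx).
split.
  split; apply: (ae_dominated_integrable _ _ ig) => //; exact: measurable_funTS.
by rewrite /l1norm/= mulr_natl mulr2n lerD//; apply: ae_dominated_Rintegral => //;
  exact: measurable_funTS.
Qed.

Lemma ctail_dominated h (w w' : R -> R) M x : cmeasurable h ->
  (forall y, is_derive y 1 w (w' y)) ->
  continuous w' -> (forall y, 0 <= w' y) -> (forall y, 0 <= w y) ->  0 <= M ->
  {ae mu, forall y, y <= x -> l1norm (h y) <= M * w' y} ->
  cintegrable mu `]-oo, x] h /\
  l1norm (cintegral mu `]-oo, x] h) <= 2 * (M * w x).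
Proof.
move=> mh dw cw w'0 w0 M0 hM.
have [intw lew] := tail_integrable x dw cw w'0 w0.
have intMw : mu.-integrable `]-oo, x] (EFin \o (fun y => M * w' y)).
  exact: integrable_EFinZl.
have hM' : {ae mu, forall y, `]-oo, x]%classic y -> l1norm (h y) <= M * w' y}.
  by apply: ae_mono hM => y H; rewrite /= in_itv/= => /H.
have [//|? hle] := l1norm_cintegral_le _ mh intMw hM'.
split => //; apply: (le_trans hle); rewrite ler_wpM2l//.
by rewrite RintegralZl// ler_wpM2l.
Qed.

Lemma cprimitive_tail_le F f (w w' : R -> R) M K c x0 : cprimitive F f -> 0 < c ->
  (forall y, y <= x0 -> l1norm (F y) <= K * expR (c * y)) ->
  (forall y, is_derive y 1 w (w' y)) -> continuous w' -> (forall y, 0 <= w y) ->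
  0 <= M ->
  {ae mu, forall y, y <= x0 -> l1norm (f y) <= M * w' y} ->
  forall x, x <= x0 -> l1norm (F x) <= 2 * (M * w x).
Proof.
move=> [rF iF] c0 FK dw cw w0 M0 fM x xx0.
rewrite /l1norm mulr_natl mulr2n lerD//.
  apply: (primitive_tail_le rF c0 _ dw cw w0 M0 _ xx0).
    by move=> y yx0; exact: le_trans (ler_Re_l1norm _) (FK _ yx0).
  by apply: ae_mono fM => y H yx0; exact: le_trans (ler_Re_l1norm _) (H yx0).
apply: (primitive_tail_le iF c0 _ dw cw w0 M0 _ xx0).
  by move=> y yx0; exact: le_trans (ler_Im_l1norm _) (FK _ yx0).
by apply: ae_mono fM => y H yx0; exact: le_trans (ler_Im_l1norm _) (H yx0).
Qed.

Lemma cintegral_cprimitive f : cmeasurable f ->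
  ae_locally_bounded (fun x => l1norm (f x)) ->
  (forall x, cintegrable mu `]-oo, x] f) ->
  cprimitive (fun x => cintegral mu `]-oo, x] f) f.
Proof.
move=> [rf jf] bf intf; split; apply: integrable_primitive => //.
- move=> a b; have [M fM] := bf a b; exists M; apply: ae_mono fM => x H /H.
  by rewrite (ger0_norm (l1norm_ge0 _)); apply: le_trans; exact: ler_Re_l1norm.
- by move=> x; have [] := intf x.
- move=> a b; have [M fM] := bf a b; exists M; apply: ae_mono fM => x H /H.
  by rewrite (ger0_norm (l1norm_ge0 _)); apply: le_trans; exact: ler_Im_l1norm.
- by move=> x; have [] := intf x.
Qed.

Lemma cderiveE F f x : cprimitive F f ->
  {for x, continuous (fun y => Re (f y))} -> {for x, continuous (fun y => Im (f y))} ->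
  cderive F x = f x.
Proof.
move=> [rF iF] cr ci; have dr := primitive_is_derive rF cr.
have di := primitive_is_derive iF ci.
rewrite /cderive; apply: complex_eq => /=; rewrite derive1E.
  by case: dr.
by case: di.
Qed.

End ComplexIntegrals.

(** * Free solutions: the exponentials, cos (k x) and sin (k x) / k, uniformly near k = 0 *)

Section JostKernels.
Variable R : realType.
Notation mu := (@lebesgue_measure R).
Local Notation Re := complex.Re.
Local Notation Im := complex.Im.
Implicit Types (z u v k c : R[i]) (x y g : R).

Lemma cexpD z u : cexp (z + u) = cexp z * cexp u.
Proof.
case: z u => a b [c d]; rewrite /cexp /=; apply: complex_eq; rewrite !(ReM, ImM) /=;
rewrite expRD cosD sinD; ring.
Qed.

Lemma cexp0 : cexp (0 : R[i]) = 1.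
Proof. by apply: complex_eq; rewrite /cexp !(ReM, ImM) /= expR0 cos0 sin0; ring. Qed.

Lemma cexp_cprimitive c :
  cprimitive (fun x => cexp (c * x%:C)) (fun x => c * cexp (c * x%:C)).
Proof.
have cl (a : R) : continuous (fun x : R => a * x).
  by move=> x; apply: cvgM; [exact: cvg_cst|exact: cvg_id].
have ce : continuous (fun x => expR (Re c * x)).
  by move=> x; apply: continuous_comp; [exact: cl|exact: continuous_expR].
have cc : continuous (fun x => cos (Im c * x)).
  by move=> x; apply: continuous_comp; [exact: cl|exact: continuous_cos].
have cs : continuous (fun x => sin (Im c * x)).
  by move=> x; apply: continuous_comp; [exact: cl|exact: continuous_sin].
have ReE x : Re (cexp (c * x%:C)) = expR (Re c * x) * cos (Im c * x).
  by rewrite /cexp !(ReM, ImM) /= !mulr0 mul0r !subr0 add0r.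
have ImE x : Im (cexp (c * x%:C)) = expR (Re c * x) * sin (Im c * x).
  by rewrite /cexp !(ReM, ImM) /= !mulr0 mul0r !subr0 add0r addr0.
split.
  apply: (@eq_primitive _ (fun x => expR (Re c * x) * cos (Im c * x)) _
    (fun x => Re c * (expR (Re c * x) * cos (Im c * x)) - Im c * (expR (Re c * x) * sin (Im c * x)))) => [x|x|].
  - by rewrite ReE.
  - by rewrite [RHS]ReM ReE ImE.
  - apply: primitive_derive => x.
      have de : is_derive x 1 (fun x => expR (Re c * x)) (Re c * expR (Re c * x)).
        by apply: is_derive_eq; rewrite /GRing.scale/= !mulr1 mulrC.
      have dc : is_derive x 1 (fun x => cos (Im c * x)) (Im c * - sin (Im c * x)).
        by apply: is_derive_eq; rewrite /GRing.scale/= !mulr1 mulrC.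
      by apply: is_derive_eq; rewrite /GRing.scale/=; ring.
    apply: cvgB; apply: cvgM; try exact: cvg_cst; apply: cvgM;
      [exact: ce|exact: cc|exact: ce|exact: cs].
apply: (@eq_primitive _ (fun x => expR (Re c * x) * sin (Im c * x)) _
    (fun x => Re c * (expR (Re c * x) * sin (Im c * x)) + Im c * (expR (Re c * x) * cos (Im c * x)))) => [x|x|].
- by rewrite ImE.
- by rewrite [RHS]ImM ReE ImE.
- apply: primitive_derive => x.
    have de : is_derive x 1 (fun x => expR (Re c * x)) (Re c * expR (Re c * x)).
      by apply: is_derive_eq; rewrite /GRing.scale/= !mulr1 mulrC.
    have dc : is_derive x 1 (fun x => sin (Im c * x)) (Im c * cos (Im c * x)).
      by apply: is_derive_eq; rewrite /GRing.scale/= !mulr1 mulrC.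
    by apply: is_derive_eq; rewrite /GRing.scale/=; ring.
  apply: cvgD; apply: cvgM; try exact: cvg_cst; apply: cvgM;
    [exact: ce|exact: cs|exact: ce|exact: cc].
Qed.

Lemma l1norm_cexp c x : l1norm (cexp (c * x%:C)) <= 2 * expR (l1norm c * `|x|).
Proof.
rewrite /cexp (le_trans (l1normM _ _))// l1norm_real mulrC ler_pM ?l1norm_ge0//.
  by rewrite /l1norm /= (natrD _ 1 1) lerD// ler_norml ?cos_geN1 ?cos_le1 ?sin_geN1 ?sin_le1.
rewrite ger0_norm ?expR_ge0// ler_expR ReM /= mulr0 subr0.
by rewrite (le_trans (ler_norm _))// normrM ler_wpM2r// ler_Re_l1norm.
Qed.

Definition expp k x := cexp ('i * k * x%:C).
Definition expm k x := cexp (- ('i * k * x%:C)).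
Definition ccos k x : R[i] := (expp k x + expm k x) / 2%:R.

Lemma exppD k x y : expp k (x + y) = expp k x * expp k y.
Proof. by rewrite /expp -cexpD -mulrDr rmorphD. Qed.
Lemma expmD k x y : expm k (x + y) = expm k x * expm k y.
Proof. by rewrite /expm -cexpD -opprD -mulrDr rmorphD. Qed.
Lemma expmE k x : expm k x = cexp (- ('i * k) * x%:C).
Proof. by rewrite mulNr. Qed.
Lemma exppN k x : expp k (- x) = expm k x.
Proof. by rewrite /expp /expm rmorphN mulrN. Qed.
Lemma expmN k x : expm k (- x) = expp k x.
Proof. by rewrite /expp /expm rmorphN mulrN opprK. Qed.
Lemma expp_expm k x : expp k x * expm k x = 1.
Proof. by rewrite /expp /expm -cexpD subrr cexp0. Qed.
Lemma expp0k x : expp 0 x = 1.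
Proof. by rewrite /expp mulr0 mul0r cexp0. Qed.
Lemma expm0k x : expm 0 x = 1.
Proof. by rewrite /expm mulr0 mul0r oppr0 cexp0. Qed.
Lemma expp0 k : expp k 0 = 1.
Proof. by rewrite /expp mulr0 cexp0. Qed.
Lemma expm0 k : expm k 0 = 1.
Proof. by rewrite /expm mulr0 oppr0 cexp0. Qed.

Lemma sqrci : 'i * 'i = -1 :> R[i]. Proof. by rewrite -expr2 sqr_i. Qed.

Lemma ci_neq0 : 'i != 0 :> R[i].
Proof. by rewrite eq_complex /= oner_eq0 andbF. Qed.

Lemma jost_kernelE k x : k != 0 ->
  jost_kernel k x = (expp k x - expm k x) / ('i *+ 2 * k).
Proof.
move=> k0; rewrite /jost_kernel (negbTE k0) /csin /expp /expm mulrA.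
by rewrite invfM mulrA.
Qed.

Lemma expm_cprimitive k : cprimitive (expm k) (fun x => - ('i * k) * expm k x).
Proof. by apply: eq_cprimitive (cexp_cprimitive (- ('i * k))) => x; rewrite expmE. Qed.

Lemma expp_cprimitive k : cprimitive (expp k) (fun x => 'i * k * expp k x).
Proof. exact: cexp_cprimitive. Qed.

Lemma expm_ccos k x : expm k x = ccos k x - 'i * k * jost_kernel k x.
Proof.
have [->|k0] := eqVneq k 0.
  by rewrite /ccos expm0k expp0k mulr0 mul0r subr0; field.
rewrite jost_kernelE// /ccos; field.
by rewrite k0 ci_neq0.
Qed.

Lemma expp_ccos k x : expp k x = ccos k x + 'i * k * jost_kernel k x.
Proof.
have [->|k0] := eqVneq k 0.
  by rewrite /ccos expm0k expp0k mulr0 mul0r addr0; field.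
rewrite jost_kernelE// /ccos; field.
by rewrite k0 ci_neq0.
Qed.

Lemma ccos_cprimitive k : cprimitive (ccos k) (fun x => - k ^+ 2 * jost_kernel k x).
Proof.
apply: eq_cprimitive (cprimitiveZ (2%:R^-1) (cprimitiveD (expp_cprimitive k) (expm_cprimitive k))) => x.
  by rewrite mulrC.
rewrite expm_ccos expp_ccos.
by rewrite -(mulN1r (k ^+ 2)) -sqrci; field.
Qed.

Lemma jost_kernel_cprimitive k : cprimitive (jost_kernel k) (ccos k).
Proof.
have [->|k0] := eqVneq k 0.
  have pid : primitive (@id R) (cst 1).
    by apply: primitive_derive => x; exact: cvg_cst.
  apply: eq_cprimitive (cprimitive_real pid) => x.
    by rewrite /jost_kernel eqxx.
  by rewrite /ccos expm0k expp0k /= rmorph1; field.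
apply: eq_cprimitive (cprimitiveZ ('i *+ 2 * k)^-1 (cprimitiveD (expp_cprimitive k) (cprimitiveN (expm_cprimitive k)))) => x.
  by rewrite jost_kernelE// mulrC.
by rewrite /ccos; field; rewrite k0 ci_neq0.
Qed.

Lemma jost_kernelB k x y :
  jost_kernel k (y - x) = jost_kernel k y * ccos k x - ccos k y * jost_kernel k x.
Proof.
have [->|k0] := eqVneq k 0.
  by rewrite /jost_kernel eqxx /ccos !expm0k !expp0k rmorphB; field.
rewrite !jost_kernelE// exppD expmD exppN expmN /ccos.
have := expp_expm k x; have := expp_expm k y.
by move=> hy hx; field; rewrite k0 ci_neq0.
Qed.

Lemma jost_kernel0 k : jost_kernel k 0 = 0.
Proof.
have [->|k0] := eqVneq k 0; first by rewrite /jost_kernel eqxx.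
by rewrite jost_kernelE// expp0 expm0 subrr mul0r.
Qed.

Lemma l1norm_half z : l1norm (z / 2%:R) = l1norm z / 2.
Proof.
have -> : z / 2%:R = (2^-1)%:C * z by rewrite mulrC fmorphV rmorph_nat.
rewrite /l1norm ReM ImM /= !mul0r subr0 addr0 !normrM.
by rewrite ger0_norm// -mulrDr mulrC.
Qed.

(** Dividing the exponentials by k would lose uniformity at k = 0. Instead sin (k x) / k is bounded
    by integrating its derivative cos (k x) from 0, which costs a factor [|x|]; this is absorbed by
    [|x| <= g^-1 * expR (g * |x|)]. Hence the doubled rate and the term 4 / g in the constant. *)
Lemma kernel_bounds g : 0 < g -> exists A, 0 < A /\ forall k, l1norm k <= g ->
  forall x, [/\ l1norm (expp k x) <= A * expR (g * 2 * `|x|),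
    l1norm (expm k x) <= A * expR (g * 2 * `|x|),
    l1norm (ccos k x) <= A * expR (g * 2 * `|x|) &
    l1norm (jost_kernel k x) <= A * expR (g * 2 * `|x|)].
Proof.
move=> g0; exists (2 + 4 / g); have A0 : 0 < 4 / g by rewrite divr_gt0.
split=> [|k kg x]; first by rewrite addr_gt0.
have ik : l1norm ('i * k) <= g.
  by rewrite (le_trans (l1normM _ _))// l1norm_i mul1r.
have exp_le y : expR (l1norm ('i * k) * `|y|) <= expR (g * `|y|).
  by rewrite ler_expR ler_wpM2r.
have hp y : l1norm (expp k y) <= 2 * expR (g * `|y|).
  by rewrite (le_trans (l1norm_cexp _ _))// ler_wpM2l.
have hm y : l1norm (expm k y) <= 2 * expR (g * `|y|).
  by rewrite expmE (le_trans (l1norm_cexp _ _))// l1normN ler_wpM2l.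
have hc y : l1norm (ccos k y) <= 2 * expR (g * `|y|).
  rewrite /ccos l1norm_half ler_pdivrMr// (le_trans (l1normD _ _))//.
  by have := hp y; have := hm y; lra.
have gx : expR (g * `|x|) <= expR (g * 2 * `|x|).
  by rewrite ler_expR ler_wpM2r// ler_pMr// ler1n.
have weak u : l1norm u <= 2 * expR (g * `|x|) ->
    l1norm u <= (2 + 4 / g) * expR (g * 2 * `|x|).
  move=> /le_trans; apply; rewrite ler_pM ?expR_ge0//.
  by rewrite lerDl ltW.
split; try by apply: weak.
have [rS iS] := jost_kernel_cprimitive k.
have lip (F f : R -> R) : primitive F f -> F 0 = 0 ->
    (forall y, `|f y| <= 2 * expR (g * `|y|)) ->
    `|F x| <= 2 * expR (g * `|x|) * `|x|.
  move=> [mf _ Ff] F0 fle.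
  have [x0|/ltW x0] := leP 0 x.
    have -> : F x = \int[mu]_(t in `[0, x]) f t by rewrite -Ff// F0 subr0.
    rewrite (le_trans (@Rintegral_itv_le _ _ 0 x (2 * expR (g * `|x|)) mf x0 _))//.
      apply: aeW => t /andP[t0 tx]; rewrite (le_trans (fle _))// ler_wpM2l//.
      by rewrite ler_expR ler_wpM2l ?(ltW g0)// !ger0_norm// (le_trans t0).
    by rewrite subr0 (ger0_norm x0).
  have -> : F x = - \int[mu]_(t in `[x, 0]) f t by rewrite -Ff// F0 sub0r opprK.
  rewrite normrN (le_trans (@Rintegral_itv_le _ _ x 0 (2 * expR (g * `|x|)) mf x0 _))//.
    apply: aeW => t /andP[xt t0]; rewrite (le_trans (fle _))// ler_wpM2l//.
    by rewrite ler_expR ler_wpM2l ?(ltW g0)// !ler0_norm// ?lerN2// (le_trans xt).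
  by rewrite sub0r (ler0_norm x0).
have S0 := jost_kernel0 k.
have hr : `|Re (jost_kernel k x)| <= 2 * expR (g * `|x|) * `|x|.
  apply: (lip _ _ rS); first by rewrite S0.
  by move=> y; exact: le_trans (ler_Re_l1norm _) (hc y).
have hi : `|Im (jost_kernel k x)| <= 2 * expR (g * `|x|) * `|x|.
  apply: (lip _ _ iS); first by rewrite S0.
  by move=> y; exact: le_trans (ler_Im_l1norm _) (hc y).
have xle : `|x| <= g^-1 * expR (g * `|x|).
  rewrite ler_pdivlMl//; apply: le_trans (expR_ge1Dx _); by rewrite lerDr.
apply: (@le_trans _ _ (4 / g * expR (g * 2 * `|x|))); last first.
  by rewrite ler_wpM2r ?expR_ge0// lerDr.
apply: (@le_trans _ _ (4 * expR (g * `|x|) * `|x|)).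
  by rewrite /l1norm; move: hr hi; lra.
have -> : g * 2 * `|x| = g * `|x| + g * `|x| by ring.
rewrite expRD -!mulrA ler_wpM2l// mulrCA ler_wpM2l ?expR_ge0//.
Qed.

End JostKernels.

(** * The Volterra equation *)

Section Volterra.
Variable R : realType.
Notation mu := (@lebesgue_measure R).
Local Notation Re := complex.Re.
Local Notation Im := complex.Im.
Implicit Types (x y d L M : R).

Lemma geometric_increments_cvg (u : nat -> R) M :
  (forall n, `|u n.+1 - u n| <= M / 2 ^+ n) -> cvgn u.
Proof.
move=> uM.
have -> : u = (fun n => u 0%N + series (fun k => u k.+1 - u k) n).
  by apply/funext => n; rewrite seriesEnat /= telescope_sumr// addrC subrK.
apply: is_cvgD; first exact: is_cvg_cst.
apply: normed_cvg.
apply: (@series_le_cvg _ _ (geometric M (2^-1))).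
- by move=> n; exact: normr_ge0.
- move=> n; rewrite /geometric /= exprVn.
  exact: (le_trans (normr_ge0 _) (uM n)).
- by move=> n; rewrite /geometric /= exprVn; exact: uM.
- apply: is_cvg_geometric_series.
  by rewrite ger0_norm ?invr_ge0// invf_lt1// ltr1n.
Qed.

(** The real line is a countable union of half-lines []-oo, n]]. The uniqueness proof obtains in
    this way the measurability of its integrands, where the unknown solution itself is not given as
    measurable. *)
Lemma cintegrable_cmeasurable (f : R -> R[i]) :
  (forall x, cintegrable mu `]-oo, x] f) -> cmeasurable f.
Proof.
move=> intf.
have cover : [set: R] = \bigcup_n `]-oo, n%:R]%classic.
  apply/seteqP; split => // x _; exists (Num.bound `|x|) => //=.
  rewrite in_itv/= ltW// (le_lt_trans (ler_norm x))//.
  exact: archi_boundP (normr_ge0 x).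
have glue (g : R -> R) : (forall x, mu.-integrable `]-oo, x] (EFin \o g)) ->
    measurable_fun setT g.
  move=> ig; rewrite cover; apply/measurable_fun_bigcup => // n.
  by apply/measurable_EFinP; case/integrableP: (ig n%:R).
by split; apply: glue => x; case: (intf x).
Qed.

(* Picard iteration is done in the norm weighted by [weight d L], an increasing
   function with values in [1, expR L]; for L large the Volterra operator halves
   this norm. *)
Definition logistic d x : R := (1 + expR (- (d * x)))^-1.
Definition dlogistic d x : R := d * (expR (- (d * x)) * logistic d x ^+ 2).
Definition weight d L x : R := expR (L * logistic d x).
Definition dweight d L x : R := L * (dlogistic d x * weight d L x).

Lemma logistic_gt0 d x : 0 < logistic d x.
Proof. by rewrite invr_gt0 ltr_pwDl// expR_ge0. Qed.

Lemma logistic_le1 d x : logistic d x <= 1.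
Proof. by rewrite invf_le1 ?ltr_pwDl ?expR_ge0// lerDl expR_ge0. Qed.

Lemma is_derive_logistic d x : is_derive x 1 (logistic d) (dlogistic d x).
Proof.
have n0 : 1 + expR (- (d * x)) != 0 by rewrite gt_eqF// ltr_pwDl// expR_ge0.
have d1 : is_derive x 1 (fun y => 1 + expR (- (d * y))) (- d * expR (- (d * x))).
  by apply: is_derive_eq; rewrite /GRing.scale/=; ring.
have -> : dlogistic d x =
    - (1 + expR (- (d * x))) ^- 2 *: (- d * expR (- (d * x))).
  by rewrite /dlogistic /logistic exprVn /GRing.scale/=; ring.
exact: (@is_deriveV _ (fun y => 1 + expR (- (d * y)))).
Qed.

Lemma continuous_dlogistic d : continuous (dlogistic d).
Proof.
have cl : continuous (logistic d).
  by move=> x; apply: differentiable_continuous; apply/derivable1_diffP;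
    case: (is_derive_logistic d x).
move=> x; apply: cvgM; first exact: cvg_cst.
apply: cvgM; last by apply: (@continuous_comp _ _ _ (logistic d) (fun y => y ^+ 2)); [exact: cl|exact: exprn_continuous].
apply: (@continuous_comp _ _ _ (fun y => - (d * y)) expR); last exact: continuous_expR.
by apply: cvgN; apply: cvgM; [exact: cvg_cst|exact: cvg_id].
Qed.

Lemma dlogistic_ge0 d x : 0 < d -> 0 <= dlogistic d x.
Proof. by move=> d0; rewrite /dlogistic mulr_ge0 ?(ltW d0)// mulr_ge0 ?expR_ge0// sqr_ge0. Qed.

(** This comparison is what lets the derivative of the weight majorise the kernel. With t = e^(-d
    |x|) <= 1 it reduces, for either sign of x, to (1 + t)^2 <= 4. *)
Lemma expR_le_dlogistic d x : 0 < d ->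
  expR (- (d * `|x|)) <= 4 / d * dlogistic d x.
Proof.
move=> d0; have -> : 4 / d * dlogistic d x =
    4 * expR (- (d * x)) / (1 + expR (- (d * x))) ^+ 2.
  rewrite /dlogistic /logistic; field; rewrite !gt_eqF// ltr_pwDl//.
have pos (y : R) : 0 < 1 + expR y by rewrite ltr_pwDl// expR_ge0.
rewrite ler_pdivlMr ?exprn_gt0//.
have [x0|/ltW x0] := leP 0 x.
  rewrite (ger0_norm x0) mulrC ler_wpM2r ?expR_ge0//.
  have e1 : expR (- (d * x)) <= 1 by rewrite -expR0 ler_expR oppr_le0 mulr_ge0// ltW.
  have := expR_ge0 (- (d * x)).
  move: (expR _) e1 => t; nra.
rewrite (ler0_norm x0) mulrN opprK.
have := expRN (d * x); have := expR_gt0 (d * x).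
have e1 : expR (d * x) <= 1 by rewrite -expR0 ler_expR mulr_ge0_le0// ltW.
move: (expR (d * x)) e1 => t t1 t0 ->.
have -> : t * (1 + t^-1) ^+ 2 = (t + 1) ^+ 2 / t by field; rewrite gt_eqF.
rewrite ler_pM2r ?invr_gt0//; nra.
Qed.

Lemma weight_ge1 d L x : 0 <= L -> 1 <= weight d L x.
Proof.
by move=> L0; rewrite -expR0 ler_expR mulr_ge0// ltW// logistic_gt0.
Qed.

Lemma weight_le d L x : 0 <= L -> weight d L x <= expR L.
Proof. by move=> L0; rewrite ler_expR ler_piMr// logistic_le1. Qed.

Lemma is_derive_weight d L x : is_derive x 1 (weight d L) (dweight d L x).
Proof.
have dl := is_derive_logistic d x.
have d1 : is_derive x 1 (fun y => L * logistic d y) (L * dlogistic d x).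
  by apply: is_derive_eq; rewrite /GRing.scale/=; ring.
have -> : dweight d L x = expR (L * logistic d x) * (L * dlogistic d x).
  by rewrite /dweight /weight; ring.
exact: (@is_derive1_comp _ expR (fun y => L * logistic d y)).
Qed.

Lemma continuous_dweight d L : continuous (dweight d L).
Proof.
move=> x; apply: cvgM; first exact: cvg_cst.
apply: cvgM; first exact: continuous_dlogistic.
by apply: differentiable_continuous; apply/derivable1_diffP;
  case: (is_derive_weight d L x).
Qed.

Lemma dweight_ge0 d L x : 0 < d -> 0 <= L -> 0 <= dweight d L x.
Proof.
by move=> d0 L0; rewrite mulr_ge0// mulr_ge0 ?expR_ge0// dlogistic_ge0.
Qed.

Section Equation.
Variables (U : R -> R) (A B eta delta : R) (s c f0 : R -> R[i]).
Hypotheses (A0 : 0 < A) (B0 : 0 <= B) (delta0 : 0 < delta).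
Hypotheses (mU : measurable_fun setT U) (ms : cmeasurable s) (mc : cmeasurable c)
  (mf0 : cmeasurable f0).
Hypothesis U_le : {ae mu, forall y, `|U y| <= B * expR (- ((eta *+ 2 + delta) * `|y|))}.
Hypotheses (s_le : forall x, l1norm (s x) <= A * expR (eta * `|x|))
  (c_le : forall x, l1norm (c x) <= A * expR (eta * `|x|))
  (f0_le : forall x, l1norm (f0 x) <= A * expR (eta * `|x|)).

(** The factor 4 / delta comes from [expR_le_dlogistic], the factor 1 / L from integrating the
    derivative of the weight. The Picard operator then contracts by 16 A^2 B / (delta L); the
    uniqueness argument contracts by 32 A^2 B / (delta L), and asking for 1/2 there gives 64. Adding
    1 keeps L positive when B = 0. *)
Let L := 64 * A ^+ 2 * B / delta + 1.
Let w := weight delta L.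
Let w' := dweight delta L.

Let L0 : 0 < L.
Proof.
by rewrite ltr_wpDl// divr_ge0 ?(ltW delta0)// mulr_ge0// mulr_ge0// sqr_ge0.
Qed.

Let LB : 64 * A ^+ 2 * B / delta <= L. Proof. by rewrite lerDl. Qed.

(* The kernel s (y - x) = s y * c x - c y * s x separates the variables, where
   c and s are cos (k x) and sin (k x) / k; s and c are abstract here. *)
Definition volterra_moment (g f : R -> R[i]) x :=
  cintegral mu `]-oo, x] (fun y => g y * (U y)%:C * f y).

Definition volterra (f : R -> R[i]) x :=
  s x * volterra_moment c f x - c x * volterra_moment s f x.

(** Balance of exponents: the kernel and f each grow at rate eta, U decays at rate 2 eta + delta,
    and decay at rate delta remains. *)
Let integrand_le g f Q y : 0 <= Q ->
  l1norm (g y) <= A * expR (eta * `|y|) ->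
  `|U y| <= B * expR (- ((eta *+ 2 + delta) * `|y|)) ->
  l1norm (f y) <= Q * expR (eta * `|y|) ->
  l1norm (g y * (U y)%:C * f y) <= A * B * Q * expR (- (delta * `|y|)).
Proof.
move=> Q0 gy Uy fy.
rewrite (le_trans (l1normM _ _))//.
have -> : A * B * Q * expR (- (delta * `|y|)) =
  (A * expR (eta * `|y|) * (B * expR (- ((eta *+ 2 + delta) * `|y|)))) *
  (Q * expR (eta * `|y|)).
  have -> : - (delta * `|y|) = eta * `|y| + - ((eta *+ 2 + delta) * `|y|) +
     eta * `|y| by ring.
  by rewrite !expRD; ring.
rewrite ler_pM ?l1norm_ge0// (le_trans (l1normM _ _))// ler_pM ?l1norm_ge0//.
by rewrite l1norm_real.
Qed.

Let moment g f Q : 0 <= Q -> cmeasurable g -> cmeasurable f ->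
  (forall y, l1norm (g y) <= A * expR (eta * `|y|)) ->
  (forall y, l1norm (f y) <= Q * expR (eta * `|y|) * w y) ->
  (forall x, cintegrable mu `]-oo, x] (fun y => g y * (U y)%:C * f y) /\
    l1norm (volterra_moment g f x) <= 8 * A * B * Q / (delta * L) * w x) /\
  cprimitive (volterra_moment g f) (fun y => g y * (U y)%:C * f y).
Proof.
move=> Q0 mg mf g_le f_le.
have mh : cmeasurable (fun y => g y * (U y)%:C * f y).
  by apply: cmeasurableM => //; apply: cmeasurableM => //; exact: cmeasurable_real.
have h_le : {ae mu, forall y, l1norm (g y * (U y)%:C * f y) <=
    A * B * Q * expR (- (delta * `|y|)) * w y}.
  apply: ae_mono U_le => y Uy.
  have -> : A * B * Q * expR (- (delta * `|y|)) * w y =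
     A * B * (Q * w y) * expR (- (delta * `|y|)) by ring.
  apply: integrand_le => //; first by rewrite mulr_ge0// expR_ge0.
  by have := f_le y; rewrite mulrAC.
have int x : cintegrable mu `]-oo, x] (fun y => g y * (U y)%:C * f y) /\
    l1norm (volterra_moment g f x) <= 8 * A * B * Q / (delta * L) * w x.
  have := @ctail_dominated R (fun y => g y * (U y)%:C * f y) w w'
    (4 * A * B * Q / (delta * L)) x mh (is_derive_weight delta L)
    (@continuous_dweight delta L) (fun y => dweight_ge0 y delta0 (ltW L0))
    (fun y => expR_ge0 _).
  case.
  - by rewrite divr_ge0 ?mulr_ge0// ltW.
  - apply: ae_mono h_le => y H _; apply: (le_trans H).
    have -> : 4 * A * B * Q / (delta * L) * w' y =
       A * B * Q * (4 / delta * dlogistic delta y) * w y.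
      by rewrite /w' /dweight -/w; field; rewrite !gt_eqF.
    rewrite ler_wpM2r ?expR_ge0// ler_wpM2l ?expR_le_dlogistic// !mulr_ge0//.
    exact: ltW.
  move=> i1 i2; split => //; apply: (le_trans i2).
  by rewrite le_eqVlt; apply/orP; left; apply/eqP; field; rewrite !gt_eqF.
split => //; apply: cintegral_cprimitive => //; last by move=> x; case: (int x).
move=> a b; exists (A * B * Q * expR L).
apply: ae_mono h_le => y H _; rewrite ger0_norm ?l1norm_ge0//.
apply: (le_trans H); rewrite ler_pM ?expR_ge0//; last exact/weight_le/ltW.
  by rewrite mulr_ge0 ?expR_ge0// !mulr_ge0// ltW.
rewrite ler_piMr ?mulr_ge0 ?(ltW A0)//.
by rewrite -expR0 ler_expR oppr_le0 mulr_ge0// ltW.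
Qed.

Let volterra_half f Q : 0 <= Q -> cmeasurable f ->
  (forall y, l1norm (f y) <= Q * expR (eta * `|y|) * w y) ->
  cmeasurable (volterra f) /\
  forall y, l1norm (volterra f y) <= Q / 2 * expR (eta * `|y|) * w y.
Proof.
move=> Q0 mf f_le.
have [cb cp] := moment Q0 mc mf c_le f_le.
have [sb sp] := moment Q0 ms mf s_le f_le.
split.
  apply: cmeasurableD; first by apply: cmeasurableM => //; exact: cprimitive_cmeasurable cp.
  apply: cmeasurableN; apply: cmeasurableM => //; exact: cprimitive_cmeasurable sp.
move=> y; have [_ cy] := cb y; have [_ sy] := sb y.
rewrite (le_trans (l1normB _ _))//.
have e0 : 0 <= A * expR (eta * `|y|) by rewrite mulr_ge0 ?expR_ge0// ltW.
apply: (@le_trans _ _ (A * expR (eta * `|y|) * (8 * A * B * Q / (delta * L) * w y) +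
  A * expR (eta * `|y|) * (8 * A * B * Q / (delta * L) * w y))).
  by rewrite lerD// (le_trans (l1normM _ _))// ler_pM ?l1norm_ge0.
have -> : A * expR (eta * `|y|) * (8 * A * B * Q / (delta * L) * w y) +
  A * expR (eta * `|y|) * (8 * A * B * Q / (delta * L) * w y) =
  (64 * A ^+ 2 * B / delta / L) * (Q / 4 * expR (eta * `|y|) * w y).
  by field; rewrite !gt_eqF.
have Q4 : 0 <= Q / 4 * expR (eta * `|y|) * w y.
  by rewrite !mulr_ge0 ?expR_ge0// ?invr_ge0.
apply: (@le_trans _ _ (1 * (Q / 4 * expR (eta * `|y|) * w y))).
  by rewrite ler_wpM2r// ler_pdivrMr// mul1r.
by rewrite mul1r !ler_wpM2r ?expR_ge0// ler_wpM2l// lef_pV2// ?posrE// ler_nat.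
Qed.

Let volterraB f g Q : 0 <= Q -> cmeasurable f -> cmeasurable g ->
  (forall y, l1norm (f y) <= Q * expR (eta * `|y|) * w y) ->
  (forall y, l1norm (g y) <= Q * expR (eta * `|y|) * w y) ->
  forall x, volterra (fun y => f y - g y) x = volterra f x - volterra g x.
Proof.
move=> Q0 mf mg f_le g_le x.
have key h : cmeasurable h -> (forall y, l1norm (h y) <= A * expR (eta * `|y|)) ->
    volterra_moment h (fun y => f y - g y) x =
    volterra_moment h f x - volterra_moment h g x.
  move=> mh h_le; have [hf _] := moment Q0 mh mf h_le f_le.
  have [hg _] := moment Q0 mh mg h_le g_le.
  have [//|_ <-] := cintegralB _ (hf x).1 (hg x).1.
  apply: (@eq_cintegral _ `]-oo, x]%classic _ _ _ _).2 => // y _.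
  by rewrite mulrBr.
by rewrite /volterra !key//; ring.
Qed.

Fixpoint picard n : R -> R[i] :=
  if n is m.+1 then fun x => f0 x + volterra (picard m) x else f0.

Let A2 : 0 <= A * 2. Proof. by rewrite mulr_ge0// ltW. Qed.

(** The constant 2 A is the fixed point of Q -> A + Q / 2, so the bound reproduces itself at each
    iteration. *)
Let picard_bound n : cmeasurable (picard n) /\
  forall y, l1norm (picard n y) <= A * 2 * expR (eta * `|y|) * w y.
Proof.
have base y : l1norm (f0 y) <= A * expR (eta * `|y|) * w y.
  apply: (le_trans (f0_le y)); rewrite ler_peMr ?weight_ge1 ?(ltW L0)//.
  by rewrite mulr_ge0 ?expR_ge0// ltW.
elim: n => [|n [mn IH]].
  split => // y; apply: (le_trans (base y)).
  by rewrite !ler_wpM2r ?expR_ge0// ler_peMr ?ltW// ltr1n.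
have [mv vb] := volterra_half A2 mn IH.
split; first exact: cmeasurableD.
move=> y /=; rewrite (le_trans (l1normD _ _))//.
have := lerD (base y) (vb y); move/le_trans; apply.
by rewrite le_eqVlt; apply/orP; left; apply/eqP; field.
Qed.

Let picard_diff n y :
  l1norm (picard n.+1 y - picard n y) <= (A / 2 ^+ n) * expR (eta * `|y|) * w y.
Proof.
elim: n y => [|n IH] y.
  rewrite /= addrAC subrr add0r.
  have [mv vb] := volterra_half A2 (picard_bound 0).1 (picard_bound 0).2.
  by have := vb y; rewrite expr0 divr1 mulfK.
have -> : picard n.+2 y - picard n.+1 y =
    volterra (fun y => picard n.+1 y - picard n y) y.
  rewrite (volterraB A2 (picard_bound _).1 (picard_bound _).1 (picard_bound _).2 (picard_bound _).2).
  by rewrite [LHS]/=; ring.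
have Q0 : 0 <= A / 2 ^+ n by rewrite divr_ge0 ?exprn_ge0// ltW.
have [|_ h] := volterra_half Q0 _ IH.
  by apply: cmeasurableD; [exact: (picard_bound _).1|apply: cmeasurableN; exact: (picard_bound _).1].
by have := h y; rewrite exprSr invfM mulrA.
Qed.

(** The increments of the Picard iterates are geometric at each point, so their limit exists and is
    measurable. The equation passes to the limit by dominated convergence, a multiple of the
    derivative of the weight being the majorant. As the weight lies between 1 and [expR L], it
    disappears from the final bound. *)
Lemma volterra_exists : exists f : R -> R[i], [/\ cmeasurable f,
  forall y, l1norm (f y) <= A * 2 * expR L * expR (eta * `|y|),
  (forall g, cmeasurable g -> (forall y, l1norm (g y) <= A * expR (eta * `|y|)) ->
     (forall x, cintegrable mu `]-oo, x] (fun y => g y * (U y)%:C * f y)) /\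
     cprimitive (volterra_moment g f) (fun y => g y * (U y)%:C * f y)) &
  forall x, f x = f0 x + volterra f x].
Proof.
pose M y := A * expR (eta * `|y|) * w y.
have dM n y : l1norm (picard n.+1 y - picard n y) <= M y / 2 ^+ n.
  have := picard_diff n y; rewrite /M; congr (_ <= _).
  by field; rewrite gt_eqF// exprn_gt0.
have cRe y : cvgn (fun n => Re (picard n y)).
  apply: (@geometric_increments_cvg _ (M y)) => n.
  by rewrite -ReN -ReD (le_trans (ler_Re_l1norm _) (dM n y)).
have cIm y : cvgn (fun n => Im (picard n y)).
  apply: (@geometric_increments_cvg _ (M y)) => n.
  by rewrite -ImN -ImD (le_trans (ler_Im_l1norm _) (dM n y)).
pose f y := limn (fun n => Re (picard n y)) +i* limn (fun n => Im (picard n y)).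
have mf : cmeasurable f.
  split.
    apply: (@measurable_fun_cvg _ _ _ _ (fun n y => Re (picard n y))).
      by move=> n; exact: (picard_bound n).1.1.
    by move=> y _; exact: cRe.
  apply: (@measurable_fun_cvg _ _ _ _ (fun n y => Im (picard n y))).
    by move=> n; exact: (picard_bound n).1.2.
  by move=> y _; exact: cIm.
have f_le y : l1norm (f y) <= A * 2 * expR (eta * `|y|) * w y.
  have cl : (fun n => l1norm (picard n y)) @ \oo --> l1norm (f y).
    by apply: cvgD; apply: cvg_norm; [exact: cRe|exact: cIm].
  apply: (cvgr_to_le cl); apply: nearW => n; exact: (picard_bound n).2.
exists f; split => //.
- move=> y; rewrite (le_trans (f_le y))// mulrAC ler_wpM2r ?expR_ge0//.
  by rewrite ler_wpM2l//; exact/weight_le/ltW.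
- move=> g mg g_le; have [gb gp] := moment A2 mg mf g_le f_le.
  by split => // x; exact: (gb x).1.
have mom g x : cmeasurable g -> (forall y, l1norm (g y) <= A * expR (eta * `|y|)) ->
    (fun n => Re (volterra_moment g (picard n) x)) @ \oo --> Re (volterra_moment g f x) /\
    (fun n => Im (volterra_moment g (picard n) x)) @ \oo --> Im (volterra_moment g f x).
  move=> mg g_le.
  have mh h : cmeasurable h -> cmeasurable (fun y => g y * (U y)%:C * h y).
    by move=> mh; apply: cmeasurableM => //; apply: cmeasurableM => //; exact: cmeasurable_real.
  pose D y := 4 * A * B * (A * 2) / (delta * L) * w' y.
  have iD : mu.-integrable `]-oo, x] (EFin \o D).
    apply: integrable_EFinZl => //.
    have [//] := @tail_integrable R w w' x (is_derive_weight delta L)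
      (@continuous_dweight delta L) (fun y => dweight_ge0 y delta0 (ltW L0))
      (fun y => expR_ge0 _).
  have dom n : {ae mu, forall y, l1norm (g y * (U y)%:C * picard n y) <= D y}.
    apply: ae_mono U_le => y Uy.
    have := @integrand_le g (picard n) (A * 2 * w y) y _ (g_le y) Uy _.
    have -> : D y = A * B * (A * 2) * (4 / delta * dlogistic delta y) * w y.
      by rewrite /D /w' /dweight -/w; field; rewrite !gt_eqF.
    move=> /(_ _ _)/le_trans; apply.
    - by rewrite mulr_ge0// expR_ge0.
    - by rewrite mulrAC; exact: (picard_bound n).2.
    have -> : A * B * (A * 2 * w y) * expR (- (delta * `|y|)) =
      A * B * (A * 2) * expR (- (delta * `|y|)) * w y by ring.
    rewrite ler_wpM2r ?expR_ge0// ler_wpM2l ?expR_le_dlogistic//.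
    by rewrite !mulr_ge0// ltW.
  split; apply: (@dominated_cvg_Rintegral _ `]-oo, x]%classic _ _ D) => //.
  - by move=> n; apply: measurable_funTS; exact: (mh _ (picard_bound n).1).1.
  - by apply: measurable_funTS; exact: (mh _ mf).1.
  - apply: aeW => y _; rewrite ReM.
    under eq_fun do rewrite ReM.
    by apply: cvgB; apply: cvgM; try exact: cvg_cst; [exact: cRe|exact: cIm].
  - move=> n; apply: ae_mono (dom n) => y H _.
    exact: le_trans (ler_Re_l1norm _) H.
  - by move=> n; apply: measurable_funTS; exact: (mh _ (picard_bound n).1).2.
  - by apply: measurable_funTS; exact: (mh _ mf).2.
  - apply: aeW => y _; rewrite ImM.
    under eq_fun do rewrite ImM.
    by apply: cvgD; apply: cvgM; try exact: cvg_cst; [exact: cIm|exact: cRe].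
  - move=> n; apply: ae_mono (dom n) => y H _.
    exact: le_trans (ler_Im_l1norm _) H.
move=> x; have [cr ci] := mom c x mc c_le; have [sr si] := mom s x ms s_le.
apply: complex_eq.
  have h1 : (fun n => Re (picard n.+1 x)) @ \oo --> Re (f0 x + volterra f x).
    rewrite ReD ReD ReN !ReM.
    under eq_fun do rewrite /= /volterra !ReD ReN !ReM.
    apply: cvgD; first exact: cvg_cst.
    by apply: cvgB; apply: cvgB; apply: cvgM => //; exact: cvg_cst.
  apply: (@cvg_unique _ _ ((fun n => Re (picard n.+1 x)) @ \oo)) => //.
  have h2 : (fun n => Re (picard n x)) @ \oo --> Re (f x) := cRe x.
  by rewrite -(cvg_shiftS (fun n => Re (picard n x))) in h2.
have h1 : (fun n => Im (picard n.+1 x)) @ \oo --> Im (f0 x + volterra f x).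
  rewrite ImD ImD ImN !ImM.
  under eq_fun do rewrite /= /volterra !ImD ImN !ImM.
  apply: cvgD; first exact: cvg_cst.
  by apply: cvgB; apply: cvgD; apply: cvgM => //; exact: cvg_cst.
apply: (@cvg_unique _ _ ((fun n => Im (picard n.+1 x)) @ \oo)) => //.
have h2 : (fun n => Im (picard n x)) @ \oo --> Im (f x) := cIm x.
  by rewrite -(cvg_shiftS (fun n => Im (picard n x))) in h2.
Qed.

(* h may grow arbitrarily, but the integrability of the two integrands makes
   G x = \int_(y <= x) g y finite, and the contraction applies to G. *)
Lemma volterra_unique (h : R -> R[i]) :
  (forall x, cintegrable mu `]-oo, x] (fun y => c y * (U y)%:C * h y)) ->
  (forall x, cintegrable mu `]-oo, x] (fun y => s y * (U y)%:C * h y)) ->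
  (forall x, h x = volterra h x) -> forall x, h x = 0.
Proof.
move=> ic is_ hE X.
pose g y := l1norm (c y * (U y)%:C * h y) + l1norm (s y * (U y)%:C * h y).
have mc' := cintegrable_cmeasurable ic; have ms' := cintegrable_cmeasurable is_.
have il (k : R -> R[i]) x : cintegrable mu `]-oo, x] k ->
    mu.-integrable `]-oo, x] (EFin \o (fun y => l1norm (k y))).
  by move=> [rk jk]; apply: integrable_EFinD => //; exact: integrable_norm.
have ig x : mu.-integrable `]-oo, x] (EFin \o g).
  by apply: integrable_EFinD => //; apply: il.
have mg : measurable_fun setT g.
  by apply: measurable_funD; exact: measurable_l1norm.
have g_ge0 y : 0 <= g y by rewrite addr_ge0 ?l1norm_ge0.
pose G x := \int[mu]_(y in `]-oo, x]) g y.
have G_ge0 x : 0 <= G x by apply: Rintegral_ge0 => y _.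
have hG x : l1norm (h x) <= 4 * A * expR (eta * `|x|) * G x.
  have mle k : cmeasurable (fun y => k y * (U y)%:C * h y) ->
      cintegrable mu `]-oo, x] (fun y => k y * (U y)%:C * h y) ->
      (forall y, l1norm (k y * (U y)%:C * h y) <= g y) ->
      l1norm (volterra_moment k h x) <= 2 * G x.
    move=> mk' ik kg.
    have [//||//] := @l1norm_cintegral_le R `]-oo, x]%classic
      (fun y => k y * (U y)%:C * h y) g _ mk' (ig x).
    by apply: aeW => y _; exact: kg.
  rewrite hE (le_trans (l1normB _ _))//.
  have -> : 4 * A * expR (eta * `|x|) * G x =
    A * expR (eta * `|x|) * (2 * G x) + A * expR (eta * `|x|) * (2 * G x) by ring.
  rewrite lerD// (le_trans (l1normM _ _))// ler_pM ?l1norm_ge0// mle// => y.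
    by rewrite lerDl l1norm_ge0.
  by rewrite lerDr l1norm_ge0.
have gG : {ae mu, forall y, g y <= 8 * A ^+ 2 * B * expR (- (delta * `|y|)) * G y}.
  apply: ae_mono U_le => y Uy.
  have -> : 8 * A ^+ 2 * B * expR (- (delta * `|y|)) * G y =
    A * B * (4 * A * G y) * expR (- (delta * `|y|)) +
    A * B * (4 * A * G y) * expR (- (delta * `|y|)) by ring.
  have Q0 : 0 <= 4 * A * G y by rewrite !mulr_ge0// ltW.
  by rewrite lerD// integrand_le// mulrAC.
have Gmono y : y <= X -> G y <= G X.
  move=> yX; rewrite /G (@Rintegral_split _ _ -oo%O y X)//.
  by rewrite lerDl; apply: Rintegral_ge0 => t _.
(* Each round inserts the current bound on G into the inequality for g and integrates against the
   weight, gaining a factor 1/2; it starts from the monotonicity of G. If G X were positive, 2^n <=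
   w X would follow for every n. *)
have step n : forall y, y <= X -> G y <= G X / 2 ^+ n * w y.
  elim: n => [|n IH] y yX.
    rewrite expr0 divr1 (le_trans (Gmono _ yX))// ler_peMr//.
    by rewrite weight_ge1// ltW.
  pose Mn := 32 * A ^+ 2 * B / (delta * L) * (G X / 2 ^+ n).
  have Mn0 : 0 <= Mn.
    by rewrite !mulr_ge0 ?sqr_ge0 ?invr_ge0 ?exprn_ge0// ?mulr_ge0// ltW.
  have [|_] := @tail_dominated R g w w' Mn y mg (is_derive_weight delta L)
    (@continuous_dweight delta L) (fun y => dweight_ge0 y delta0 (ltW L0))
      (fun y => expR_ge0 _) Mn0.
    apply: ae_mono gG => t gt ty; rewrite ger0_norm//; apply: (le_trans gt).
    have -> : Mn * w' t = 8 * A ^+ 2 * B * (4 / delta * dlogistic delta t) *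
      (G X / 2 ^+ n * w t).
      rewrite /Mn /w' /dweight -/w; field.
      by rewrite !gt_eqF// exprn_gt0.
    have AB0 : 0 <= 8 * A ^+ 2 * B by rewrite mulr_ge0// mulr_ge0// sqr_ge0.
    rewrite ler_pM//; first by rewrite mulr_ge0// expR_ge0.
      by rewrite ler_wpM2l// expR_le_dlogistic.
    exact: IH (le_trans ty yX).
  rewrite ger0_norm ?G_ge0//; move=> /le_trans; apply.
  rewrite ler_wpM2r ?expR_ge0//.
  have -> : Mn = (64 * A ^+ 2 * B / delta / L) * (G X / 2 ^+ n.+1).
    by rewrite /Mn (exprS 2 n); field; rewrite !gt_eqF// exprn_gt0.
  rewrite ler_piMl ?divr_ge0 ?exprn_ge0//.
  by rewrite ler_pdivrMr// mul1r.
have GX0 : G X <= 0.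
  rewrite leNgt; apply/negP => GX.
  have bound n : 2 ^+ n <= w X.
    have := step n X (lexx _).
    rewrite mulrAC ler_pdivlMr ?exprn_gt0//.
    by rewrite ler_pM2l.
  have := archi_boundP (expR_ge0 (L * logistic delta X)).
  rewrite -/(weight _ _ _) -/w => h1.
  have := bound (Num.bound (w X)); rewrite leNgt => /negP; apply.
  by apply: (lt_le_trans h1); rewrite -natrX ler_nat ltnW// ltn_expl.
apply: l1norm_eq0; apply: (le_trans (hG X)).
have : G X = 0 by apply/eqP; rewrite eq_le GX0 G_ge0.
by move=> ->; rewrite mulr0.
Qed.

End Equation.
End Volterra.

(** * Jost solutions *)

Section JostMinus.
Variable R : realType.
Notation mu := (@lebesgue_measure R).
Local Notation Re := complex.Re.
Local Notation Im := complex.Im.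
Implicit Types (x y : R) (k : R[i]) (U : R -> R).

Lemma is_derive_exp_scaled (c x : R) : 0 < c ->
  is_derive x 1 (fun y => expR (c * y) / c) (expR (c * x)).
Proof.
move=> c0; have de : is_derive x 1 (fun y => expR (c * y)) (c * expR (c * x)).
  by apply: is_derive_eq; rewrite /GRing.scale/= !mulr1 mulrC.
by apply: is_derive_eq; rewrite /GRing.scale/=; field; rewrite gt_eqF.
Qed.

Lemma continuous_exp_scaled (c : R) : continuous (fun y => expR (c * y)).
Proof.
move=> x; apply: (@continuous_comp _ _ _ (fun y => c * y) expR); last exact: continuous_expR.
by apply: cvgM; [exact: cvg_cst|exact: cvg_id].
Qed.

Lemma ctail_exp (h : R -> R[i]) (M c x : R) : cmeasurable h -> 0 < c -> 0 <= M ->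
  {ae mu, forall y, y <= x -> l1norm (h y) <= M * expR (c * y)} ->
  cintegrable mu `]-oo, x] h /\
  l1norm (cintegral mu `]-oo, x] h) <= 2 * M / c * expR (c * x).
Proof.
move=> mh c0 M0 hM.
have [|i1 i2] := @ctail_dominated R h (fun y => expR (c * y) / c) (fun y => expR (c * y)) M x mh
  (fun y => is_derive_exp_scaled y c0) (@continuous_exp_scaled c) (fun y => expR_ge0 _) _ M0 hM.
  by move=> y; rewrite divr_ge0 ?expR_ge0 ?ltW.
by split => //; apply: (le_trans i2); rewrite mulrA mulrA mulrAC.
Qed.

Lemma cprimitive_tail_exp (F f : R -> R[i]) (M K c c' x0 : R) : cprimitive F f ->
  0 < c -> 0 < c' -> 0 <= M ->
  (forall y, y <= x0 -> l1norm (F y) <= K * expR (c' * y)) ->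
  {ae mu, forall y, y <= x0 -> l1norm (f y) <= M * expR (c * y)} ->
  forall x, x <= x0 -> l1norm (F x) <= 2 * M / c * expR (c * x).
Proof.
move=> pF c0 c'0 M0 FK fM x xx0.
have w0 y : 0 <= expR (c * y) / c by rewrite divr_ge0 ?expR_ge0 ?ltW.
have := @cprimitive_tail_le R F f (fun y => expR (c * y) / c) (fun y => expR (c * y))
  M K c' x0 pF c'0 FK (fun y => is_derive_exp_scaled y c0) (@continuous_exp_scaled c) w0 M0 fM x xx0.
by move/le_trans; apply; rewrite mulrA mulrA mulrAC.
Qed.

(** If the kernel vanished on all positive reals, so would its derivative cos (k x) at 1; both
    exponentials would then vanish there, although their product is 1. *)
Lemma jost_kernel_neq0 k : exists2 d, 0 < d & jost_kernel k d != 0.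
Proof.
apply: contrapT => H.
have s0 d : 0 < d -> jost_kernel k d = 0.
  by move=> d0; apply/eqP/negPn/negP => sd; apply: H; exists d.
have [rS iS] := jost_kernel_cprimitive k.
have [rC iC] := ccos_cprimitive k.
have key (F f : R -> R) : primitive F f -> continuous f ->
    (forall d, 0 < d -> F d = 0) -> f 1 = 0.
  move=> pF cf F0; have dF := primitive_is_derive pF (cf 1).
  have d0 : is_derive (1 : R) 1 F 0.
    apply: (@near_eq_is_derive _ _ _ (cst 0)).
      near=> t; rewrite F0//; near: t.
      exact: lt_nbhsr.
  by rewrite -(@derive_val _ _ _ _ _ _ _ dF) (@derive_val _ _ _ _ _ _ _ d0).
have c1 : ccos k 1 = 0.
  apply: complex_eq.
    by apply: (key _ _ rS) => [|d d0]; [exact: primitive_continuous rC|rewrite s0].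
  by apply: (key _ _ iS) => [|d d0]; [exact: primitive_continuous iC|rewrite s0].
have := expp_expm k 1; rewrite expp_ccos expm_ccos c1 s0// mulr0 subr0 addr0 mul0r.
by move=> /esym/eqP; rewrite oner_eq0.
Unshelve. all: by end_near. Qed.

Lemma cintegrable_subset (D E : set R) (f : R -> R[i]) : measurable D -> measurable E ->
  E `<=` D -> cintegrable mu D f -> cintegrable mu E f.
Proof. by move=> mD mE ED [rf jf]; split; [exact: (@integrableS _ (measurableTypeR R) R mu D E _ mD mE ED rf)|exact: (@integrableS _ (measurableTypeR R) R mu D E _ mD mE ED jf)]. Qed.

(* is_jost_minus only gives the integrability of the combinations
   jost_kernel k (y - x) * U y * f y; those at the points x and x + d with
   jost_kernel k d != 0 determine the two moments. *)
Lemma is_jost_minus_moments k U f : is_jost_minus mu U k f -> forall x,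
  [/\ cintegrable mu `]-oo, x] (fun y => ccos k y * (U y)%:C * f y),
      cintegrable mu `]-oo, x] (fun y => jost_kernel k y * (U y)%:C * f y) &
      f x = expm k x + volterra U (jost_kernel k) (ccos k) f x].
Proof.
move=> jf x.
have [d d0 sd] := jost_kernel_neq0 k.
have i0 := (jf x).1.
have i1 : cintegrable mu `]-oo, x]
    (fun y => jost_kernel k (y - (x + d)) * (U y)%:C * f y).
  apply: cintegrable_subset (jf (x + d)).1 => //.
  by apply: subset_itvl; rewrite bnd_simp lerDl ltW.
have lin (a b : R[i]) : cintegrable mu `]-oo, x] (fun y =>
    a * (jost_kernel k (y - x) * (U y)%:C * f y) +
    b * (jost_kernel k (y - (x + d)) * (U y)%:C * f y)).
  have [//|ia _] := cintegralZ a _ i0; have [//|ib _] := cintegralZ b _ i1.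
  by have [] := cintegralD _ ia ib.
(* The kernels based at x and at x + d are linear combinations of the two functions of y to be
   integrated. By the addition formula the determinant of this system is [jost_kernel k d], whatever
   x is, and Cramer's rule gives the coefficients used below. *)
have sE : jost_kernel k (x + d) * ccos k x - jost_kernel k x * ccos k (x + d) = jost_kernel k d.
  by rewrite mulrC [X in _ - X]mulrC mulrC (mulrC _ (ccos _ x)) (mulrC (ccos _ (x + d)))
    (mulrC (ccos _ x)) (mulrC (jost_kernel _ x)) -jost_kernelB addrC addKr.
have ic : cintegrable mu `]-oo, x] (fun y => ccos k y * (U y)%:C * f y).
  apply: (eq_cintegral _ _).1 (lin (ccos k (x + d) / jost_kernel k d) (- ccos k x / jost_kernel k d)).
    by [].
  move=> y _; rewrite -sE in sd *; rewrite !jost_kernelB; field.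
  by [].
have is_ : cintegrable mu `]-oo, x] (fun y => jost_kernel k y * (U y)%:C * f y).
  apply: (eq_cintegral _ _).1 (lin (jost_kernel k (x + d) / jost_kernel k d) (- jost_kernel k x / jost_kernel k d)).
    by [].
  move=> y _; rewrite -sE in sd *; rewrite !jost_kernelB; field.
  by [].
split => //.
rewrite {1}(jf x).2 /volterra /volterra_moment; congr (_ + _).
have [//|j1 e1] := cintegralZ (ccos k x) _ is_.
have [//|j2 e2] := cintegralZ (jost_kernel k x) _ ic.
have [//|_ e3] := cintegralB _ j2 j1.
rewrite -e1 -e2 -e3 -(mulN1r (cintegral _ _ _)).
have [//|_ <-] := cintegralZ (-1) _ i0.
apply: (eq_cintegral _ _).2 => // y _; rewrite jost_kernelB; ring.
Qed.

Lemma moments_is_jost_minus k U f :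
  (forall x, cintegrable mu `]-oo, x] (fun y => ccos k y * (U y)%:C * f y)) ->
  (forall x, cintegrable mu `]-oo, x] (fun y => jost_kernel k y * (U y)%:C * f y)) ->
  (forall x, f x = expm k x + volterra U (jost_kernel k) (ccos k) f x) ->
  is_jost_minus mu U k f.
Proof.
move=> ic is_ fE x.
have [//|j1 e1] := cintegralZ (ccos k x) _ (is_ x).
have [//|j2 e2] := cintegralZ (jost_kernel k x) _ (ic x).
have [//|j3 e3] := cintegralB _ j1 j2.
have [i0 e0] : (cintegrable mu `]-oo, x] (fun y => jost_kernel k (y - x) * (U y)%:C * f y)) /\
   cintegral mu `]-oo, x] (fun y => jost_kernel k (y - x) * (U y)%:C * f y) =
   ccos k x * volterra_moment U (jost_kernel k) f x -
   jost_kernel k x * volterra_moment U (ccos k) f x.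
  have pt y : `]-oo, x]%classic y ->
    ccos k x * (jost_kernel k y * (U y)%:C * f y) -
    jost_kernel k x * (ccos k y * (U y)%:C * f y) =
    jost_kernel k (y - x) * (U y)%:C * f y by move=> _; rewrite jost_kernelB; ring.
  have [//|t1 t2] := eq_cintegral _ pt.
  by split; [exact: t1|rewrite -t2 e3 e1 e2].
move=> F; split => //; rewrite [cintegral _ _ F]e0 {1}fE /volterra /expm; ring.
Qed.

(** The equivalence with [is_jost_minus] turns the choice made by [xget] into a characterisation.
    The functions a and b are the coefficients of variation of constants; they allow the solution to
    be differentiated without differentiating an integral whose kernel depends on x. The rates are
    those of a potential decaying at 8 eta with kernel and solution growing at eta. One constant Q
    serves all admissible k and U. *)
Theorem jost_minus_solution (eta B : R) : 0 < eta -> 0 <= B ->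
  exists Q, 1 <= Q /\ forall k U, l1norm k <= eta / 2 -> measurable_fun setT U ->
  {ae mu, forall y, `|U y| <= B * expR (- (8 * eta * `|y|))} ->
  [/\ forall g, is_jost_minus mu U k g <-> g = jost_minus mu U k,
    forall y, l1norm (jost_minus mu U k y) <= Q * expR (eta * `|y|),
    forall y, [/\ l1norm (expp k y) <= Q * expR (eta * `|y|),
      l1norm (expm k y) <= Q * expR (eta * `|y|),
      l1norm (ccos k y) <= Q * expR (eta * `|y|) &
      l1norm (jost_kernel k y) <= Q * expR (eta * `|y|)] &
    exists a b : R -> R[i], [/\
      cprimitive a (fun y => ccos k y * (U y)%:C * jost_minus mu U k y),
      cprimitive b (fun y => jost_kernel k y * (U y)%:C * jost_minus mu U k y),
      forall y, l1norm (a y) <= Q * expR (6 * eta * y),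
      forall y, l1norm (b y) <= Q * expR (6 * eta * y) &
      forall y, jost_minus mu U k y =
        expm k y + jost_kernel k y * a y - ccos k y * b y]].
Proof.
move=> eta0 B0; have [A [A0 kb]] := @kernel_bounds R (eta / 2) (divr_gt0 eta0 (ltr0Sn _ 1)).
have d0 : 0 < 6 * eta by rewrite mulr_gt0.
pose L := 64 * A ^+ 2 * B / (6 * eta) + 1.
pose P := A * 2 * expR L.
have P0 : 0 < P by rewrite !mulr_gt0// expR_gt0.
have AP : A <= P + 1.
  rewrite ler_wpDr// /P -mulrA ler_peMr ?(ltW A0)//.
  have L0 : 0 <= L by rewrite addr_ge0// divr_ge0 ?(ltW d0)// mulr_ge0// mulr_ge0// sqr_ge0.
  by have := expR_ge1Dx L; lra.
(* Q exceeds A, which bounds the kernels, P, which bounds the solution, and the tail constant 2 A B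
   P / (6 eta) of the moments. *)
pose Q := P + 1 + 2 * (A * B * P) / (6 * eta).
have Q1 : P + 1 <= Q by rewrite lerDl divr_ge0 ?(ltW d0)// !mulr_ge0// ltW.
exists Q; split; first by rewrite (le_trans _ Q1)// lerDr ltW.
move=> k U kle mU Ule.
have kb' y : [/\ l1norm (expp k y) <= A * expR (eta * `|y|),
      l1norm (expm k y) <= A * expR (eta * `|y|),
      l1norm (ccos k y) <= A * expR (eta * `|y|) &
      l1norm (jost_kernel k y) <= A * expR (eta * `|y|)].
  by have := kb k kle y; rewrite divfK.
have mc := cprimitive_cmeasurable (ccos_cprimitive k).
have ms := cprimitive_cmeasurable (jost_kernel_cprimitive k).
have me := cprimitive_cmeasurable (expm_cprimitive k).
have Ule' : {ae mu, forall y, `|U y| <= B * expR (- ((eta *+ 2 + 6 * eta) * `|y|))}.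
  apply: ae_mono Ule => y /le_trans; apply; rewrite le_eqVlt; apply/orP; left.
  by apply/eqP; congr (_ * expR _); ring.
have s_le y : l1norm (jost_kernel k y) <= A * expR (eta * `|y|) by case: (kb' y).
have c_le y : l1norm (ccos k y) <= A * expR (eta * `|y|) by case: (kb' y).
have e_le y : l1norm (expm k y) <= A * expR (eta * `|y|) by case: (kb' y).
have [f [mf f_le fmom fE]] := @volterra_exists R U A B eta (6 * eta)
  (jost_kernel k) (ccos k) (expm k) A0 B0 d0 mU ms mc me Ule' s_le c_le e_le.
have [ic pc] := fmom _ mc c_le; have [is_ ps] := fmom _ ms s_le.
have jf : is_jost_minus mu U k f by exact: moments_is_jost_minus.
have fu g : is_jost_minus mu U k g -> g = f.
  move=> jg; have gm x := is_jost_minus_moments jg x.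
  have igc x : cintegrable mu `]-oo, x] (fun y => ccos k y * (U y)%:C * g y) by case: (gm x).
  have igs x : cintegrable mu `]-oo, x] (fun y => jost_kernel k y * (U y)%:C * g y) by case: (gm x).
  have gE x : g x = expm k x + volterra U (jost_kernel k) (ccos k) g x by case: (gm x).
  have mom (h : R -> R[i]) x : cintegrable mu `]-oo, x] (fun y => h y * (U y)%:C * g y) ->
      cintegrable mu `]-oo, x] (fun y => h y * (U y)%:C * f y) ->
      cintegrable mu `]-oo, x] (fun y => h y * (U y)%:C * (g y - f y)) /\
      volterra_moment U h (fun y => g y - f y) x =
      volterra_moment U h g x - volterra_moment U h f x.
    move=> ig jf'; have [//|i e] := cintegralB _ ig jf'.
    have pt y : `]-oo, x]%classic y -> h y * (U y)%:C * g y - h y * (U y)%:C * f y =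
      h y * (U y)%:C * (g y - f y) by move=> _; rewrite mulrBr.
    have [//|t1 t2] := eq_cintegral _ pt.
    by split; [exact: t1|rewrite /volterra_moment -t2].
  have := @volterra_unique R U A B eta (6 * eta) (jost_kernel k) (ccos k)
    A0 B0 d0 Ule' s_le c_le (fun y => g y - f y).
  move=> H; apply/funext => x; apply/eqP; rewrite -subr_eq0; apply/eqP; apply: H => {}x.
  - by have [] := mom _ x (igc x) (ic x).
  - by have [] := mom _ x (igs x) (is_ x).
  - rewrite /volterra (mom _ x (igc x) (ic x)).2 (mom _ x (igs x) (is_ x)).2.
    by rewrite {1}gE {1}fE /volterra; ring.
have -> : jost_minus mu U k = f.
  apply: fu; rewrite /jost_minus.
  by apply: (@xgetPex _ (fun=> 0) [set f | is_jost_minus mu U k f]); exists f.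
have weaken (u : R[i]) y : l1norm u <= A * expR (eta * `|y|) ->
    l1norm u <= Q * expR (eta * `|y|).
  move=> /le_trans; apply; rewrite ler_wpM2r ?expR_ge0//.
  exact: le_trans AP Q1.
have tail g : cmeasurable g -> (forall y, l1norm (g y) <= A * expR (eta * `|y|)) ->
    forall x, l1norm (volterra_moment U g f x) <= Q * expR (6 * eta * x).
  move=> mg g_le x.
  have [||||_] := @ctail_exp (fun y => g y * (U y)%:C * f y) (A * B * P) (6 * eta) x.
  - by apply: cmeasurableM => //; apply: cmeasurableM => //; exact: cmeasurable_real.
  - exact: d0.
  - by rewrite !mulr_ge0// ltW.
  - apply: ae_mono Ule => y Uy _.
    apply: (@le_trans _ _ ((A * expR (eta * `|y|)) * (B * expR (- (8 * eta * `|y|))) *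
       (P * expR (eta * `|y|)))).
      rewrite (le_trans (l1normM _ _))// ler_pM ?l1norm_ge0// (le_trans (l1normM _ _))//.
      by rewrite ler_pM ?l1norm_ge0// l1norm_real.
    have -> : (A * expR (eta * `|y|)) * (B * expR (- (8 * eta * `|y|))) *
       (P * expR (eta * `|y|)) = A * B * P * expR (- (6 * eta * `|y|)).
      have -> : - (6 * eta * `|y|) = eta * `|y| - 8 * eta * `|y| + eta * `|y| by ring.
      by rewrite !expRD; ring.
    rewrite ler_wpM2l//; first by rewrite !mulr_ge0// ltW.
    rewrite ler_expR -mulrN ler_wpM2l ?(ltW d0)// lerNl.
    by rewrite -normrN ler_norm.
  - move/le_trans; apply; rewrite ler_wpM2r ?expR_ge0//.
    by rewrite lerDr addr_ge0// ltW.
split.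
- by move=> g; split => [/fu|->].
- move=> y; apply: (le_trans (f_le y)); rewrite ler_wpM2r ?expR_ge0//.
  by rewrite -/L -/P (le_trans _ Q1)// lerDl.
- by move=> y; have [? ? ? ?] := kb' y; split; apply: weaken.
- exists (volterra_moment U (ccos k) f), (volterra_moment U (jost_kernel k) f).
split => //; [exact: tail|exact: tail|].
by move=> y; rewrite {1}fE /volterra addrA.
Qed.

End JostMinus.

(** * Asymptotics of the Jost solution *)

Section Asymptotics.
Variable R : realType.
Notation mu := (@lebesgue_measure R).
Local Notation Re := complex.Re.
Local Notation Im := complex.Im.
Implicit Types (x y : R) (k : R[i]) (U p r : R -> R).

Ltac nonneg := repeat first [done | assumption | apply: addr_ge0 | apply: mulr_ge0 |
  apply: sqr_ge0 | apply: exprn_ge0 | apply: expR_ge0 | apply: l1norm_ge0 |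
  apply: normr_ge0 | apply: ltW; assumption ].

(** Bookkeeping weight: multiplying estimates adds the numbers c, so the growth of each product of
    factors is read off from a sum of integers. A nonpositive c is finally converted by [T_le] into
    a one-sided weight that decays at minus infinity. *)
Let T (eta c y : R) : R := expR (c * (eta * `|y|)).

Let TD eta c d y : T eta c y * T eta d y = T eta (c + d) y.
Proof. by rewrite /T mulrDl expRD. Qed.

Let T_le eta c d y : 0 < eta -> 0 <= d -> c + d <= 0 -> T eta c y <= expR (d * eta * y).
Proof.
move=> eta0 d0 cd; rewrite ler_expR.
have h1 : - `|y| <= y by rewrite lerNl -normrN ler_norm.
have ey : 0 <= eta * `|y| by rewrite mulr_ge0// ltW.
have h2 : - (eta * `|y|) <= eta * y by rewrite -mulrN ler_wpM2l// ltW.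
have : d * (- (eta * `|y|)) <= d * (eta * y) by rewrite ler_wpM2l.
have : 0 <= - (c + d) * (eta * `|y|) by rewrite mulr_ge0// oppr_ge0.
rewrite -mulrA; nra.
Qed.

Let T_le1 eta c y : 0 < eta -> c <= 0 -> T eta c y <= 1.
Proof.
by move=> eta0 c0; rewrite -expR0 ler_expR mulr_le0_ge0// mulr_ge0// ltW.
Qed.

(** For y <= 0 the exponents add up to exactly 4 eta y. On [0, 1] the excess is at most 4 eta, which
    is the constant in front; this is why the estimates are confined to y <= 1. *)
Let T2_le eta y : 0 < eta -> y <= 1 ->
  T eta 2 y * expR (6 * eta * y) <= expR (4 * eta) * expR (4 * eta * y).
Proof.
move=> eta0 y1; rewrite -!expRD ler_expR.
have [y0|y0] := leP 0 y.
  by rewrite ger0_norm//; nra.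
by rewrite ltr0_norm//; nra.
Qed.

Let E6_le eta y : 0 < eta -> y <= 1 ->
  expR (6 * eta * y) <= expR (4 * eta) * expR (4 * eta * y).
Proof. by move=> eta0 y1; rewrite -!expRD ler_expR; nra. Qed.

Lemma cprimitive_increment (F f : R -> R[i]) (M x : R) : cprimitive F f -> `|x| <= 1 ->
  (forall y, `|y| <= 1 -> l1norm (f y) <= M) -> l1norm (F x - F 0) <= 2 * M.
Proof.
move=> [pr_ pi_] x1 fM.
have M0 : 0 <= M by rewrite (le_trans (l1norm_ge0 _) (fM 0 _))// normr0.
have key (G g : R -> R) : primitive G g -> (forall y, `|y| <= 1 -> `|g y| <= M) ->
    `|G x - G 0| <= M.
  move=> [mg _ Gg] gM.
  have bnd a b : a <= b -> -1 <= a -> b <= 1 -> b - a <= 1 -> `|G b - G a| <= M.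
    move=> ab a1 b1 ba; rewrite Gg//.
    rewrite (le_trans (@Rintegral_itv_le _ _ a b M mg ab _))//.
      apply: aeW => y /andP[ay yb]; apply: gM.
      by rewrite ler_norml (le_trans a1 ay) (le_trans yb b1).
    by rewrite ler_piMr.
  move: x1; rewrite ler_norml => /andP[x1 x2].
  have [x0|/ltW x0] := leP 0 x; first by rewrite bnd// ?subr0// lerN10.
  by rewrite distrC bnd// sub0r lerNl.
rewrite /l1norm !ReD !ImD !ReN !ImN mulr_natl mulr2n lerD//.
  by apply: (key _ _ pr_) => y y1; exact: le_trans (ler_Re_l1norm _) (fM y y1).
by apply: (key _ _ pi_) => y y1; exact: le_trans (ler_Im_l1norm _) (fM y y1).
Qed.

Let l1norm3 (u v w : R[i]) : l1norm (- u - v + w) <= l1norm u + l1norm v + l1norm w.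
Proof.
by rewrite (le_trans (l1normD _ _))// lerD2r (le_trans (l1normB _ _))// l1normN.
Qed.

(** The two precisions differ on purpose: in the Wronskian the error in f - 1 is multiplied by
    quantities of size e^2, so O(e) is enough, whereas f' - p f enters directly and must be known up
    to O(e^3). The point x0 will be 1 for one Jost solution and -1 for the reflection of the
    other. *)
Theorem jost_minus_asymptotics (eta B K : R) : 0 < eta -> 0 <= B -> 0 <= K ->
  exists C e0, [/\ 0 <= C, 0 < e0 & forall e k U p r x0, 0 < e -> e < e0 ->
    l1norm k <= K * e ^+ 2 ->
    measurable_fun setT U -> measurable_fun setT r ->
    {ae mu, forall y, `|U y| <= B * expR (- (8 * eta * `|y|))} ->
    primitive p (fun y => U y + r y) ->
    (forall y, `|p y| <= B * e * expR (- (8 * eta * `|y|))) ->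
    {ae mu, forall y, `|r y| <= B * e ^+ 3 * expR (- (8 * eta * `|y|))} ->
    `|x0| <= 1 ->
    (forall g, is_jost_minus mu U k g <-> g = jost_minus mu U k) /\
    exists f' f'', [/\ cprimitive (jost_minus mu U k) f', cprimitive f' f'',
      l1norm (jost_minus mu U k x0 - 1) <= C * e &
      l1norm (f' x0 - (p x0)%:C * jost_minus mu U k x0 + 'i * k +
        (\int[mu]_(y in `]-oo, x0]) (p y ^+ 2))%:C) <= C * e ^+ 3]].
Proof.
move=> eta0 B0 K0; have [Q [Q1 sol]] := @jost_minus_solution R eta B eta0 B0.
have half_eta : eta / 2 <= eta by lra.
have Q0 : 0 <= Q by exact: le_trans Q1.
pose D := expR (4 * eta).
have D0 : 0 <= D by exact: expR_ge0.
(* [V0], [V1], [V2] bound V at orders 1, e and e^2; [N1] bounds N at order e; [S] and [W] bound F'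
   and F at order e^3; [Z] bounds e^(i k x0) - 1 at order e^2; [C1] bounds f - 1 at order e. Each
   quotient by a rate comes from one use of [cprimitive_tail_exp]. *)
pose V0 := Q + eta * Q + Q ^+ 2 * B.
have V00 : 0 <= V0 by nonneg.
pose M1 := Q ^+ 2 * (B + B ^+ 2 + 2 * K * B).
have M10 : 0 <= M1 by nonneg.
pose V1 := 2 * (B * V0 + M1) / (6 * eta).
have e6 : 0 < 6 * eta by rewrite mulr_gt0.
have e4 : 0 < 4 * eta by rewrite mulr_gt0.
have V10 : 0 <= V1 by apply: divr_ge0; nonneg.
pose V2 := 2 * (B * V1 + M1) / (6 * eta).
have V20 : 0 <= V2 by apply: divr_ge0; nonneg.
pose N1 := 2 * (Q ^+ 2 * V2 * D + B * Q ^+ 2) / (4 * eta).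
have N10 : 0 <= N1 by apply: divr_ge0; nonneg.
pose S := B * V2 * D + N1 * B ^+ 2 + 2 * K * Q ^+ 2 * B ^+ 2 + Q ^+ 2 * B + 2 * K * B * Q ^+ 2.
have S0 : 0 <= S by nonneg.
pose W := 2 * S / (4 * eta).
have W0 : 0 <= W by apply: divr_ge0; nonneg.
pose Z := 2 * (K * (Q * expR eta)).
have Z0 : 0 <= Z by nonneg.
pose C1 := Q * expR eta * (N1 * D) + Z * (Q * expR eta + 1).
have C10 : 0 <= C1 by nonneg.
pose C := C1 + (Z * (V2 * expR (6 * eta)) + W * D + K * C1).
have C0 : 0 <= C by nonneg.
(* For e below this threshold K e^2 <= (K + 1) e <= eta / 2, so k lies in the range where the Jost
   solution has been constructed. *)
pose e0 := Num.min 1 (eta / (2 * (K + 1))).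
exists C, e0; split => //.
  by rewrite lt_min ltr01 divr_gt0// mulr_gt0// ltr_wpDl.
move=> e k U p r x0 epos; rewrite lt_min => /andP[e1 eK] kle mU mr Ule pU ple rle x01.
have ege := ltW epos; have e1' := ltW e1.
have ee : e ^+ 2 <= e by rewrite expr2 ler_piMl.
have eee : e ^+ 3 <= e ^+ 2 by rewrite exprS ler_piMl// sqr_ge0.
have e20 : 0 <= e ^+ 2 by rewrite sqr_ge0.
have e30 : 0 <= e ^+ 3 by rewrite exprn_ge0.
have k_small : l1norm k <= eta / 2.
  apply: (le_trans kle); apply: (@le_trans _ _ ((K + 1) * e)).
    by rewrite ler_pM// lerDl.
  have K1 : 0 < K + 1 by rewrite ltr_wpDl.
  rewrite mulrC -ler_pdivlMr// (le_trans (ltW eK))// le_eqVlt; apply/orP; left.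
  by apply/eqP; field; rewrite gt_eqF.
have [jf f_le kb [a [b [pa pb a_le b_le fE]]]] := sol k U k_small mU Ule.
set f := jost_minus mu U k in jf f_le pa pb fE *.
pose ik : R[i] := 'i * k.
have ik_le : l1norm ik <= K * e ^+ 2.
  by rewrite (le_trans (l1normM _ _))// l1norm_i mul1r.
pose ep := expp k; pose em := expm k; pose c := ccos k; pose s := jost_kernel k.
have epm x : ep x * em x = 1 by exact: expp_expm.
have emE x : em x = c x - ik * s x by exact: expm_ccos.
have epE x : ep x = c x + ik * s x by exact: expp_ccos.
have kE : k ^+ 2 = - (ik * ik) by rewrite /ik mulrACA sqrci mulN1r opprK expr2.
pose P x : R[i] := (p x)%:C.
(* As in variation of constants, the terms s a' and c b' cancel in the derivative, both being c s U
   f. *)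
pose f' x : R[i] := - ik * em x + c x * a x + k ^+ 2 * (s x * b x).
have pep : cprimitive ep (fun x => ik * ep x) by exact: expp_cprimitive.
have pem : cprimitive em (fun x => - ik * em x) by exact: expm_cprimitive.
have pc : cprimitive c (fun x => - k ^+ 2 * s x) by exact: ccos_cprimitive.
have ps : cprimitive s c by exact: jost_kernel_cprimitive.
have pP : cprimitive P (fun x => (U x + r x)%:C) by exact: cprimitive_real.
have pf : cprimitive f f'.
  apply: eq_cprimitive (cprimitiveD (cprimitiveD pem (cprimitiveM ps pa))
    (cprimitiveN (cprimitiveM pc pb))) => x.
    by rewrite fE.
  by rewrite /f' -/(c x) -/(s x); ring.
have [f'' pf'] : exists f'', cprimitive f' f''.
  by eexists; exact: (cprimitiveD (cprimitiveD (cprimitiveZ (- ik) pem)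
    (cprimitiveM pc pa)) (cprimitiveZ (k ^+ 2) (cprimitiveM ps pb))).
(* The operator d/dx + i k annihilates the free wave e^(-ikx), so only the moments remain; they
   vanish at minus infinity, which lets the tail estimates start. *)
have f'E x : f' x + ik * f x = ep x * (a x - ik * b x).
  by rewrite fE /f' -/(em x) -/(c x) -/(s x) epE kE; ring.
(* V = em * (f' - p f + i k f), whose derivative V' does not contain U. *)
pose V x : R[i] := a x - ik * b x - em x * P x * f x.
pose V' x : R[i] := - (P x * V x) - em x * f x * ((r x)%:C + P x * P x) + 2%:R * ik * P x * (em x * f x).
have abE x : a x - ik * b x = V x + em x * P x * f x by rewrite /V subrK.
have emf' x : em x * f' x = V x + em x * P x * f x - ik * (em x * f x).
  have : em x * (f' x + ik * f x) = V x + em x * P x * f x.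
    by rewrite f'E mulrA (mulrC (em x)) epm mul1r abE.
  rewrite mulrDr => <-; rewrite (mulrCA (em x)) addrK.
  by [].
have pV : cprimitive V V'.
  apply: eq_cprimitive (cprimitiveD (cprimitiveD pa (cprimitiveN (cprimitiveZ ik pb)))
      (cprimitiveN (cprimitiveM (cprimitiveM pem pP) pf))) => x; first by [].
  rewrite rmorphD -/(c x) -/(s x).
  have -> : c x * (U x)%:C * f x = (em x + ik * s x) * (U x)%:C * f x by rewrite emE; ring.
  have -> : em x * P x * f' x = P x * (em x * f' x) by ring.
  by rewrite emf' /V'; ring.
have le_k8 y : T eta (-8) y = expR (- (8 * eta * `|y|)) by rewrite /T mulNr mulrA.
have tk y : T eta 1 y = expR (eta * `|y|) by rewrite /T mul1r.
have f_T y : l1norm (f y) <= Q * T eta 1 y by rewrite tk.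
have ep_T y : l1norm (ep y) <= Q * T eta 1 y by rewrite tk; case: (kb y).
have em_T y : l1norm (em y) <= Q * T eta 1 y by rewrite tk; case: (kb y).
have c_T y : l1norm (c y) <= Q * T eta 1 y by rewrite tk; case: (kb y).
have s_T y : l1norm (s y) <= Q * T eta 1 y by rewrite tk; case: (kb y).
have P_T y : l1norm (P y) <= B * e * T eta (-8) y by rewrite le_k8 l1norm_real.
have r_T : {ae mu, forall y, l1norm (r y)%:C <= B * e ^+ 3 * T eta (-8) y}.
  by apply: ae_mono rle => y; rewrite le_k8 l1norm_real.
have T_ge0 d y : 0 <= T eta d y by exact: expR_ge0.
have mul_T u v (M N d d' y : R) : l1norm u <= M * T eta d y -> l1norm v <= N * T eta d' y ->
    l1norm (u * v) <= M * N * T eta (d + d') y.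
  move=> uM vN; rewrite (le_trans (l1normM _ _))// -TD.
  have -> : M * N * (T eta d y * T eta d' y) = (M * T eta d y) * (N * T eta d' y) by ring.
  by rewrite ler_pM ?l1norm_ge0.
have emf_T y : l1norm (em y * f y) <= Q ^+ 2 * T eta 2 y.
  by rewrite expr2; apply: mul_T.
have epf_T y : l1norm (ep y * f y) <= Q ^+ 2 * T eta 2 y.
  by rewrite expr2; apply: mul_T.
have PP_T y : l1norm (P y * P y) <= B ^+ 2 * e ^+ 2 * T eta (-8) y.
  apply: (@le_trans _ _ (B * e * (B * e) * T eta (-8 + -8) y)); first exact: mul_T.
  have -> : B * e * (B * e) = B ^+ 2 * e ^+ 2 by ring.
  rewrite ler_wpM2l//; first by nonneg.
  by rewrite -TD ler_piMl// T_le1// lerN10.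
have kP_T y : l1norm (2%:R * ik * P y) <= 2 * K * B * e ^+ 3 * T eta (-8) y.
  have -> : 2%:R * ik * P y = (ik * P y) + (ik * P y) by ring.
  have h : l1norm (ik * P y) <= K * e ^+ 2 * (B * e * T eta (-8) y).
    by rewrite (le_trans (l1normM _ _))// ler_pM ?l1norm_ge0.
  rewrite (le_trans (l1normD _ _))// (le_trans (lerD h h))// le_eqVlt; apply/orP; left.
  by apply/eqP; ring.
(* A bound O(1) on V gives O(eps), and then O(eps^2). *)
have V'_le (M : R) : 0 <= M -> (forall y, y <= 1 -> l1norm (V y) <= M * expR (6 * eta * y)) ->
    {ae mu, forall y, y <= 1 -> l1norm (V' y) <= (B * M * e + M1 * e ^+ 2) * expR (6 * eta * y)}.
  move=> M0 VM; apply: ae_mono r_T => y ry y1.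
  rewrite /V' (le_trans (l1norm3 _ _ _))//.
  have h1 : l1norm (P y * V y) <= B * M * e * expR (6 * eta * y).
    rewrite (le_trans (l1normM _ _))//.
    have -> : B * M * e * expR (6 * eta * y) = (B * e) * (M * expR (6 * eta * y)) by ring.
    rewrite ler_pM ?l1norm_ge0 ?VM// (le_trans (P_T y))// ler_piMr//; first by nonneg.
    by rewrite T_le1.
  have h2 : l1norm (em y * f y * ((r y)%:C + P y * P y)) <=
      Q ^+ 2 * (B + B ^+ 2) * e ^+ 2 * expR (6 * eta * y).
    apply: (@le_trans _ _ (Q ^+ 2 * ((B + B ^+ 2) * e ^+ 2) * T eta (2 + -8) y)).
      apply: mul_T => //; rewrite (le_trans (l1normD _ _))// (le_trans (lerD ry (PP_T y)))//.
      rewrite -mulrDl ler_wpM2r// [leRHS]mulrDl lerD// ler_wpM2l//.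
    rewrite mulrA ler_wpM2l//; first by nonneg.
    by apply: T_le => //; lra.
  have h3 : l1norm (2%:R * ik * P y * (em y * f y)) <=
      Q ^+ 2 * (2 * K * B) * e ^+ 2 * expR (6 * eta * y).
    apply: (@le_trans _ _ ((2 * K * B * e ^+ 3) * Q ^+ 2 * T eta (-8 + 2) y)); first exact: mul_T.
    have -> : Q ^+ 2 * (2 * K * B) * e ^+ 2 = 2 * K * B * e ^+ 2 * Q ^+ 2 by ring.
    rewrite ler_pM//; first by nonneg.
      by rewrite ler_wpM2r ?sqr_ge0// ler_wpM2l//; nonneg.
    by apply: T_le => //; lra.
  rewrite (le_trans (lerD (lerD h1 h2) h3))//.
  by rewrite /M1 le_eqVlt; apply/orP; left; apply/eqP; ring.
have V_le0 y : l1norm (V y) <= V0 * expR (6 * eta * y).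
  rewrite /V (le_trans (l1normB _ _))//.
  have h1 : l1norm (a y - ik * b y) <= (Q + eta * Q) * expR (6 * eta * y).
    rewrite (le_trans (l1normB _ _))// [leRHS]mulrDl lerD//.
    rewrite (le_trans (l1normM _ _))//.
    have -> : eta * Q * expR (6 * eta * y) = eta * (Q * expR (6 * eta * y)) by ring.
    rewrite ler_pM ?l1norm_ge0//.
    by rewrite (le_trans (l1normM _ _))// l1norm_i mul1r (le_trans k_small).
  have h2 : l1norm (em y * P y * f y) <= Q ^+ 2 * B * expR (6 * eta * y).
    have -> : em y * P y * f y = P y * (em y * f y) by ring.
    apply: (@le_trans _ _ (B * e * Q ^+ 2 * T eta (-8 + 2) y)); first exact: mul_T.
    have -> : Q ^+ 2 * B = B * Q ^+ 2 by ring.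
    rewrite ler_pM//; first by nonneg.
      by rewrite ler_wpM2r ?sqr_ge0// ler_piMr.
    by apply: T_le => //; lra.
  by rewrite (le_trans (lerD h1 h2))// -mulrDl.
have V_le1 y : y <= 1 -> l1norm (V y) <= V1 * e * expR (6 * eta * y).
  move=> y1; have := cprimitive_tail_exp pV e6 e6 _ (fun y _ => V_le0 y) (V'_le _ V00 (fun y _ => V_le0 y)) y1.
  move=> /(_ _)/le_trans; apply; first by nonneg.
  rewrite ler_wpM2r ?expR_ge0//.
  have -> : V1 * e = 2 * (B * V0 * e + M1 * e) / (6 * eta).
    by rewrite /V1; field; rewrite gt_eqF.
  rewrite ler_wpM2r ?invr_ge0 ?(ltW e6)// ler_wpM2l// lerD2l.
  by rewrite ler_wpM2l.
have V_le2 y : y <= 1 -> l1norm (V y) <= V2 * e ^+ 2 * expR (6 * eta * y).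
  move=> y1; have V1e : 0 <= V1 * e by nonneg.
  have := cprimitive_tail_exp pV e6 e6 _ (fun y _ => V_le0 y) (V'_le _ V1e V_le1) y1.
  move=> /(_ _)/le_trans; apply; first by nonneg.
  rewrite ler_wpM2r ?expR_ge0//.
  rewrite le_eqVlt; apply/orP; left; apply/eqP.
  by rewrite /V2; field; rewrite gt_eqF.
(* N is the deviation of f from the free wave e^(-ikx), multiplied by e^(ikx). Its derivative is
   e^(ikx) (f' + i k f); since V is already O(e^2), the leading contribution is p e^(ikx) f, of size
   e. *)
pose N x : R[i] := ep x * f x - 1.
pose N' x : R[i] := ep x * (ep x * V x) + P x * (ep x * f x).
have pN : cprimitive N N'.
  apply: eq_cprimitive (cprimitiveD (cprimitiveM pep pf) (cprimitive_cst (-1))) => x //.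
  have -> : ik * ep x * f x + ep x * f' x + cst 0 x = ep x * (f' x + ik * f x).
    by rewrite /= addr0; ring.
  rewrite f'E abE /N' mulrDr mulrDr; congr (_ + _).
  have -> : ep x * (ep x * (em x * P x * f x)) = (ep x * em x) * (ep x * P x * f x) by ring.
  by rewrite epm; ring.
have pos2 y : 0 <= T eta 2 y by [].
have N'_le : {ae mu, forall y, y <= 1 ->
    l1norm (N' y) <= (Q ^+ 2 * V2 * D + B * Q ^+ 2) * e * expR (4 * eta * y)}.
  apply: aeW => y y1; rewrite /N' (le_trans (l1normD _ _))//.
  have h1 : l1norm (ep y * (ep y * V y)) <= Q ^+ 2 * V2 * D * e * expR (4 * eta * y).
    rewrite mulrA (le_trans (l1normM _ _))//.
    apply: (@le_trans _ _ (Q * Q * T eta (1 + 1) y * (V2 * e ^+ 2 * expR (6 * eta * y)))).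
      by rewrite ler_pM ?l1norm_ge0// ?V_le2// mul_T.
    have -> : Q * Q * T eta (1 + 1) y * (V2 * e ^+ 2 * expR (6 * eta * y)) =
      Q ^+ 2 * V2 * e ^+ 2 * (T eta 2 y * expR (6 * eta * y)).
      by have -> : 1 + 1 = 2 :> R by []; ring.
    have -> : Q ^+ 2 * V2 * D * e * expR (4 * eta * y) =
      Q ^+ 2 * V2 * e * (D * expR (4 * eta * y)) by ring.
    rewrite ler_pM//; first by nonneg.
    - by nonneg.
    - by rewrite ler_wpM2l//; nonneg.
    - exact: T2_le.
  have h2 : l1norm (P y * (ep y * f y)) <= B * Q ^+ 2 * e * expR (4 * eta * y).
    apply: (@le_trans _ _ (B * e * Q ^+ 2 * T eta (-8 + 2) y)); first exact: mul_T.
    have -> : B * Q ^+ 2 * e = B * e * Q ^+ 2 by ring.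
    rewrite ler_wpM2l//; first by nonneg.
    by apply: T_le => //; lra.
  by rewrite (le_trans (lerD h1 h2))// le_eqVlt; apply/orP; left; apply/eqP; ring.
(* This bound does not shrink with e. It only ensures that N vanishes at minus infinity, after which
   the bound on N' gives the small one; [F_le0] serves F in the same way. *)
have N_le0 y : y <= 1 -> l1norm (N y) <= (2 * Q ^+ 3 * D) * expR (4 * eta * y).
  move=> y1.
  have -> : N y = ep y * (s y * a y) - ep y * (c y * b y).
    by rewrite /N fE -/(em y) -/(s y) -/(c y) !mulrDr mulrN epm; ring.
  have h (g q : R -> R[i]) : (forall y, l1norm (g y) <= Q * T eta 1 y) ->
      (forall y, l1norm (q y) <= Q * expR (6 * eta * y)) ->
      l1norm (ep y * (g y * q y)) <= Q ^+ 3 * D * expR (4 * eta * y).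
    move=> gT qT; rewrite mulrA (le_trans (l1normM _ _))//.
    apply: (@le_trans _ _ (Q * Q * T eta (1 + 1) y * (Q * expR (6 * eta * y)))).
      by rewrite ler_pM ?l1norm_ge0// mul_T.
    have -> : Q * Q * T eta (1 + 1) y * (Q * expR (6 * eta * y)) =
      Q ^+ 3 * (T eta 2 y * expR (6 * eta * y)).
      by have -> : 1 + 1 = 2 :> R by []; ring.
    by rewrite -[leRHS]mulrA ler_wpM2l ?T2_le//; nonneg.
  rewrite (le_trans (l1normB _ _))// (le_trans (lerD (h _ _ s_T a_le) (h _ _ c_T b_le)))//.
  by rewrite le_eqVlt; apply/orP; left; apply/eqP; ring.
have N_le y : y <= 1 -> l1norm (N y) <= N1 * e * expR (4 * eta * y).
  move=> y1; have := cprimitive_tail_exp pN e4 e4 _ N_le0 N'_le y1.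
  move=> /(_ _)/le_trans; apply; first by nonneg.
  rewrite ler_wpM2r ?expR_ge0//.
  rewrite le_eqVlt; apply/orP; left; apply/eqP.
  by rewrite /N1; field; rewrite gt_eqF.
have [cp mp] : continuous p /\ measurable_fun setT p.
  by have cp := primitive_continuous pU; split => //; exact: continuous_measurable.
pose P2 x := \int[mu]_(y in `]-oo, x]) (p y ^+ 2).
have mp2 : measurable_fun setT (fun y => p y ^+ 2) by exact: measurable_funX.
have p2_le y : `|p y ^+ 2| <= B ^+ 2 * expR (6 * eta * y).
  have := PP_T y; rewrite -rmorphM -expr2 l1norm_real => /le_trans; apply.
  rewrite ler_pM//; first by nonneg.
    by rewrite ler_piMr ?sqr_ge0// expr_le1.
  by apply: T_le => //; lra.
have p2_tail x : mu.-integrable `]-oo, x] (EFin \o (fun y => p y ^+ 2)) /\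
    `|P2 x| <= B ^+ 2 * (expR (6 * eta * x) / (6 * eta)).
  apply: (@tail_dominated R (fun y => p y ^+ 2) (fun y => expR (6 * eta * y) / (6 * eta))
    (fun y => expR (6 * eta * y)) (B ^+ 2) x mp2 (fun y => is_derive_exp_scaled y e6)
    (@continuous_exp_scaled R (6 * eta)) (fun y => expR_ge0 _)).
  - by move=> y; rewrite divr_ge0 ?expR_ge0// ltW.
  - exact: sqr_ge0.
  - by apply: aeW => y _.
have pP2 : primitive P2 (fun y => p y ^+ 2).
  apply: integrable_primitive => //; last by move=> x; case: (p2_tail x).
  apply: continuous_locally_bounded => x.
  by apply: (@continuous_comp _ _ _ p (fun y => y ^+ 2)); [exact: cp|exact: exprn_continuous].
(* Adding the integral of p^2 cancels the only source of size e^2 in V'. What is left of it is p^2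
   (e^(-ikx) f - 1), and e^(-ikx) f - 1 = N - 2 i k s f is O(e), so all of F' is O(e^3). *)
pose F x : R[i] := V x + (P2 x)%:C.
pose F' x : R[i] := - (P x * V x) - (em x * f x * (r x)%:C + (N x - 2%:R * ik * (s x * f x)) * (P x * P x))
  + 2%:R * ik * P x * (em x * f x).
have pF : cprimitive F F'.
  apply: eq_cprimitive (cprimitiveD pV (cprimitive_real pP2)) => x //.
  have -> : (p x ^+ 2)%:C = P x * P x by rewrite expr2 rmorphM.
  rewrite /F'.
  have -> : N x - 2%:R * ik * (s x * f x) = em x * f x - 1.
    by rewrite /N epE emE; ring.
  by rewrite /V'; ring.
have F'_le : {ae mu, forall y, y <= 1 -> l1norm (F' y) <= S * e ^+ 3 * expR (4 * eta * y)}.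
  apply: ae_mono r_T => y ry y1; rewrite /F' (le_trans (l1norm3 _ _ _))//.
  have h1 : l1norm (P y * V y) <= B * V2 * D * e ^+ 3 * expR (4 * eta * y).
    rewrite (le_trans (l1normM _ _))//.
    apply: (@le_trans _ _ (B * e * (V2 * e ^+ 2 * expR (6 * eta * y)))).
      rewrite ler_pM ?l1norm_ge0// ?V_le2// (le_trans (P_T y))// ler_piMr//; first by nonneg.
      by rewrite T_le1.
    have -> : B * e * (V2 * e ^+ 2 * expR (6 * eta * y)) =
      B * V2 * e ^+ 3 * expR (6 * eta * y) by ring.
    have -> : B * V2 * D * e ^+ 3 * expR (4 * eta * y) =
      B * V2 * e ^+ 3 * (D * expR (4 * eta * y)) by ring.
    by rewrite ler_wpM2l ?E6_le//; nonneg.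
  have h2 : l1norm (em y * f y * (r y)%:C) <= Q ^+ 2 * B * e ^+ 3 * expR (4 * eta * y).
    apply: (@le_trans _ _ (Q ^+ 2 * (B * e ^+ 3) * T eta (2 + -8) y)); first exact: mul_T.
    rewrite mulrA ler_wpM2l//; first by nonneg.
    by apply: T_le => //; lra.
  have h3 : l1norm (N y * (P y * P y)) <= N1 * B ^+ 2 * e ^+ 3 * expR (4 * eta * y).
    rewrite (le_trans (l1normM _ _))//.
    apply: (@le_trans _ _ (N1 * e * expR (4 * eta * y) * (B ^+ 2 * e ^+ 2))).
      rewrite ler_pM ?l1norm_ge0 ?N_le// (le_trans (PP_T y))// ler_piMr//; first by nonneg.
      by rewrite T_le1.
    by rewrite le_eqVlt; apply/orP; left; apply/eqP; ring.
  have h4 : l1norm (2%:R * ik * (s y * f y) * (P y * P y)) <=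
      2 * K * Q ^+ 2 * B ^+ 2 * e ^+ 3 * expR (4 * eta * y).
    have -> : 2%:R * ik * (s y * f y) * (P y * P y) =
      ik * ((s y * f y) * (P y * P y)) + ik * ((s y * f y) * (P y * P y)) by ring.
    have h : l1norm (ik * ((s y * f y) * (P y * P y))) <=
        K * Q ^+ 2 * B ^+ 2 * e ^+ 3 * expR (4 * eta * y).
      rewrite (le_trans (l1normM _ _))//.
      apply: (@le_trans _ _ (K * e ^+ 2 * (Q * Q * (B ^+ 2 * e ^+ 2) * T eta (1 + 1 + -8) y))).
        by rewrite ler_pM ?l1norm_ge0//; apply: (mul_T) => //; exact: mul_T.
      have -> : K * e ^+ 2 * (Q * Q * (B ^+ 2 * e ^+ 2) * T eta (1 + 1 + -8) y) =
        K * Q ^+ 2 * B ^+ 2 * (e ^+ 2 * e ^+ 2) * T eta (1 + 1 + -8) y by ring.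
      have -> : e ^+ 2 * e ^+ 2 = e ^+ 3 * e by ring.
      rewrite ler_pM//; first by nonneg.
        by rewrite ler_wpM2l ?ler_piMr//; nonneg.
      by apply: T_le => //; lra.
    rewrite (le_trans (l1normD _ _))// (le_trans (lerD h h))//.
    by rewrite le_eqVlt; apply/orP; left; apply/eqP; ring.
  have h5 : l1norm (2%:R * ik * P y * (em y * f y)) <=
      2 * K * B * Q ^+ 2 * e ^+ 3 * expR (4 * eta * y).
    apply: (@le_trans _ _ ((2 * K * B * e ^+ 3) * Q ^+ 2 * T eta (-8 + 2) y)); first exact: mul_T.
    have -> : 2 * K * B * Q ^+ 2 * e ^+ 3 = 2 * K * B * e ^+ 3 * Q ^+ 2 by ring.
    by rewrite ler_wpM2l//; [nonneg|apply: T_le => //; lra].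
  have h6 : l1norm (em y * f y * (r y)%:C + (N y - 2%:R * ik * (s y * f y)) * (P y * P y)) <=
      Q ^+ 2 * B * e ^+ 3 * expR (4 * eta * y) + (N1 * B ^+ 2 * e ^+ 3 * expR (4 * eta * y) +
        2 * K * Q ^+ 2 * B ^+ 2 * e ^+ 3 * expR (4 * eta * y)).
    rewrite (le_trans (l1normD _ _))// lerD// mulrBl (le_trans (l1normB _ _))// lerD//.
  rewrite (le_trans (lerD (lerD h1 h6) h5))//.
  by rewrite /S le_eqVlt; apply/orP; left; apply/eqP; ring.
have F_le0 y : y <= 1 -> l1norm (F y) <= (V0 + B ^+ 2 / (6 * eta)) * expR (6 * eta * y).
  move=> y1; rewrite /F (le_trans (l1normD _ _))// mulrDl lerD// l1norm_real.
  by rewrite (le_trans (p2_tail y).2)// mulrA mulrAC.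
have F_le y : y <= 1 -> l1norm (F y) <= W * e ^+ 3 * expR (4 * eta * y).
  move=> y1; have := cprimitive_tail_exp pF e4 e6 _ F_le0 F'_le y1.
  move=> /(_ _)/le_trans; apply; first by nonneg.
  rewrite ler_wpM2r ?expR_ge0//.
  rewrite le_eqVlt; apply/orP; left; apply/eqP.
  by rewrite /W; field; rewrite gt_eqF.
have x0le : x0 <= 1 by rewrite (le_trans (ler_norm _)).
have Tx0 : T eta 1 x0 <= expR eta.
  by rewrite ler_expR mul1r ler_piMr// ltW.
have exp_x0 d : 0 <= d -> expR (d * x0) <= expR d.
  by move=> d0; rewrite ler_expR ler_piMr.
have epx0 : l1norm (ep x0) <= Q * expR eta by rewrite (le_trans (ep_T _))// ler_wpM2l.
have emx0 : l1norm (em x0) <= Q * expR eta by rewrite (le_trans (em_T _))// ler_wpM2l.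
have ep1 : l1norm (ep x0 - 1) <= Z * e ^+ 2.
  have := @cprimitive_increment _ _ (K * e ^+ 2 * (Q * expR eta)) x0 pep x01.
  rewrite [ep 0]expp0 => /(_ _)/le_trans; apply; last first.
    by rewrite /Z le_eqVlt; apply/orP; left; apply/eqP; ring.
  move=> y y1; rewrite (le_trans (l1normM _ _))// ler_pM ?l1norm_ge0//.
  by rewrite (le_trans (ep_T _))// ler_wpM2l// ler_expR mul1r ler_piMr// ltW.
have f1 : l1norm (f x0 - 1) <= C1 * e.
  have -> : f x0 - 1 = em x0 * N x0 - em x0 * (ep x0 - 1).
    transitivity (ep x0 * em x0 * f x0 - ep x0 * em x0); first by rewrite epm mul1r.
    by rewrite /N; ring.
  rewrite (le_trans (l1normB _ _))//.
  have h1 : l1norm (em x0 * N x0) <= Q * expR eta * (N1 * D) * e.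
    rewrite (le_trans (l1normM _ _))//.
    have -> : Q * expR eta * (N1 * D) * e = Q * expR eta * (N1 * e * D) by ring.
    rewrite ler_pM ?l1norm_ge0// (le_trans (N_le _ x0le))// ler_wpM2l//; first by nonneg.
    by apply: exp_x0; exact: ltW.
  have h2 : l1norm (em x0 * (ep x0 - 1)) <= Z * (Q * expR eta + 1) * e.
    rewrite (le_trans (l1normM _ _))//.
    apply: (@le_trans _ _ (Q * expR eta * (Z * e))).
      rewrite ler_pM ?l1norm_ge0// (le_trans ep1)// ler_wpM2l//.
    have -> : Z * (Q * expR eta + 1) * e = Q * expR eta * (Z * e) + Z * e by ring.
    by rewrite lerDl; nonneg.
  by rewrite (le_trans (lerD h1 h2))// -mulrDl.
split => //; exists f', f''; split => //.
  by rewrite (le_trans f1)// ler_wpM2r// /C lerDl; nonneg.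
have -> : f' x0 - (p x0)%:C * f x0 + 'i * k + (\int[mu]_(y in `]-oo, x0]) p y ^+ 2)%:C =
    (ep x0 - 1) * V x0 + F x0 - ik * (f x0 - 1).
  have : f' x0 + ik * f x0 = ep x0 * V x0 + P x0 * f x0.
    rewrite f'E abE mulrDr; congr (_ + _).
    have -> : ep x0 * (em x0 * P x0 * f x0) = (ep x0 * em x0) * (P x0 * f x0) by ring.
    by rewrite epm mul1r.
  move=> /(canRL (addrK _)) ->; rewrite /F -/(P x0) -/ik -/(P2 x0); ring.
rewrite (le_trans (l1normB _ _))//.
have h1 : l1norm ((ep x0 - 1) * V x0) <= Z * (V2 * expR (6 * eta)) * e ^+ 3.
  rewrite (le_trans (l1normM _ _))//.
  apply: (@le_trans _ _ (Z * e ^+ 2 * (V2 * e ^+ 2 * expR (6 * eta)))).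
    rewrite ler_pM ?l1norm_ge0// (le_trans (V_le2 _ x0le))// ler_wpM2l//; first by nonneg.
    by apply: exp_x0; exact: ltW.
  have -> : Z * e ^+ 2 * (V2 * e ^+ 2 * expR (6 * eta)) =
    Z * (V2 * expR (6 * eta)) * (e ^+ 3 * e) by ring.
  by rewrite ler_wpM2l ?ler_piMr//; nonneg.
have h2 : l1norm (F x0) <= W * D * e ^+ 3.
  rewrite (le_trans (F_le _ x0le))// mulrAC ler_wpM2r// ler_wpM2l//.
  by apply: exp_x0; exact: ltW.
have h3 : l1norm (ik * (f x0 - 1)) <= K * C1 * e ^+ 3.
  rewrite (le_trans (l1normM _ _))//.
  have -> : K * C1 * e ^+ 3 = K * e ^+ 2 * (C1 * e) by ring.
  by rewrite ler_pM ?l1norm_ge0.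
apply: (@le_trans _ _ (Z * (V2 * expR (6 * eta)) * e ^+ 3 + W * D * e ^+ 3 + K * C1 * e ^+ 3)).
  by rewrite lerD// (le_trans (l1normD _ _))// lerD.
by rewrite -!mulrDl ler_wpM2r// /C lerDr.
Qed.

End Asymptotics.

(** * Reflection and the Wronskian *)

Section Reflection.
Variable R : realType.
Notation mu := (@lebesgue_measure R).
Local Notation Re := complex.Re.
Local Notation Im := complex.Im.
Implicit Types (x y a b : R) (f g : R -> R) (D : set R).

Let oppm : measurable_fun [set: measurableTypeR R] (-%R : measurableTypeR R -> measurableTypeR R).
Proof. exact: measurable_funN. Qed.

Lemma measurable_opp_preimage D : measurable D -> measurable (-%R @^-1` D : set (measurableTypeR R)).
Proof. by move=> mD; rewrite -(setTI (_ @^-1` _)); exact: oppm. Qed.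

Lemma ge0_integral_opp D (g : R -> \bar R) : measurable D -> measurable_fun D g ->
  (forall x, D x -> (0 <= g x)%E) ->
  (\int[mu]_(x in D) g x = \int[mu]_(x in -%R @^-1` D) g (- x)%R)%E.
Proof.
move=> mD mg g0.
have := @ge0_integral_pushforward _ _ (measurableTypeR R) (measurableTypeR R) R
  -%R oppm mu D g mD mg (fun x xD => g0 x (set_mem xD)).
move=> <-; apply: eq_measure_integral => A mA _.
by apply/esym; exact: lebesgue_measureN.
Qed.

Lemma integral_opp D (g : R -> \bar R) : measurable D -> measurable_fun D g ->
  (\int[mu]_(x in D) g x = \int[mu]_(x in -%R @^-1` D) g (- x)%R)%E.
Proof.
move=> mD mg; rewrite integralE [RHS]integralE.
have hp := @ge0_integral_opp D _ mD (measurable_funepos mg) (fun x _ => funepos_ge0 g x).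
have hn := @ge0_integral_opp D _ mD (measurable_funeneg mg) (fun x _ => funeneg_ge0 g x).
rewrite hp hn; congr (_ - _)%E; apply: eq_integral => x _.
  by rewrite -[RHS]/((g \o (-%R : R -> R))^\+%E x) [in RHS]funepos_comp.
by rewrite -[RHS]/((g \o (-%R : R -> R))^\-%E x) [in RHS]funeneg_comp.
Qed.

Lemma measurable_fun_opp D d (T : measurableType d) (g : R -> T) : measurable D ->
  measurable_fun D g -> measurable_fun (-%R @^-1` D : set R) (fun x => g (- x)).
Proof.
move=> mD mg; apply: (@measurable_comp _ _ _ (measurableTypeR R) (measurableTypeR R) _ D g) => //.
by move=> _ [x Dx <-].
Qed.

Lemma integrable_opp D f : measurable D -> mu.-integrable D (EFin \o f) ->
  mu.-integrable (-%R @^-1` D) (EFin \o (fun x => f (- x))).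
Proof.
move=> mD /integrableP[mf intf]; apply/integrableP; split.
  apply/measurable_EFinP; apply: measurable_fun_opp => //.
  exact/measurable_EFinP.
rewrite (le_lt_trans _ intf)// [leRHS]ge0_integral_opp//.
exact: measurableT_comp.
Qed.

Lemma Rintegral_opp D f : measurable D -> measurable_fun D f ->
  \int[mu]_(x in D) f x = \int[mu]_(x in -%R @^-1` D) f (- x).
Proof.
move=> mD mf; rewrite /Rintegral integral_opp//; exact/measurable_EFinP.
Qed.

Lemma opp_preimage_cy x : -%R @^-1` `[x, +oo[%classic = `]-oo, - x]%classic :> set R.
Proof. by rewrite opp_preimage_itvbndy. Qed.

Lemma opp_preimage_Nyc x : -%R @^-1` `]-oo, x]%classic = `[- x, +oo[%classic :> set R.
Proof.
by apply/seteqP; split => y /=; rewrite !in_itv/= andbT lerNl.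
Qed.

Lemma opp_preimage_cc a b : -%R @^-1` `[a, b]%classic = `[- b, - a]%classic :> set R.
Proof.
by apply/seteqP; split => y /=; rewrite !in_itv/= lerNl lerNr andbC.
Qed.

Lemma ae_opp (P : R -> Prop) : {ae mu, forall x, P x} -> {ae mu, forall x, P (- x)}.
Proof.
move=> [N [mN N0 PN]]; exists (-%R @^-1` N); split.
- exact: measurable_opp_preimage.
- by rewrite -N0; exact: lebesgue_measureN.
- by move=> x /= nP; exact: PN.
Qed.

Lemma measurable_fun_oppT f : measurable_fun setT f -> measurable_fun setT (fun x => f (- x)).
Proof. by move=> mf; have := measurable_fun_opp measurableT mf; rewrite preimage_setT. Qed.

Lemma primitive_opp F f : primitive F f -> primitive (fun x => - F (- x)) (fun x => f (- x)).
Proof.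
move=> [mf bf Ff]; split; first exact: measurable_fun_oppT.
  move=> a b; have [M fM] := bf (- b) (- a); exists M.
  apply: ae_mono (ae_opp fM) => x H /andP[ax xb].
  by apply: H; rewrite !lerN2 xb.
move=> a b ab; rewrite opprK addrC Ff ?lerN2//.
rewrite Rintegral_opp//; last exact: measurable_funTS.
by rewrite opp_preimage_cc !opprK.
Qed.

Lemma cintegral_opp D (f : R -> R[i]) : measurable D -> cintegrable mu D f ->
  cintegrable mu (-%R @^-1` D) (fun x => f (- x)) /\
  cintegral mu (-%R @^-1` D) (fun x => f (- x)) = cintegral mu D f.
Proof.
move=> mD [rf jf]; split.
  by split; [exact: (integrable_opp mD rf)|exact: (integrable_opp mD jf)].
rewrite /cintegral; congr (_ +i* _).
  rewrite [RHS]Rintegral_opp//; by case/integrableP: rf => /measurable_EFinP.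
rewrite [RHS]Rintegral_opp//; by case/integrableP: jf => /measurable_EFinP.
Qed.

Lemma jost_kernelN (k : R[i]) x : jost_kernel k (- x) = - jost_kernel k x.
Proof.
have [->|k0] := eqVneq k 0; first by rewrite /jost_kernel eqxx rmorphN.
by rewrite !jost_kernelE// exppN expmN; ring.
Qed.

(** The kernel is odd, so reflecting the half-line of integration flips the sign in front of the
    integral; the two definitions carry opposite signs there. Every result on the left solution thus
    transfers to the right one. *)
Lemma is_jost_plus_opp (k : R[i]) (U : R -> R) (f : R -> R[i]) :
  is_jost_plus mu U k f <->
  is_jost_minus mu (fun x => U (- x)) k (fun x => f (- x)).
Proof.
have FE x y : jost_kernel k (- y + x) = - jost_kernel k (y - x).
  by rewrite -jost_kernelN opprB addrC.
have eqD x : -%R @^-1` `[x, +oo[%classic = `]-oo, - x]%classic :> set R := opp_preimage_cy x.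
split.
  move=> jf x F; rewrite /F => {F}.
  have [i0 e0] := jf (- x); rewrite opprK in i0 e0.
  have [//|] := cintegral_opp _ i0; rewrite eqD opprK => i1 e1.
  have [//|i2 e2] := cintegralZ (-1) _ i1.
  have pt y : `]-oo, x]%classic y ->
    -1 * (jost_kernel k (- y + x) * (U (- y))%:C * f (- y)) =
    jost_kernel k (y - x) * (U (- y))%:C * f (- y).
    by move=> _; rewrite FE; ring.
  have [//|t1 t2] := eq_cintegral _ pt.
  split; first exact: t1.
  by rewrite -t2 e2 e1 mulN1r opprK e0 rmorphN mulrN.
move=> jf x F; rewrite /F => {F}.
have [i0 e0] := jf (- x).
have [//|] := cintegral_opp _ i0; rewrite opp_preimage_Nyc opprK => i1 e1.
have [//|i2 e2] := cintegralZ (-1) _ i1.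
have pt y : `[x, +oo[%classic y ->
  -1 * (jost_kernel k (- y + x) * (U (- - y))%:C * f (- - y)) =
  jost_kernel k (y - x) * (U y)%:C * f y.
  by move=> _; rewrite !opprK FE; ring.
have [//|t1 t2] := eq_cintegral _ pt.
split; first exact: t1.
move: e0; rewrite opprK => ->.
by rewrite -t2 e2 e1 mulN1r rmorphN mulrN opprK.
Qed.

Lemma jost_plusE (k : R[i]) (U : R -> R) (g : R -> R[i]) :
  (forall h, is_jost_minus mu (fun x => U (- x)) k h <-> h = g) ->
  jost_plus mu U k = (fun x => g (- x)).
Proof.
move=> gu; have pu h : is_jost_plus mu U k h <-> h = (fun x => g (- x)).
  rewrite is_jost_plus_opp gu; split => [<-|->]; apply/funext => x /=; by rewrite opprK.
rewrite /jost_plus; apply/pu.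
apply: (@xgetPex _ (fun=> 0) [set f | is_jost_plus mu U k f]).
by exists (fun x => g (- x)); apply/pu.
Qed.

Lemma cderive_opp (F f f1 : R -> R[i]) x : cprimitive F f -> cprimitive f f1 ->
  cderive (fun y => F (- y)) x = - f (- x).
Proof.
move=> [rF iF] [rf jf].
have key (G g : R -> R) : primitive G g -> continuous g ->
    derive1 (fun y => G (- y)) x = - g (- x).
  move=> pG cg; have dG := primitive_is_derive pG (cg (- x)).
  have dN : is_derive x 1 (-%R : R -> R) (- 1) by apply: is_derive_eq.
  have dc := @is_derive1_comp _ G -%R x _ _ dG dN.
  by rewrite derive1E (@derive_val _ _ _ _ _ _ _ dc) mulrN1.
rewrite /cderive; apply: complex_eq; rewrite ?ReN ?ImN /=.
  by apply: (key _ _ rF); exact: primitive_continuous rf.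
by apply: (key _ _ iF); exact: primitive_continuous jf.
Qed.

(** The left solution is expanded at 1 and the reflected right solution at -1, that is, at the same
    physical point. Their integrals of p^2 cover the two half-lines ending at 1 and add up to the
    integral over the line. *)
Theorem jost_wronskian_asymptotics (eta B K : R) : 0 < eta -> 0 <= B -> 0 <= K ->
  exists C e0 : R, [/\ 0 <= C, 0 < e0 & forall (e : R) k (U p r : R -> R), 0 < e -> e < e0 ->
    l1norm k <= K * e ^+ 2 ->
    measurable_fun setT U -> measurable_fun setT r ->
    {ae mu, forall y, `|U y| <= B * expR (- (8 * eta * `|y|))} ->
    primitive p (fun y => U y + r y) ->
    (forall y, `|p y| <= B * e * expR (- (8 * eta * `|y|))) ->
    {ae mu, forall y, `|r y| <= B * e ^+ 3 * expR (- (8 * eta * `|y|))} ->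
    mu.-integrable setT (EFin \o (fun y => p y ^+ 2)) /\
    l1norm (jost_wronskian mu U k + 'i *+ 2 * k +
       (\int[mu]_y (p y ^+ 2))%:C) <= C * e ^+ 3].
Proof.
move=> eta0 B0 K0.
have [C [e0 [C0 e00 asy]]] := @jost_minus_asymptotics R eta B K eta0 B0 K0.
have e8 : 0 < 8 * eta by rewrite mulr_gt0.
have N11 : -1 <= 1 :> R by lra.
pose I := B ^+ 2 * (expR (8 * eta) / (8 * eta)).
have I0 : 0 <= I by rewrite mulr_ge0 ?sqr_ge0// divr_ge0 ?expR_ge0// ltW.
pose C' := 2 * C * (K + I + C) + 2 * C.
have C'0 : 0 <= C' by rewrite /C' !addr_ge0// mulr_ge0// ?mulr_ge0// !addr_ge0.
exists C', (Num.min 1 e0); split => //; first by rewrite lt_min ltr01.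
move=> e k U p r epos; rewrite lt_min => /andP[e1 ee0] kle mU mr Ule pU ple rle.
have ege := ltW epos; have e1' := ltW e1.
have e20 : 0 <= e ^+ 2 by rewrite sqr_ge0.
have e30 : 0 <= e ^+ 3 by rewrite exprn_ge0.
have eee : e ^+ 3 <= e ^+ 2 by rewrite exprS ler_piMl.
have [fu [f' [f'' [pf pf' f1 fa]]]] := asy e k U p r 1 epos ee0 kle mU mr Ule pU ple rle
  ltac:(by rewrite normr1).
(* Reflection sends the derivative of p to that of - p (- x), so the reflected data satisfy the same
   hypotheses with the same constants. *)
pose U' x := U (- x); pose p' x := - p (- x); pose r' x := r (- x).
have [gu [g' [g'' [pg pg' g1 ga]]]] := asy e k U' p' r' (-1) epos ee0 kle
  (measurable_fun_oppT mU) (measurable_fun_oppT mr)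
  ltac:(by apply: ae_mono (ae_opp Ule) => y; rewrite normrN)
  (primitive_opp pU)
  ltac:(by move=> y; rewrite /p' normrN -(normrN y); exact: ple)
  ltac:(by apply: ae_mono (ae_opp rle) => y; rewrite normrN)
  ltac:(by rewrite normrN normr1).
set f := jost_minus mu U k in fu pf f1 fa.
set g := jost_minus mu U' k in gu pg g1 ga.
have mp : measurable_fun setT p by exact: continuous_measurable (primitive_continuous pU).
have mp2 : measurable_fun setT (fun y => p y ^+ 2) by exact: measurable_funX.
have p2_le (q : R -> R) y : (forall y, `|q y| <= B * e * expR (- (8 * eta * `|y|))) ->
    `|q y ^+ 2| <= B ^+ 2 * e ^+ 2 * expR (8 * eta * y).
  move=> qle; rewrite normrX.
  apply: (@le_trans _ _ ((B * e * expR (- (8 * eta * `|y|))) ^+ 2)).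
    by rewrite ler_sqr ?nnegrE// ?qle// !mulr_ge0// expR_ge0.
  rewrite !exprMn ler_wpM2l ?mulr_ge0 ?sqr_ge0// expr2 -expRD ler_expR.
  have h : - `|y| <= y by rewrite lerNl -normrN ler_norm.
  have := normr_ge0 y; nra.
have p2_tail (q : R -> R) x : measurable_fun setT q ->
    (forall y, `|q y| <= B * e * expR (- (8 * eta * `|y|))) -> x <= 1 ->
    mu.-integrable `]-oo, x] (EFin \o (fun y => q y ^+ 2)) /\
    `|\int[mu]_(y in `]-oo, x]) q y ^+ 2| <= I * e ^+ 2.
  move=> mq qle x1.
  have := @tail_dominated R (fun y => q y ^+ 2) (fun y => expR (8 * eta * y) / (8 * eta))
    (fun y => expR (8 * eta * y)) (B ^+ 2 * e ^+ 2) x _ (fun y => is_derive_exp_scaled y e8)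
    (@continuous_exp_scaled R (8 * eta)) (fun y => expR_ge0 _).
  case.
  - exact: measurable_funX.
  - by move=> y; rewrite divr_ge0 ?expR_ge0// ltW.
  - by rewrite mulr_ge0// sqr_ge0.
  - by apply: aeW => y _; exact: p2_le.
  move=> i1 i2; split => //; apply: (le_trans i2).
  rewrite /I [leRHS]mulrAC ler_wpM2l ?mulr_ge0 ?sqr_ge0// ler_wpM2r ?invr_ge0 ?(ltW e8)//.
  by rewrite ler_expR ler_piMr// ltW.
have [ip1 I1] := p2_tail p 1 mp ple (lexx _).
have mp' : measurable_fun setT p'.
  exact: continuous_measurable (primitive_continuous (primitive_opp pU)).
have ple' y : `|p' y| <= B * e * expR (- (8 * eta * `|y|)).
  by rewrite /p' normrN -(normrN y); exact: ple.
have [ip2 I2] := p2_tail p' (-1) mp' ple' N11.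
set J1 := \int[mu]_(y in `]-oo, 1]) p y ^+ 2 in fa I1.
set J2 := \int[mu]_(y in `]-oo, -1]) p' y ^+ 2 in ga I2.
have ip2' : mu.-integrable `[1, +oo[ (EFin \o (fun y => p y ^+ 2)).
  have pE : (fun x => p' (- x) ^+ 2) = (fun x => p x ^+ 2).
    by apply/funext => x; rewrite /p' opprK sqrrN.
  by have := integrable_opp (measurable_itv _) ip2; rewrite opp_preimage_Nyc opprK pE.
have J2E : J2 = \int[mu]_(y in `[1, +oo[) p y ^+ 2.
  rewrite /J2 Rintegral_opp//; last by apply: measurable_funTS; exact: measurable_funX.
  rewrite opp_preimage_Nyc opprK; apply: eq_Rintegral => x _.
  by rewrite /p' opprK sqrrN.
have cover : [set: R] = `]-oo, 1]%classic `|` `]1, +oo[%classic.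
  by apply/seteqP; split => // x _ /=; rewrite !in_itv/= andbT; case: (leP x 1); [left|right].
have ip2o : mu.-integrable `]1, +oo[ (EFin \o (fun y => p y ^+ 2)).
  apply: (@integrableS _ (measurableTypeR R) R mu `[1, +oo[ `]1, +oo[ _) ip2' => //.
  by apply: subset_itvr; rewrite bnd_simp.
have ipT : mu.-integrable setT (EFin \o (fun y => p y ^+ 2)).
  apply/integrableP; split; first by apply/measurable_EFinP.
  rewrite cover ge0_integral_setU//=.
  - rewrite lte_add_pinfty//; first by case/integrableP: ip1.
    by case/integrableP: ip2o.
  - by apply/measurable_EFinP; apply: measurableT_comp => //; exact: measurable_funTS.
  - apply/disj_setPS => x [] /=; rewrite !in_itv/= andbT => x1 x2.
    by move: (le_lt_trans x1 x2); rewrite ltxx.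
split => //.
have JE : \int[mu]_y p y ^+ 2 = J1 + J2.
  rewrite J2E -(Rintegral_itv_obnd_cbnd ip2o) {1}cover Rintegral_setU//.
  - by rewrite -cover.
  - apply/disj_setPS => x [] /=; rewrite !in_itv/= andbT => x1 x2.
    by move: (le_lt_trans x1 x2); rewrite ltxx.
rewrite JE.
rewrite /jost_wronskian /wronskian (jost_plusE gu) -/f.
have -> : cderive f 1 = f' 1.
  by apply: (cderiveE pf); [exact: (primitive_continuous pf'.1)|exact: (primitive_continuous pf'.2)].
rewrite (cderive_opp 1 pg pg').
set P1 := (p 1)%:C in fa.
have P1' : (p' (-1))%:C = - P1 by rewrite /p' opprK rmorphN.
rewrite P1' in ga.
set E1 := f' 1 - P1 * f 1 + 'i * k + J1%:C in fa.
set E2 := g' (-1) - - P1 * g (-1) + 'i * k + J2%:C in ga.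
(* In f_+ f_-' - f_- f_+' at 1 the contributions of p cancel, as f_+ is the
   reflection of g and p' (-1) = - p 1. *)
have -> : g (-1) * f' 1 - f 1 * - g' (-1) + 'i *+ 2 * k + (J1 + J2)%:C =
   (g (-1) - 1) * (E1 - 'i * k - J1%:C) + (f 1 - 1) * (E2 - 'i * k - J2%:C) + (E1 + E2).
  by rewrite /E1 /E2 rmorphD mulr2n; ring.
have ik_le : l1norm ('i * k) <= K * e ^+ 2.
  by rewrite (le_trans (l1normM _ _))// l1norm_i mul1r.
have bnd (E : R[i]) (J : R) : l1norm E <= C * e ^+ 3 -> `|J| <= I * e ^+ 2 ->
    l1norm (E - 'i * k - J%:C) <= (K + I + C) * e ^+ 2.
  move=> hE hJ; rewrite (le_trans (l1normB _ _))// l1norm_real.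
  have h : l1norm (E - 'i * k) <= C * e ^+ 2 + K * e ^+ 2.
    by rewrite (le_trans (l1normB _ _))// lerD// (le_trans hE)// ler_wpM2l.
  by rewrite (le_trans (lerD h hJ))// le_eqVlt; apply/orP; left; apply/eqP; ring.
have h1 : l1norm ((g (-1) - 1) * (E1 - 'i * k - J1%:C)) <= C * e * ((K + I + C) * e ^+ 2).
  by rewrite (le_trans (l1normM _ _))// ler_pM ?l1norm_ge0// bnd.
have h2 : l1norm ((f 1 - 1) * (E2 - 'i * k - J2%:C)) <= C * e * ((K + I + C) * e ^+ 2).
  by rewrite (le_trans (l1normM _ _))// ler_pM ?l1norm_ge0// bnd.
have h3 : l1norm (E1 + E2) <= C * e ^+ 3 + C * e ^+ 3.
  by rewrite (le_trans (l1normD _ _))// lerD.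
rewrite (le_trans (l1normD _ _))// (le_trans (lerD (le_trans (l1normD _ _) (lerD h1 h2)) h3))//.
by rewrite /C' le_eqVlt; apply/orP; left; apply/eqP; ring.
Qed.

End Reflection.

(** * Test functions and weak derivatives *)

Section TestFunctions.
Variable R : realType.
Notation mu := (@lebesgue_measure R).
Implicit Types (x y a b : R) (f g : R -> R).

(** Smoothness is recorded with explicit derivatives, which makes closure under sums, products and
    affine changes of variable a plain induction; [nsmooth_derivable] converts it to the form
    required by [test_function]. *)
Fixpoint nsmooth (n : nat) f : Prop :=
  if n is m.+1 then exists2 f', (forall x, is_derive x 1 f (f' x)) & nsmooth m f'
  else True.

Lemma nsmooth_le n f : nsmooth n.+1 f -> nsmooth n f.
Proof.
elim: n f => [//|n IH] f [f' df sf']; exists f' => //; exact: IH.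
Qed.

Lemma nsmooth_cst n (c : R) : nsmooth n (cst c).
Proof.
by elim: n c => [//|n IH] c; exists (cst 0) => // x; exact: is_derive_cst.
Qed.

Lemma nsmoothD n f g : nsmooth n f -> nsmooth n g -> nsmooth n (fun x => f x + g x).
Proof.
elim: n f g => [//|n IH] f g [f' df sf] [g' dg sg].
by exists (fun x => f' x + g' x); [move=> x; exact: is_deriveD|exact: IH].
Qed.

Lemma nsmoothM n f g : nsmooth n f -> nsmooth n g -> nsmooth n (fun x => f x * g x).
Proof.
elim: n f g => [//|n IH] f g sf sg; have sf0 := nsmooth_le sf; have sg0 := nsmooth_le sg.
case: sf => f' df sf; case: sg => g' dg sg.
exists (fun x => f' x * g x + f x * g' x); last by apply: nsmoothD; exact: IH.
move=> x; have := is_deriveM (df x) (dg x).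
have -> // : f x *: g' x + g x *: f' x = f' x * g x + f x * g' x.
by rewrite /GRing.scale/=; ring.
Qed.

Lemma nsmooth_affine n f a b : nsmooth n f -> nsmooth n (fun x => f (a * x + b)).
Proof.
elim: n f => [//|n IH] f [f' df sf].
exists (fun x => f' (a * x + b) * a); last by apply: nsmoothM; [exact: IH|exact: nsmooth_cst].
move=> x; have da : is_derive x 1 (fun x => a * x + b) a.
  by apply: is_derive_eq; rewrite /GRing.scale/=; ring.
exact: (@is_derive1_comp _ f (fun x => a * x + b) x _ _ (df _) da).
Qed.

Lemma nsmooth_derivable f : (forall n, nsmooth n f) ->
  forall n x, derivable (derive1n n f) x 1.
Proof.
move=> sf n; have := sf n.+1; elim: n f {sf} => [|n IH] f [f' df sf'] x.
  by rewrite derive1n0; case: (df x).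
rewrite derive1Sn; suff -> : derive1 f = f' by exact: IH.
by apply/funext => y; rewrite derive1E; case: (df y).
Qed.

(* The derivatives of e^(-1/x) are combinations of the functions flat n. *)
Definition flat (n : nat) x : R := if 0 < x then x^-1 ^+ n * expR (- x^-1) else 0.

Lemma flat_ge0 n x : 0 <= flat n x.
Proof.
rewrite /flat; case: ifP => // x0.
by rewrite mulr_ge0 ?expR_ge0// exprn_ge0// invr_ge0 ltW.
Qed.

Lemma flat0_le1 x : flat 0 x <= 1.
Proof.
rewrite /flat; case: ifP => // x0; rewrite expr0 mul1r -expR0 ler_expR.
by rewrite oppr_le0 invr_ge0 ltW.
Qed.

Lemma flatS n x : flat n x = flat n.+1 x * x.
Proof.
rewrite /flat; case: ifP => x0; last by rewrite mul0r.
by rewrite exprS; field; rewrite gt_eqF.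
Qed.

(** From e^(1/x) >= (1/x)^(n+1) / (n+1)!. Spending one power of 1/x more than [flat n] contains
    leaves the factor [|x|], hence continuity at 0. *)
Lemma flat_bounded n x : flat n x <= (n.+1)`!%:R * `|x|.
Proof.
rewrite flatS /flat; case: ifP => x0; last by rewrite mul0r mulr_ge0.
rewrite gtr0_norm// ler_wpM2r ?(ltW x0)//.
have ix : 0 <= x^-1 by rewrite invr_ge0 ltW.
have := expR_ge1Dxn n ix; rewrite expRN ler_pdivrMr ?expR_gt0// => h.
rewrite -ler_pdivrMl// mulrC (le_trans _ h)// lerDr.
exact: ler01.
Qed.

Lemma continuous_flat0 n : {for (0 : R), continuous (flat n)}.
Proof.
have flat00 : flat n 0 = 0 by rewrite /flat ltxx.
apply/cvgrPdist_le => e e0; near=> z.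
rewrite flat00 sub0r normrN ger0_norm ?flat_ge0// (le_trans (flat_bounded _ _))//.
rewrite mulrC -ler_pdivlMr// -normrN -sub0r.
near: z; apply: cvgr_dist_le; first exact: cvg_id.
by rewrite divr_gt0.
Unshelve. all: by end_near. Qed.

(** Away from 0 this is calculus. At 0 the difference quotient of [flat n] is exactly [flat n.+1],
    which is continuous there, so Caratheodory's criterion applies. *)
Lemma is_derive_flat n x :
  is_derive x 1 (flat n) (flat n.+2 x + (- n%:R) * flat n.+1 x).
Proof.
have [x0|x0|x0] := ltgtP x 0.
- have e0 : flat n.+2 x + (- n%:R) * flat n.+1 x = 0.
    by rewrite /flat ltNge (ltW x0) mulr0 addr0.
  rewrite e0; apply: (@near_eq_is_derive _ _ _ (cst 0)).
  near=> z; rewrite /flat ltNge.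
  suff /ltW -> : z < 0 by [].
  by near: z; exact: lt_nbhsl.
- pose h y : R := y^-1 ^+ n * expR (- y^-1).
  have xn0 : x != 0 by rewrite gt_eqF.
  have di : is_derive x 1 (fun y : R => y^-1) (- x ^- 2).
    have := @is_deriveV R id x 1 1 xn0 (is_derive_id _ _).
    by rewrite /GRing.scale/= mulr1.
  have dX : is_derive x 1 (fun y : R => y^-1 ^+ n) (n%:R * x^-1 ^+ n.-1 * - x ^- 2).
    by have := @is_deriveX _ _ (fun y : R => y^-1) n x 1 _ di; rewrite exprfctE.
  have dN : is_derive x 1 (fun y : R => - y^-1) (x ^- 2).
    by have := is_deriveN di; rewrite opprK.
  have dE : is_derive x 1 (fun y : R => expR (- y^-1)) (expR (- x^-1) * x ^- 2).
    exact: (@is_derive1_comp _ expR (fun y : R => - y^-1)).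
  have dh : is_derive x 1 h (x^-1 ^+ n * (expR (- x^-1) * x ^- 2) +
      expR (- x^-1) * (n%:R * x^-1 ^+ n.-1 * - x ^- 2)).
    exact: is_deriveM.
  have -> : flat n.+2 x + (- n%:R) * flat n.+1 x = x^-1 ^+ n * (expR (- x^-1) * x ^- 2) +
      expR (- x^-1) * (n%:R * x^-1 ^+ n.-1 * - x ^- 2).
    rewrite /flat x0; case: (n) => [|m]; first by rewrite !exprS !expr0; field.
    by rewrite !exprS /=; field.
  apply: near_eq_is_derive dh; near=> z; rewrite /flat /h.
  suff -> : 0 < z by [].
  by near: z; exact: lt_nbhsr.
- rewrite x0; have -> : flat n.+2 0 + (- n%:R) * flat n.+1 0 = flat n.+1 0.
    by rewrite /flat ltxx mulr0 addr0.
  apply/is_derive1_caratheodory; exists (flat n.+1); split => //.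
    by move=> z; rewrite [flat n 0]/flat ltxx !subr0 flatS.
  exact: continuous_flat0.
Unshelve. all: by end_near. Qed.

Lemma nsmooth_flat m n : nsmooth m (flat n).
Proof.
elim: m n => [//|m IH] n; eexists; first by move=> x; exact: is_derive_flat.
apply: nsmoothD; first exact: IH.
by apply: nsmoothM; [exact: nsmooth_cst|exact: IH].
Qed.

Definition bump x := flat 0 x * flat 0 (1 - x).

Lemma nsmooth_bump n : nsmooth n bump.
Proof.
apply: nsmoothM; first exact: nsmooth_flat.
have := @nsmooth_affine n _ (-1) 1 (nsmooth_flat n 0).
by congr nsmooth; apply/funext => x; rewrite mulN1r addrC.
Qed.

Lemma continuous_bump : continuous bump.
Proof.
move=> x; case: (nsmooth_bump 1) => f' /(_ x) df _.
by apply: differentiable_continuous; apply/derivable1_diffP; case: df.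
Qed.

Lemma bump_ge0 x : 0 <= bump x.
Proof. by rewrite mulr_ge0 ?flat_ge0. Qed.

Lemma bump_le1 x : bump x <= 1.
Proof. by rewrite mulr_ile1 ?flat_ge0 ?flat0_le1. Qed.

Lemma bump_out x : x <= 0 \/ 1 <= x -> bump x = 0.
Proof.
rewrite /bump /flat => -[x0|x1]; first by rewrite ltNge x0 mul0r.
by rewrite subr_gt0 [x < 1]ltNge x1 mulr0.
Qed.

Lemma bump_ge x : 4^-1 <= x <= 3 / 4 -> expR (- 8) <= bump x.
Proof.
move=> /andP[x1 x2]; have x0 : 0 < x by apply: lt_le_trans x1.
have key z : 0 < z -> 4^-1 <= z -> expR (- 4) <= flat 0 z.
  move=> z0 z4; rewrite /flat z0 expr0 mul1r ler_expR lerN2.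
  by rewrite -(invrK 4) lef_pV2 ?posrE// invr_gt0.
have -> : expR (- 8) = expR (- 4) * expR (- 4) :> R by rewrite -expRD; congr expR; ring.
by rewrite ler_pM ?expR_ge0// key//; move: x2; lra.
Qed.

Definition step x := \int[mu]_(y in `]-oo, x]) bump y.

Let bump_tail x : mu.-integrable `]-oo, x] (EFin \o bump).
Proof.
have mb : measurable_fun setT bump by exact: (continuous_measurable (@continuous_bump)).
have i1 : mu.-integrable `]-oo, x] (EFin \o (fun y => expR y)).
  have [] := @tail_integrable R expR expR x (fun y => is_derive_expR y) _ _ _ => //.
  - exact: continuous_expR.
apply: (ae_dominated_integrable _ _ i1) => //; first exact: measurable_funTS.
apply: aeW => y _; rewrite ger0_norm ?bump_ge0//.
have [y0|y0] := leP y 0; first by rewrite bump_out ?expR_ge0//; left.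
by rewrite (le_trans (bump_le1 y))// -expR0 ler_expR ltW.
Qed.

Lemma primitive_step : primitive step bump.
Proof.
apply: integrable_primitive.
- exact: (continuous_measurable (@continuous_bump)).
- exact: (continuous_locally_bounded (@continuous_bump)).
- exact: bump_tail.
Qed.

Lemma is_derive_step x : is_derive x 1 step (bump x).
Proof. by apply: (primitive_is_derive primitive_step); exact: (@continuous_bump). Qed.

Lemma nsmooth_step n : nsmooth n step.
Proof. by case: n => // n; exists bump; [exact: is_derive_step|exact: nsmooth_bump]. Qed.

Lemma step_le0 x : x <= 0 -> step x = 0.
Proof.
move=> x0; rewrite /step; under eq_Rintegral => y.
  rewrite inE/= in_itv/= => yx; rewrite bump_out; last by left; exact: le_trans yx x0.
  over.
by rewrite /Rintegral integral0.
Qed.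

Lemma step_ge1 x : 1 <= x -> step x = step 1.
Proof.
move=> x1; rewrite /step (@Rintegral_split _ _ -oo%O 1 x _ x1 (bump_tail x))//.
rewrite [X in _ + X](_ : _ = 0) ?addr0//.
  under eq_Rintegral => y.
  rewrite inE/= in_itv/= => /andP[y1 _]; rewrite bump_out; last by right.
  over.
by rewrite /Rintegral integral0.
Qed.

Lemma step_nondecreasing x y : x <= y -> step x <= step y.
Proof.
move=> xy; rewrite /step (@Rintegral_split _ _ -oo%O x y _ xy (bump_tail y))// lerDl.
by apply: Rintegral_ge0 => t _; exact: bump_ge0.
Qed.

(** The value [step 1] is the mass of the bump. The bump is not normalised; this factor appears on
    both sides of the du Bois-Reymond identity and is cancelled there, for which positivity is
    enough. *)
Lemma step1_gt0 : 0 < step 1.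
Proof.
have [_ _ pst] := primitive_step.
have h : step 4^-1 + expR (- 8) * (3 / 4 - 4^-1) <= step (3 / 4).
  rewrite -lerBrDl pst; last by lra.
  have -> : expR (- 8) * (3 / 4 - 4^-1) = \int[mu]_(x in `[4^-1, 3 / 4]) cst (expR (- 8)) x.
    rewrite (@Rintegral_cst _ (measurableTypeR R))//= lebesgue_measure_itv/= lte_fin.
    by rewrite ifT//; lra.
  apply: le_Rintegral => //.
  - exact: cst_integrable_itv.
  - apply: locally_bounded_integrable; first exact: (continuous_measurable (@continuous_bump)).
    exact: (continuous_locally_bounded (@continuous_bump)).
  - by move=> x; rewrite /= in_itv/= => /bump_ge.
have s0 : 0 <= step 4^-1 by apply: Rintegral_ge0 => t _; exact: bump_ge0.
have h1 : step (3 / 4) <= step 1 by apply: step_nondecreasing; lra.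
apply: lt_le_trans h1; apply: lt_le_trans h.
by rewrite ltr_wpDl// mulr_gt0//; lra.
Qed.

Lemma step_bounds x : 0 <= step x <= step 1.
Proof.
rewrite Rintegral_ge0//=; last by move=> t _; exact: bump_ge0.
have [x1|/ltW x1] := leP 1 x; first by rewrite step_ge1.
exact: step_nondecreasing.
Qed.

(** A smooth approximation of [step 1] times the indicator of []a, b]]: its derivative is an
    approximate identity just to the right of a minus one just to the right of b. *)
Definition plateau a b d x := step ((x - a) / d) - step ((x - b) / d).

Lemma nsmooth_plateau n a b d : nsmooth n (plateau a b d).
Proof.
have h c : nsmooth n (fun x => step ((x - c) / d)).
  have := @nsmooth_affine n _ (d^-1) (- c / d) (nsmooth_step n).
  by congr nsmooth; apply/funext => x; congr step; ring.
apply: nsmoothD; first exact: h.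
have := nsmoothM (nsmooth_cst n (-1)) (h b).
by congr nsmooth; apply/funext => x; rewrite mulN1r.
Qed.

Lemma test_function_plateau a b d : a <= b -> 0 < d -> test_function (plateau a b d).
Proof.
move=> ab d0; split; first by apply: nsmooth_derivable => n; exact: nsmooth_plateau.
exists (`|a| + `|b| + d) => x; rewrite /plateau; have [x0|x0] := leP 0 x => hx.
  rewrite (ger0_norm x0) in hx.
  have xb : b + d < x.
    apply: le_lt_trans hx; rewrite lerD2r (le_trans (ler_norm b))// lerDr.
    exact: normr_ge0.
  have xa : a + d < x by apply: le_lt_trans xb; rewrite lerD2r.
  rewrite !step_ge1 ?subrr// ler_pdivlMr// mul1r lerBrDl; exact: ltW.
have xa : x < a.
  rewrite ltNge; apply/negP => ax; move: hx; rewrite (ltr0_norm x0) ltNge => /negP; apply.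
  have : - x <= `|a| by rewrite -(normrN a) (le_trans _ (ler_norm (- a)))// lerN2.
  by move=> /le_trans; apply; rewrite -addrA lerDl addr_ge0// ltW.
have xb : x < b by exact: lt_le_trans ab.
by rewrite !step_le0 ?subrr// pmulr_lle0 ?invr_gt0// subr_le0 ltW.
Qed.

Lemma derive_plateau a b d x :
  derive1 (plateau a b d) x = d^-1 * bump ((x - a) / d) - d^-1 * bump ((x - b) / d).
Proof.
have h c : is_derive x 1 (fun x => step ((x - c) / d)) (bump ((x - c) / d) * d^-1).
  have da : is_derive x 1 (fun x => (x - c) / d) (d^-1).
    by apply: is_derive_eq; rewrite /GRing.scale/=; ring.
  exact: (@is_derive1_comp _ step (fun x => (x - c) / d) x _ _ (is_derive_step _) da).
have hd := is_deriveB (h a) (h b).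
by rewrite derive1E (@derive_val _ _ _ _ _ _ _ hd) !(mulrC d^-1).
Qed.

(** * From weak derivatives to indefinite integrals *)

Section DuBoisReymond.
Variables (g h : R -> R) (M : R).
Hypotheses (lg : locally_integrable setT g) (mh : measurable_fun setT h)
  (h_le : {ae mu, forall x, `|h x| <= M})
  (weak : forall phi, test_function phi ->
     \int[mu]_x (derive1 phi x * g x) = - \int[mu]_x (phi x * h x)).

Let mg : measurable_fun setT g. Proof. by case: lg. Qed.

Let int_g a b : mu.-integrable `[a, b] (EFin \o g).
Proof.
apply/integrableP; split; first by apply/measurable_EFinP; exact: measurable_funTS.
by case: lg => _ _; apply => //; exact: segment_compact.
Qed.

Let d (n : nat) : R := n.+1%:R^-1.

Let d_gt0 n : 0 < d n. Proof. by rewrite invr_gt0. Qed.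

Let kernel a n x := (d n)^-1 * bump ((x - a) / d n).

Let continuous_kernel a n : continuous (kernel a n).
Proof.
move=> x; apply: cvgM; first exact: cvg_cst.
apply: (@continuous_comp _ _ _ (fun x => (x - a) / d n) bump); last exact: (@continuous_bump).
by apply: cvgM; [apply: cvgB; [exact: cvg_id|exact: cvg_cst]|exact: cvg_cst].
Qed.

Let kernel_out a n x : x <= a \/ a + d n <= x -> kernel a n x = 0.
Proof.
move=> h'; rewrite /kernel bump_out ?mulr0//; case: h' => h'; [left|right].
  by rewrite pmulr_lle0 ?invr_gt0// subr_le0.
by rewrite ler_pdivlMr// mul1r lerBrDl.
Qed.

Let kernel_le a n x : `|kernel a n x| <= (d n)^-1.
Proof.
have dn : 0 <= (d n)^-1 by rewrite invr_ge0 ltW.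
have k0 : 0 <= kernel a n x by apply: mulr_ge0 => //; exact: bump_ge0.
by rewrite (ger0_norm k0) /kernel ler_piMr// bump_le1.
Qed.

Let restrict_kernel a n f : \int[mu]_x (kernel a n x * f x) =
  \int[mu]_(x in `[a, a + d n]) (kernel a n x * f x).
Proof.
rewrite [RHS]Rintegral_mkcond; apply: eq_Rintegral => x _.
rewrite patchE; case: ifPn => //; rewrite notin_setE /= in_itv/= => /negP.
rewrite negb_and -!ltNge => /orP[xa|xa]; rewrite kernel_out ?mul0r//.
  by left; exact: ltW.
by right; exact: ltW.
Qed.

Let int_kernel a n f : measurable_fun setT f ->
  (forall x y, mu.-integrable `[x, y] (EFin \o f)) ->
  mu.-integrable `[a, a + d n] (EFin \o (fun x => kernel a n x * f x)).
Proof.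
move=> mf intf; apply: (@ae_dominated_integrable _ _ _ (fun x => (d n)^-1 * `|f x|)) => //.
- apply: measurable_funTS; apply: measurable_funM => //.
  exact: (continuous_measurable (@continuous_kernel a n)).
- by apply: integrable_EFinZl => //; exact: integrable_norm.
- by apply: aeW => x _; rewrite normrM ler_wpM2r// kernel_le.
Qed.

Let int_kernelT a n f : measurable_fun setT f ->
  (forall x y, mu.-integrable `[x, y] (EFin \o f)) ->
  mu.-integrable setT (EFin \o (fun x => kernel a n x * f x)).
Proof.
move=> mf intf; have := int_kernel a n mf intf.
rewrite (@integrable_mkcond _ (measurableTypeR R) R mu `[a, a + d n]%classic)//.
apply: eq_integrable => // x _ /=; rewrite patchE; case: ifPn => //.
rewrite notin_setE /= in_itv/= => /negP.
rewrite negb_and -!ltNge => /orP[xa|xa]; rewrite kernel_out ?mul0r//.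
  by left; exact: ltW.
by right; exact: ltW.
Qed.

Let kernel_mass a n : \int[mu]_(x in `[a, a + d n]) kernel a n x = step 1.
Proof.
have dk x : is_derive x 1 (fun x => step ((x - a) / d n)) (kernel a n x).
  have da : is_derive x 1 (fun x => (x - a) / d n) ((d n)^-1).
    by apply: is_derive_eq; rewrite /GRing.scale/=; ring.
  rewrite /kernel mulrC.
  exact: (@is_derive1_comp _ step (fun x => (x - a) / d n) x _ _ (is_derive_step _) da).
have [_ _ pk] := primitive_derive dk (@continuous_kernel a n).
rewrite -pk ?lerDl ?(ltW (d_gt0 n))//.
have -> : (a + d n - a) / d n = 1 by field; rewrite gt_eqF.
by rewrite subrr mul0r (step_le0 (lexx 0)) subr0.
Qed.

(** The kernel lives on [a, a + d] and is at most 1 / d. That segment lies in the open ball of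
    radius 2 d, of length 4 d, so the one-sided mean of [|g x - g a|] is at most 4 times the
    symmetric mean, which tends to 0 at a Lebesgue point. *)
Let average_cvg a : lebesgue_pt g a ->
  (fun n => \int[mu]_x (kernel a n x * g x)) @ \oo --> step 1 * g a.
Proof.
move=> lga.
have diff_le n : (`|\int[mu]_x (kernel a n x * g x) - step 1 * g a|%:E <=
    4%:E * davg g a (2 * d n))%E.
  have int_c x y : mu.-integrable `[x, y] (EFin \o (fun=> g a)).
    exact: cst_integrable_itv.
  have int_gc x y : mu.-integrable `[x, y] (EFin \o (fun x => g x - g a)).
    apply: eq_integrable (integrable_EFinD _ (int_g x y) (cst_integrable_itv x y (- g a))) => //.
  rewrite restrict_kernel -(kernel_mass a n) -RintegralZr//; last first.
    by apply: locally_bounded_integrable;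
     [exact: (continuous_measurable (@continuous_kernel a n))
     |exact: (continuous_locally_bounded (@continuous_kernel a n))].
  rewrite -RintegralB//; [|exact: int_kernel|exact: int_kernel].
  apply: (@le_trans _ _ ((\int[mu]_(x in `[a, a + d n]) ((d n)^-1 * `|g x - g a|))%:E)).
    rewrite lee_fin; apply: ae_dominated_Rintegral => //.
    - apply: measurable_funTS; apply: measurable_funB; apply: measurable_funM => //;
        exact: (continuous_measurable (@continuous_kernel a n)).
    - by apply: integrable_EFinZl => //; exact: integrable_norm.
    - by apply: aeW => x _; rewrite -mulrBr normrM ler_wpM2r// kernel_le.
  have ing : mu.-integrable `[a, a + d n] (EFin \o (fun x => `|g x - g a|)).
    exact: integrable_norm.
  rewrite RintegralZl// EFinM /Rintegral fineK; last exact: integrable_fin_num.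
  rewrite /davg /iavg lebesgue_measure_ball; last by rewrite mulr_ge0// ltW.
  have -> : (2 * d n *+ 2) = 4 * d n by rewrite mulr2n; ring.
  rewrite inver mulf_eq0 pnatr_eq0/= gt_eqF// muleA -EFinM.
  have -> : 4 * (4 * d n)^-1 = (d n)^-1 by field; rewrite gt_eqF.
  rewrite lee_wpmul2l ?lee_fin ?invr_ge0 ?(ltW (d_gt0 n))//.
  apply: ge0_subset_integral => //.
  - exact: measurable_ball.
  - apply/measurable_EFinP; apply: measurableT_comp => //; apply: measurable_funTS.
    exact: measurable_funB.
  - move=> x; rewrite /= in_itv/= ball_itv/= in_itv/= => /andP[ax xa].
    have := d_gt0 n; move: ax xa; move: (d n) => dn; lra.
apply/cvgrPdist_le => e e0.
have /cvge_at_rightP : davg g a r @[r --> 0%R^'+] --> 0%E by exact: lga.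
move=> /(_ (fun n => 2 * d n)) H.
have {}H : davg g a (2 * d n) @[n --> \oo] --> 0%E.
  apply: H; split; first by move=> n; rewrite mulr_gt0.
  rewrite -(mulr0 2); apply: cvgM; first exact: cvg_cst.
  exact: cvg_harmonic.
have e4 : (0 < (e / 4)%:E)%E by rewrite lte_fin divr_gt0.
near=> n.
rewrite distrC -lee_fin (le_trans (diff_le n))//.
have -> : e = 4 * (e / 4) by field.
rewrite EFinM lee_wpmul2l// ltW//.
near: n; exact: (H _ (open_ereal_lt' e4)).
Unshelve. all: by end_near. Qed.

Let h_int x y : mu.-integrable `[x, y] (EFin \o h).
Proof.
apply: locally_bounded_integrable => // a b; exists M.
by apply: ae_mono h_le => t H _.
Qed.

(** Since d n <= 1, all the plateaus are supported in [a, b + 1], which provides a common integrable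
    majorant. *)
Let plateau_cvg a b : a <= b ->
  (fun n => \int[mu]_x (plateau a b (d n) x * h x)) @ \oo -->
  step 1 * \int[mu]_(x in `]a, b]) h x.
Proof.
move=> ab; have ih : mu.-integrable `]a, b] (EFin \o h).
  by apply: (@integrableS _ (measurableTypeR R) R mu `[a, b] `]a, b] _ _ _ _ (h_int a b)) => //;
    exact: subset_itv_oc_cc.
rewrite -RintegralZl// Rintegral_mkcond.
have lim x : (fun n => plateau a b (d n) x) @ \oo --> (if a < x <= b then step 1 else 0).
  have st c : (fun n => step ((x - c) / d n)) @ \oo --> (if c < x then step 1 else 0).
    have [cx|xc] := ltP c x; last first.
      rewrite (_ : (fun n => _) = cst 0); first exact: cvg_cst.
      apply/funext => n; apply: step_le0.
      by rewrite pmulr_lle0 ?invr_gt0// subr_le0.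
    apply: (@cvg_near_cst _ _ (step 1)); near=> n.
    rewrite step_ge1// ler_pdivlMr// mul1r ltW//.
    near: n; have := @cvg_harmonic R.
    by move=> /cvgr_lt /(_ (x - c)); apply; rewrite subr_gt0.
  have -> : (if a < x <= b then step 1 else 0) =
      (if a < x then step 1 else 0) - (if b < x then step 1 else 0) :> R.
    have [ax|xa] /= := ltP a x; have [bx|xb] := ltP b x; rewrite ?subrr ?subr0//.
    by move: (lt_le_trans (le_lt_trans ab bx) xa); rewrite ltxx.
  by apply: cvgB; exact: st.
have plateau_le n x : `|plateau a b (d n) x| <= step 1.
  have /andP[h1 h2] := step_bounds ((x - a) / d n).
  have /andP[h3 h4] := step_bounds ((x - b) / d n).
  by rewrite /plateau ler_norml; lra.
have plateau_out n x : ~~ (a <= x <= b + 1) -> plateau a b (d n) x = 0.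
  have dn1 : d n <= 1 by rewrite invf_le1// ler1n.
  rewrite negb_and -!ltNge => /orP[xa|bx].
    have xb := lt_le_trans xa ab.
    by rewrite /plateau !step_le0 ?subrr// pmulr_lle0 ?invr_gt0// subr_le0 ltW.
  rewrite /plateau !step_ge1 ?subrr// ler_pdivlMr// mul1r; move: ab bx dn1; lra.
apply: (@dominated_cvg_Rintegral _ setT _ _ ((fun=> step 1 * M) \_ `[a, b + 1])) => //.
- move=> n; apply: measurable_funM => //; apply: continuous_measurable => x.
  case: (nsmooth_plateau 1 a b (d n)) => f' /(_ x) df _.
  by apply: differentiable_continuous; apply/derivable1_diffP; case: df.
- apply/measurable_restrict => //; apply: measurable_funTS; exact: measurable_funM.
- apply: aeW => x _; rewrite patchE.
  have := lim x; rewrite mem_setE in_itv/=; case: ifP => xab cv.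
    by apply: cvgM; [exact: cv|exact: cvg_cst].
  by rewrite -[X in _ --> X](mul0r (h x)); apply: cvgM; [exact: cv|exact: cvg_cst].
- have := cst_integrable_itv a (b + 1) (step 1 * M).
  rewrite (@integrable_mkcond _ (measurableTypeR R) R mu `[a, b + 1]%classic)//.
  by apply: eq_integrable => // x _; rewrite /= !patchE; case: ifP.
- move=> n; apply: ae_mono h_le => x hx _.
  rewrite patchE; case: ifPn => [_|]; first by rewrite normrM ler_pM.
  rewrite notin_setE /= in_itv /= => /negP xab.
  by rewrite plateau_out// mul0r normr0.
Unshelve. all: by end_near. Qed.

(* The derivative of a plateau is a difference of approximate identities, which
   converge to g (b) and g (a) at Lebesgue points; this gives g as an indefinite
   integral of h off a null set. *)
Lemma weak_derivative_primitive : exists2 G, primitive G h & {ae mu, forall x, G x = g x}.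
Proof.
have lpt := lebesgue_differentiation lg.
have key a b : a <= b -> lebesgue_pt g a -> lebesgue_pt g b ->
    g b - g a = \int[mu]_(x in `[a, b]) h x.
  move=> ab la lb.
  have ih : mu.-integrable `]a, b] (EFin \o h).
    by apply: (@integrableS _ (measurableTypeR R) R mu `[a, b] `]a, b] _ _ _ _ (h_int a b)) => //;
      exact: subset_itv_oc_cc.
  rewrite -Rintegral_itv_obnd_cbnd//.
  have c1 := cvgB (average_cvg la) (average_cvg lb).
  have c2 := cvgN (plateau_cvg ab).
  have eqs n : \int[mu]_x (kernel a n x * g x) - \int[mu]_x (kernel b n x * g x) =
      - \int[mu]_x (plateau a b (d n) x * h x).
    rewrite -weak; last exact: test_function_plateau.
    rewrite -RintegralB//; try exact: int_kernelT.
    by apply: eq_Rintegral => x _; rewrite derive_plateau mulrBl.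
  have : step 1 * g a - step 1 * g b = - (step 1 * \int[mu]_(x in `]a, b]) h x).
    apply: (@cvg_unique _ _ ((fun n => - \int[mu]_x (plateau a b (d n) x * h x)) @ \oo)) => //;
      last exact: c2.
    have -> : (fun n => - \int[mu]_x (plateau a b (d n) x * h x)) =
      (fun n => \int[mu]_x (kernel a n x * g x) - \int[mu]_x (kernel b n x * g x)).
      by apply/funext => n; rewrite eqs.
    exact: c1.
  rewrite -mulrBr -mulrN => /(mulfI (lt0r_neq0 step1_gt0)) e.
  by apply: oppr_inj; rewrite -e opprB.
have [a0 la0] : exists a0, lebesgue_pt g a0.
  apply: contrapT => nex; have : {ae mu, forall x : R, False}.
    by apply: ae_mono lpt => x lx; apply: nex; exists x.
  move=> [N [mN N0 sN]].
  have NT : N = setT by apply/seteqP; split => // x _; apply: sN => /=.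
  have : (mu `[0%R, 1%R] <= mu N)%E by rewrite NT le_measure// inE.
  rewrite N0 lebesgue_measure_itv/= lte01 oppr0 adde0 leNgt => /negP; apply.
  exact: lte01.
(* Anchoring at a Lebesgue point a0 makes the increment formula identify G with g at every Lebesgue
   point, on either side of a0. *)
pose G x := g a0 + if a0 <= x then \int[mu]_(y in `[a0, x]) h y
                   else - \int[mu]_(y in `[x, a0]) h y.
have bh : ae_locally_bounded h.
  by move=> a b; exists M; apply: ae_mono h_le => t H _.
exists G.
  split => // a b ab; rewrite /G.
  have sp x y z : x <= y -> y <= z -> \int[mu]_(t in `[x, z]) h t =
      \int[mu]_(t in `[x, y]) h t + \int[mu]_(t in `[y, z]) h t.
    by move=> xy yz; rewrite (@Rintegral_split _ _ (BLeft x) y z _ yz (h_int x z))// bnd_simp.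
  have [ab0|ba0] := leP a0 b; have [aa0|a0a] := leP a0 a.
  - by rewrite (sp a0 a b)//; ring.
  - by rewrite (sp a a0 b) ?(ltW a0a)//; ring.
  - by move: (lt_le_trans (le_lt_trans ab ba0) aa0); rewrite ltxx.
  - by rewrite (sp a b a0) ?(ltW ba0)//; ring.
apply: ae_mono lpt => x lx; rewrite /G.
have [ax|/ltW xa] := leP a0 x; first by rewrite -key// addrC subrK.
by rewrite -key// opprB addrC subrK.
Qed.

End DuBoisReymond.

Lemma ae_le_continuous f g : continuous f -> continuous g ->
  {ae mu, forall x, f x <= g x} -> forall x, f x <= g x.
Proof.
move=> cf cg [N [mN N0 sN]] x; rewrite leNgt; apply/negP => gf.
have : \forall y \near x, g y < f y.
  near=> y; rewrite -subr_gt0; near: y.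
  have : (fun y => f y - g y) @ x --> f x - g x by apply: cvgB; [exact: cf|exact: cg].
  by move/cvgr_gt; apply; rewrite subr_gt0.
move=> /nbhs_ballP[e /= e0 ball_e].
have : (mu (ball x e) <= mu N)%E.
  apply: le_measure; rewrite ?inE//; first exact: measurable_ball.
  by move=> y /ball_e gfy; apply: sN => /=; apply/negP; rewrite -ltNge.
rewrite N0 lebesgue_measure_ball; last exact: ltW.
by rewrite lee_fin leNgt => /negP; apply; rewrite mulrn_wgt0.
Unshelve. all: by end_near. Qed.

End TestFunctions.

(** * Exponential decay and dominated series *)

Section Decay.
Variable R : realType.
Notation mu := (@lebesgue_measure R).
Implicit Types (x y a b : R) (f g : R -> R).

Definition decay b x : R := expR (- (b * `|x|)).

Lemma decay_ge0 b x : 0 <= decay b x. Proof. exact: expR_ge0. Qed.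

Lemma continuous_decay b : continuous (decay b).
Proof.
move=> x; apply: (@continuous_comp _ _ _ (fun y => - (b * `|y|)) expR); last exact: continuous_expR.
by apply: cvgN; apply: cvgM; [exact: cvg_cst|exact: norm_continuous].
Qed.

Lemma decay_le1 b x : 0 <= b -> decay b x <= 1.
Proof. by move=> b0; rewrite -expR0 ler_expR oppr_le0 mulr_ge0. Qed.

Lemma decayM b c x : decay b x * decay c x = decay (b + c) x.
Proof. by rewrite /decay -expRD; congr expR; ring. Qed.

Lemma integrable_decay b : 0 < b -> mu.-integrable setT (EFin \o decay b).
Proof.
move=> b0.
have w0 y : 0 <= expR (b * y) / b by rewrite divr_ge0 ?expR_ge0// ltW.
have [il _] := @tail_integrable R _ _ 0 (fun y => is_derive_exp_scaled y b0)
  (@continuous_exp_scaled R b) (fun y => expR_ge0 _) w0.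
have ir := integrable_opp (measurable_itv _) il.
rewrite opp_preimage_Nyc oppr0 in ir.
rewrite (@integrable_mkcond _ (measurableTypeR R) R mu)// in il.
rewrite (@integrable_mkcond _ (measurableTypeR R) R mu)// in ir.
pose l x := if x <= 0 then expR (b * x) else 0 : R.
pose r x := if 0 <= x then expR (b * - x) else 0 : R.
have il' : mu.-integrable setT (EFin \o l).
  apply: eq_integrable il => // x _; rewrite patchE /l /=.
  by rewrite mem_setE in_itv/=; case: ifP.
have ir' : mu.-integrable setT (EFin \o r).
  apply: eq_integrable ir => // x _; rewrite patchE /r /=.
  by rewrite mem_setE in_itv/= andbT; case: ifP.
apply: (@ae_dominated_integrable _ _ _ (fun x => l x + r x)) => //.
- exact: (continuous_measurable (@continuous_decay b)).
- exact: integrable_EFinD.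
- apply: aeW => x _; rewrite ger0_norm ?decay_ge0// /decay /l /r.
  have [x0|x0] := leP 0 x.
    by rewrite (ger0_norm x0) -mulrN lerDr; case: ifP => // _; exact: expR_ge0.
  by rewrite (ltr0_norm x0) (ltW x0) mulrN opprK addr0.
Qed.

Definition decay_mass b := \int[mu]_x decay b x.

Lemma decay_mass_ge0 b : 0 <= decay_mass b.
Proof. by apply: Rintegral_ge0 => x _; exact: decay_ge0. Qed.

Lemma decay_integrable f b M : 0 < b -> measurable_fun setT f ->
  (forall x, `|f x| <= M * decay b x) ->
  mu.-integrable setT (EFin \o f) /\ `|\int[mu]_x f x| <= M * decay_mass b.
Proof.
move=> b0 mf fM; have id := @integrable_EFinZl R setT (decay b) M measurableT (integrable_decay b0).
have ae : {ae mu, forall x, setT x -> `|f x| <= M * decay b x} by exact: aeW.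
split; first exact: (ae_dominated_integrable _ _ id).
rewrite /decay_mass -RintegralZl//; last exact: integrable_decay.
exact: ae_dominated_Rintegral.
Qed.

Lemma decay_cvg b (u : nat -> R) M : 0 < b -> (forall n, `|u n| <= M * decay b n%:R) ->
  u @ \oo --> 0.
Proof.
move=> b0 uM.
have M0 : 0 <= M by rewrite -(pmulr_lge0 _ (expR_gt0 (- (b * `|0%:R|)))) (le_trans _ (uM 0%N)).
apply/cvgr0Pnorm_le => e e0.
near=> n; apply: (le_trans (uM n)).
have bn : 0 <= b * n%:R by apply: mulr_ge0; [exact: ltW|exact: ler0n].
have h : decay b n%:R <= (1 + b * n%:R)^-1.
  rewrite /decay normr_nat expRN lef_pV2 ?posrE ?expR_gt0 ?expR_ge1Dx//.
  by rewrite ltr_pwDl.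
apply: (le_trans (ler_wpM2l M0 h)); rewrite ler_pdivrMr ?ltr_pwDl//.
rewrite -ler_pdivrMl// (@le_trans _ _ (b * n%:R)) ?lerDr//.
rewrite -ler_pdivrMl//; near: n; exact: nbhs_infty_ger.
Unshelve. all: by end_near. Qed.

(** Truncating to [-n, n] leaves the boundary values F n - F (- n), which vanish in the limit by the
    decay of F. *)
Lemma Rintegral_primitive_decay F f b M : 0 < b -> primitive F f ->
  (forall x, `|F x| <= M * decay b x) -> mu.-integrable setT (EFin \o f) ->
  \int[mu]_x f x = 0.
Proof.
move=> b0 [mf bf Ff] FM intf.
pose I n : set R := `[- n%:R, n%:R]%classic.
have cv : (fun n => \int[mu]_x (f \_ (I n)) x) @ \oo --> \int[mu]_x f x.
  apply: (@dominated_cvg_Rintegral _ setT _ _ (fun x => `|f x|)) => //.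
  - by move=> n; apply/measurable_restrict => //; [exact: measurable_itv|exact: measurable_funTS].
  - apply: aeW => x _; apply: (@cvg_near_cst _ _ (f x)).
    near=> n; rewrite patchE mem_setE in_itv/= -ler_norml ifT//.
    by near: n; exact: nbhs_infty_ger.
  - exact: integrable_norm.
  - by move=> n; apply: aeW => x _; rewrite patchE; case: ifP => //; rewrite normr0.
have cv0 : (fun n => \int[mu]_x (f \_ (I n)) x) @ \oo --> 0.
  have -> : (fun n => \int[mu]_x (f \_ (I n)) x) = (fun n => F n%:R - F (- n%:R)).
    apply/funext => n; rewrite -Rintegral_mkcond Ff//.
    by rewrite (@le_trans _ _ 0) ?oppr_le0.
  rewrite -[X in _ --> X](subr0 0); apply: cvgB.
    exact: (@decay_cvg b (fun n => F n%:R) M).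
  apply: (@decay_cvg b (fun n => F (- n%:R)) M) => // n.
  by rewrite (le_trans (FM _))// /decay normrN.
exact: (cvg_unique _ cv cv0).
Unshelve. all: by end_near. Qed.

End Decay.

(** * Series of functions dominated termwise by a summable sequence *)

Section SumsOfFunctions.
Variable R : realType.
Notation mu := (@lebesgue_measure R).
Implicit Types (x y a b : R) (f g : nat -> R -> R).
Variable c : nat -> R.
Hypotheses (c0 : forall i, 0 <= c i) (cc : cvgn (series c)).

Lemma partial_sum_le n : series c n <= limn (series c).
Proof.
apply: limr_ge => //; near=> m.
have nm : (n <= m)%N by near: m; exact: nbhs_infty_ge.
rewrite -subr_ge0 sub_series_geq//; exact: sumr_ge0.
Unshelve. all: by end_near. Qed.

Lemma sum_limit_ge0 : 0 <= limn (series c).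
Proof. by apply: le_trans (partial_sum_le 0); rewrite /series/= big_geq. Qed.

Section Scalar.
Variables (u : nat -> R) (w : R).
Hypothesis uc : forall i, `|u i| <= c i * w.

Lemma dominated_series_cvg : series u @ \oo --> limn (series u).
Proof.
have cw : cvgn (series (fun i => c i * w)).
  have -> : series (fun i => c i * w) = (fun n => series c n * w).
    by apply/funext => n; rewrite /series/= mulr_suml.
  by apply: is_cvgMl.
have h : cvgn [normed series u].
  apply: (series_le_cvg _ _ _ cw) => //= i; exact: le_trans (normr_ge0 _) (uc i).
exact: (normed_cvg h).
Qed.

Lemma dominated_series_tail n : `|limn (series u) - series u n| <= (limn (series c) - series c n) * w.
Proof.
have cv : `|series u m - series u n| @[m --> \oo] --> `|limn (series u) - series u n|.
  by apply: cvg_norm; apply: cvgB; [exact: dominated_series_cvg|exact: cvg_cst].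
have cv' : (series c m - series c n) * w @[m --> \oo] --> (limn (series c) - series c n) * w.
  by apply: cvgM; [apply: cvgB; [exact: cc|exact: cvg_cst]|exact: cvg_cst].
apply: (ler_cvg_to cv cv'); near=> m.
have nm : (n <= m)%N by near: m; exact: nbhs_infty_ge.
rewrite !sub_series_geq// mulr_suml (le_trans (ler_norm_sum _ _ _))//.
by apply: ler_sum => i _; exact: uc.
Unshelve. all: by end_near. Qed.

Lemma dominated_series_le : `|limn (series u)| <= limn (series c) * w.
Proof.
by have := dominated_series_tail 0; rewrite /series/= !big_geq// !subr0.
Qed.

Lemma dominated_partial_le n : `|series u n| <= limn (series c) * w.
Proof.
(* The sign of w follows from the domination: a positive [c i] forces w >= 0, and otherwise every
   term of both series vanishes. *)
have w0 : (forall i, c i = 0) \/ 0 <= w.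
  have [[i ci]|h] := pselect (exists i, c i != 0); [right|left].
    have ci0 : 0 < c i by rewrite lt_neqAle eq_sym ci c0.
    by rewrite -(pmulr_rge0 _ ci0) (le_trans _ (uc i)).
  by move=> i; apply: contrapT => ci; apply: h; exists i; apply/eqP.
case: w0 => [cz|w0].
  rewrite (_ : series c = cst 0) ?lim_cst// ?mul0r.
    rewrite /series/= big1 ?normr0// => i _; apply/eqP; rewrite -normr_le0.
    by rewrite (le_trans (uc i))// cz mul0r.
  by apply/funext => k; rewrite /series/= big1// => i _; exact: cz.
apply: (@le_trans _ _ (series c n * w)).
  by rewrite /series/= (le_trans (ler_norm_sum _ _ _))// mulr_suml; apply: ler_sum => i _; exact: uc.
by rewrite ler_wpM2r// partial_sum_le.
Qed.

End Scalar.

Definition fsum f x : R := limn (series (fun i => f i x)).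

Lemma measurable_partial_sum f n : (forall i, measurable_fun setT (f i)) ->
  measurable_fun setT (fun x => series (fun i => f i x) n).
Proof. by move=> mf; apply: measurable_sum. Qed.

Lemma measurable_fsum f (w : R -> R) : (forall i, measurable_fun setT (f i)) ->
  (forall i x, `|f i x| <= c i * w x) -> measurable_fun setT (fsum f).
Proof.
move=> mf fw; apply: (@measurable_fun_cvg _ (measurableTypeR R) R setT
  (fun n x => series (fun i => f i x) n)).
  by move=> n; exact: measurable_partial_sum.
by move=> x _; exact: (dominated_series_cvg (fun i => fw i x)).
Qed.

Lemma primitive_sum (P f : nat -> R -> R) n : (forall i, primitive (P i) (f i)) ->
  primitive (fun x => series (fun i => P i x) n) (fun x => series (fun i => f i x) n).
Proof.
move=> pf; elim: n => [|n IH].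
  apply: eq_primitive (primitive_cst (0 : R)) => x; by rewrite /series/= big_geq.
apply: eq_primitive (primitiveD IH (pf n)) => x; by rewrite seriesSr.
Qed.

Lemma primitive_fsum (P f : nat -> R -> R) M (w : R -> R) : (forall i, primitive (P i) (f i)) ->
  (forall i x, `|f i x| <= c i * M) -> (forall i x, `|P i x| <= c i * w x) ->
  primitive (fsum P) (fsum f).
Proof.
move=> pf fM Pw.
have mf i : measurable_fun setT (f i) by case: (pf i).
have ms : measurable_fun setT (fsum f) by exact: (measurable_fsum mf fM).
have fs x := dominated_series_le (fM ^~ x).
split => //.
  by move=> a b; exists (limn (series c) * M); apply: aeW => x _; exact: fs.
move=> a b ab.
have cv1 : (fun n => series (fun i => P i b) n - series (fun i => P i a) n) @ \oo -->
    fsum P b - fsum P a.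
  by apply: cvgB; exact: (dominated_series_cvg (Pw ^~ _)).
apply: (cvg_unique _ cv1) => //.
have -> : (fun n => series (fun i => P i b) n - series (fun i => P i a) n) =
    (fun n => \int[mu]_(x in `[a, b]) (series (fun i => f i x) n)).
  by apply/funext => n; case: (primitive_sum n pf) => _ _ ->.
apply: (@dominated_cvg_Rintegral _ _ _ _ (cst (limn (series c) * M))) => //.
- by move=> n; apply: measurable_funTS; exact: measurable_partial_sum.
- exact: measurable_funTS.
- apply: aeW => x _; exact: (dominated_series_cvg (fM ^~ x)).
- exact: cst_integrable_itv.
- move=> n; apply: aeW => x _; exact: (dominated_partial_le (fM ^~ x)).
Qed.

End SumsOfFunctions.

(** * Oscillating modes *)

Section Oscillations.
Variable R : realType.
Notation mu := (@lebesgue_measure R).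
Implicit Types (x y k : R) (f g : R -> R).

(* The real part of (f + i g) e^(i k x). *)
Definition osc k f g x : R := f x * cos (k * x) - g x * sin (k * x).

Lemma primitive_cos k : primitive (fun x => cos (k * x)) (fun x => - (k * sin (k * x))).
Proof.
apply: primitive_derive => x.
  by apply: is_derive_eq; rewrite /GRing.scale/=; ring.
apply: cvgN; apply: cvgM; first exact: cvg_cst.
apply: (@continuous_comp _ _ _ (fun y => k * y) sin); last exact: continuous_sin.
by apply: cvgM; [exact: cvg_cst|exact: cvg_id].
Qed.

Lemma primitive_sin k : primitive (fun x => sin (k * x)) (fun x => k * cos (k * x)).
Proof.
apply: primitive_derive => x.
  by apply: is_derive_eq; rewrite /GRing.scale/=; ring.
apply: cvgM; first exact: cvg_cst.
apply: (@continuous_comp _ _ _ (fun y => k * y) cos); last exact: continuous_cos.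
by apply: cvgM; [exact: cvg_cst|exact: cvg_id].
Qed.

Lemma measurable_osc k f g : measurable_fun setT f -> measurable_fun setT g ->
  measurable_fun setT (osc k f g).
Proof.
move=> mf mg; apply: measurable_funB; apply: measurable_funM => //.
  exact: continuous_measurable (primitive_continuous (primitive_cos k)).
exact: continuous_measurable (primitive_continuous (primitive_sin k)).
Qed.

Lemma osc_le k f g x M : `|f x| <= M -> `|g x| <= M -> `|osc k f g x| <= 2 * M.
Proof.
move=> fM gM; have M0 := le_trans (normr_ge0 _) fM.
have hc : `|cos (k * x)| <= 1 by rewrite ler_norml cos_geN1 cos_le1.
have hs : `|sin (k * x)| <= 1 by rewrite ler_norml sin_geN1 sin_le1.
rewrite (le_trans (ler_normB _ _))// mulr2n mulrDl mul1r !normrM.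
by rewrite lerD// -[leRHS]mulr1 ler_pM.
Qed.

(** In complex notation an integration by parts divides f + i g by i k, and (f + i g) / (i k) = (g -
    i f) / k: the pair (f, g) is rotated into (g, - f). *)
Lemma osc_ibp k f f' g g' : k != 0 -> primitive f f' -> primitive g g' ->
  primitive (fun x => k^-1 * osc k g (fun y => - f y) x)
    (fun x => osc k f g x + k^-1 * osc k g' (fun y => - f' y) x).
Proof.
move=> k0 pf pg.
have p1 := primitiveM pg (primitive_cos k).
have p2 := primitiveM pf (primitive_sin k).
apply: eq_primitive (primitiveZ (k^-1) (primitiveD p1 p2)) => x; rewrite /osc; first by ring.
by field.
Qed.

Lemma oscM k l f g f' g' x : osc k f g x * osc l f' g' x =
  2^-1 * osc (k + l) (fun y => f y * f' y - g y * g' y) (fun y => f y * g' y + g y * f' y) x +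
  2^-1 * osc (k - l) (fun y => f y * f' y + g y * g' y) (fun y => g y * f' y - f y * g' y) x.
Proof. by rewrite /osc (mulrDl k l x) (mulrBl x k l) cosD sinD cosB sinB; field. Qed.

(** One integration by parts gains 1 / k; the boundary term is a decaying primitive, whose
    derivative has zero integral. *)
Lemma osc_mean_le k f f' g g' b M : 0 < b -> k != 0 -> primitive f f' -> primitive g g' ->
  (forall x, `|f x| <= M * decay b x) -> (forall x, `|g x| <= M * decay b x) ->
  (forall x, `|f' x| <= M * decay b x) -> (forall x, `|g' x| <= M * decay b x) ->
  `|\int[mu]_x osc k f g x| <= `|k^-1| * (2 * M * decay_mass b).
Proof.
move=> b0 k0 pf pg fM gM fM' gM'; have [mf' _ _] := pf; have [mg' _ _] := pg.
have mf := continuous_measurable (primitive_continuous pf).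
have mg := continuous_measurable (primitive_continuous pg).
have le1 x : `|osc k f g x| <= 2 * M * decay b x by rewrite -mulrA osc_le.
have le2 x : `|osc k g' (fun y => - f' y) x| <= 2 * M * decay b x.
  by rewrite -mulrA osc_le// normrN.
have m1 : measurable_fun setT (osc k f g) by exact: measurable_osc.
have m2 : measurable_fun setT (osc k g' (fun y => - f' y)).
  by apply: measurable_osc => //; exact: measurableT_comp.
have [i1 _] := decay_integrable b0 m1 le1.
have [i2 l2] := decay_integrable b0 m2 le2.
have i3 := @integrable_EFinZl R setT _ (k^-1) measurableT i2.
have h0 := @Rintegral_primitive_decay R _ _ b (`|k^-1| * (2 * M)) b0 (osc_ibp k0 pf pg) _
  (integrable_EFinD measurableT i1 i3).
have : \int[mu]_x osc k f g x = - (k^-1 * \int[mu]_x osc k g' (fun y => - f' y) x).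
  apply/eqP; rewrite -addr_eq0 -RintegralZl// -RintegralD//; apply/eqP; apply: h0 => x.
  by rewrite normrM -!mulrA ler_wpM2l// osc_le// normrN.
by move=> ->; rewrite normrN normrM ler_wpM2l.
Qed.

End Oscillations.

(** * The oscillating potential and its small primitive *)

Section Potential.
Variable R : realType.
Notation mu := (@lebesgue_measure R).
Implicit Types (x y e : R).
Variables (beta theta : R) (lam : nat -> R) (a b : nat -> nat -> R -> R) (c : nat -> R).
Hypotheses (beta0 : 0 < beta) (theta0 : 0 < theta) (lam_ge : forall i, theta <= `|lam i|).
Hypotheses (c0 : forall i, 0 <= c i) (cc : cvgn (series c)).
Hypotheses (pa : forall l i, (l < 3)%N -> primitive (a l i) (a l.+1 i))
  (pb : forall l i, (l < 3)%N -> primitive (b l i) (b l.+1 i))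
  (ac : forall l i x, (l <= 3)%N -> `|a l i x| <= c i * decay beta x)
  (bc : forall l i x, (l <= 3)%N -> `|b l i x| <= c i * decay beta x).

Definition freq e i : R := 2 * pi * lam i / e.

(** The order-e part of the primitive, divided by e: the first integration by parts divides the
    amplitude 2 by the frequency 2 pi lam / e, and the quotient is e / (pi lam). *)
Definition leading e := fsum (fun i x => (pi * lam i)^-1 * osc (freq e i) (b 0 i) (fun y => - a 0 i y) x).

(** The modes of indices j and -j are conjugate, so each pair is twice a real part and only positive
    j remain, shifted to start at 0. *)
Definition potential e := fsum (fun i x => 2 * osc (freq e i) (a 0 i) (b 0 i) x).

Let C := limn (series c).

Let C0 : 0 <= C. Proof. exact: (sum_limit_ge0 c0). Qed.

Lemma lam_neq0 i : lam i != 0.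
Proof. by rewrite -normr_gt0 (lt_le_trans theta0). Qed.

Lemma invr_lam_le i : `|(pi * lam i)^-1| <= theta^-1.
Proof.
have pi1 : 1 <= pi :> R by rewrite (le_trans _ (pi_ge2 R))// ler1n.
rewrite normrV ?unitfE ?mulf_neq0 ?lam_neq0 ?gt_eqF ?pi_gt0//.
rewrite lef_pV2 ?posrE// normrM ?(ger0_norm (pi_ge0 _)).
  by rewrite (le_trans (lam_ge i))// ler_peMl.
by rewrite mulr_gt0 ?pi_gt0// (lt_le_trans theta0).
Qed.

Lemma invr_freqE e i : (freq e i)^-1 = 2^-1 * e * (pi * lam i)^-1.
Proof. by rewrite /freq !invfM invrK; ring. Qed.

Lemma leading_term_le e i x :
  `|(pi * lam i)^-1 * osc (freq e i) (b 0 i) (fun y => - a 0 i y) x| <=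
  c i * (theta^-1 * 2 * decay beta x).
Proof.
rewrite normrM [leRHS](_ : _ = theta^-1 * (2 * (c i * decay beta x))); last by ring.
by rewrite ler_pM// ?invr_lam_le// osc_le// ?normrN ?ac ?bc.
Qed.

(* 1 + theta^-1 + theta^-1 ^+ 2 + theta^-1 ^+ 3 dominates the inverse frequencies
   of all three integrations by parts. *)
Definition potential_bound := C * (4 * (1 + theta^-1 + theta^-1 ^+ 2 + theta^-1 ^+ 3)).

Lemma oscillating_primitive e : 0 < e -> e < 1 ->
  let B := potential_bound in
  exists p r : R -> R, [/\ measurable_fun setT r,
    forall x, `|potential e x| <= B * decay beta x,
    primitive p (fun x => potential e x + r x),
    forall x, `|p x| <= B * e * decay beta x /\ `|p x - e * leading e x| <= B * e ^+ 2 * decay beta x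
   & forall x, `|r x| <= B * e ^+ 3 * decay beta x].
Proof.
move=> e0 e1 B.
pose t : R := theta^-1; pose T : R := 4 * (1 + t + t ^+ 2 + t ^+ 3).
have t0 : 0 <= t by rewrite invr_ge0 ltW.
have t20 : 0 <= t ^+ 2 by exact: exprn_ge0.
have t30 : 0 <= t ^+ 3 by exact: exprn_ge0.
have ee0 := ltW e0; have e20 : 0 <= e ^+ 2 by exact: exprn_ge0.
have e21 : e ^+ 2 <= e by rewrite expr2 ler_piMl// ltW.
have e32 : e ^+ 3 <= e ^+ 2 by rewrite exprS ler_piMl// ltW.
pose k := freq e; pose v i := (k i)^-1.
have v_le i : `|v i| <= e * t.
  rewrite /v /k invr_freqE normrM (@ger0_norm _ (2^-1 * e)); last by rewrite mulr_ge0.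
  rewrite ler_pM// ?invr_lam_le//; first by rewrite mulr_ge0.
  by rewrite ler_piMl// invf_le1// ler1n.
have k0 i : k i != 0.
  by rewrite /k /freq !mulf_neq0 ?lam_neq0 ?invr_eq0 ?gt_eqF ?pi_gt0.
have v2_le i : `|v i ^+ 2| <= e ^+ 2 * t ^+ 2.
  by rewrite normrX -exprMn lerXn2r ?nnegrE// mulr_ge0.
have v3_le i : `|v i ^+ 3| <= e ^+ 3 * t ^+ 3.
  by rewrite normrX -exprMn lerXn2r ?nnegrE// mulr_ge0.
pose O0 i := osc (k i) (a 0 i) (b 0 i).
pose O1 i := osc (k i) (b 0 i) (fun y => - a 0 i y).
pose O2 i := osc (k i) (fun y => - a 1 i y) (fun y => - b 1 i y).
pose O3 i := osc (k i) (fun y => - b 2 i y) (fun y => - - a 2 i y).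
pose O4 i := osc (k i) (fun y => - b 3 i y) (fun y => - - a 3 i y).
(* [O1], [O2], [O3] are the boundary terms of three successive integrations by parts, each with the
   pair rotated and one more derivative. In the alternating sum the intermediate remainders
   telescope; only [Q], with the third derivatives and v^3, survives. *)
pose P i x := 2 * (v i * O1 i x - v i ^+ 2 * O2 i x + v i ^+ 3 * O3 i x).
pose Q i x := 2 * v i ^+ 3 * O4 i x.
pose f i x := 2 * O0 i x.
have pP i : primitive (P i) (fun x => f i x + Q i x).
  have s0 := osc_ibp (k0 i) (pa i (isT : (0 < 3)%N)) (pb i (isT : (0 < 3)%N)).
  have s1 := osc_ibp (k0 i) (pb i (isT : (1 < 3)%N)) (primitiveN (pa i (isT : (1 < 3)%N))).
  have s2 := osc_ibp (k0 i) (primitiveN (pa i (isT : (2 < 3)%N))) (primitiveN (pb i (isT : (2 < 3)%N))).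
  have := primitiveZ 2 (primitiveD (primitiveB s0 (primitiveZ (v i) s1)) (primitiveZ (v i ^+ 2) s2)).
  apply: eq_primitive => x; rewrite /P /f /Q /O0 /O1 /O2 /O3 /O4 -/(v i); first by ring.
  by ring.
have O0le i x : `|O0 i x| <= 2 * (c i * decay beta x) by apply: osc_le; [exact: ac|exact: bc].
have O1le i x : `|O1 i x| <= 2 * (c i * decay beta x).
  by apply: osc_le; rewrite ?normrN; [exact: bc|exact: ac].
have O2le i x : `|O2 i x| <= 2 * (c i * decay beta x).
  by apply: osc_le; rewrite ?normrN; [exact: ac|exact: bc].
have O3le i x : `|O3 i x| <= 2 * (c i * decay beta x).
  by apply: osc_le; rewrite ?normrN; [exact: bc|exact: ac].
have O4le i x : `|O4 i x| <= 2 * (c i * decay beta x).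
  by apply: osc_le; rewrite ?normrN; [exact: bc|exact: ac].
have cd i x : 0 <= c i * decay beta x by rewrite mulr_ge0// decay_ge0.
have fle i x : `|f i x| <= c i * (T * decay beta x).
  rewrite /f normrM ger0_norm// (le_trans (ler_wpM2l _ (O0le i x)))//.
  by have := cd i x; rewrite /T; nra.
have Qle i x : `|Q i x| <= c i * (T * e ^+ 3 * decay beta x).
  rewrite /Q -mulrA normrM (@ger0_norm _ 2)//.
  have h : `|v i ^+ 3 * O4 i x| <= e ^+ 3 * t ^+ 3 * (2 * (c i * decay beta x)).
    by rewrite normrM; exact: ler_pM.
  rewrite (le_trans (ler_wpM2l _ h))//.
  have d0 : 0 <= e ^+ 3 * (c i * decay beta x) by rewrite mulr_ge0// exprn_ge0.
  have : 0 <= e ^+ 3 * (c i * decay beta x) * (1 + t + t ^+ 2) by rewrite mulr_ge0// !addr_ge0.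
  by rewrite /T; nra.
have Dle i x : `|P i x - e * ((pi * lam i)^-1 * O1 i x)| <= c i * (T * e ^+ 2 * decay beta x).
  have -> : P i x - e * ((pi * lam i)^-1 * O1 i x) = 2 * (v i ^+ 3 * O3 i x - v i ^+ 2 * O2 i x).
    by rewrite /P {1}/v /k invr_freqE; set w := (pi * lam i)^-1; field.
  rewrite normrM ger0_norm//.
  have h2 : `|v i ^+ 2 * O2 i x| <= e ^+ 2 * t ^+ 2 * (2 * (c i * decay beta x)).
    by rewrite normrM; exact: ler_pM.
  have h3 : `|v i ^+ 3 * O3 i x| <= e ^+ 2 * t ^+ 3 * (2 * (c i * decay beta x)).
    rewrite normrM; apply: ler_pM => //; apply: (le_trans (v3_le i)).
    by rewrite ler_wpM2r.
  have h := le_trans (ler_normB _ _) (lerD h3 h2).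
  rewrite (le_trans (ler_wpM2l _ h))//.
  have : 0 <= e ^+ 2 * (c i * decay beta x) * (1 + t).
    by apply: mulr_ge0; [exact: mulr_ge0|exact: addr_ge0].
  by rewrite /T; nra.
have Ple i x : `|P i x| <= c i * (T * e * decay beta x).
  rewrite /P normrM ger0_norm//.
  have h1 : `|v i * O1 i x| <= e * t * (2 * (c i * decay beta x)).
    by rewrite normrM; exact: ler_pM.
  have h2 : `|v i ^+ 2 * O2 i x| <= e * t ^+ 2 * (2 * (c i * decay beta x)).
    rewrite normrM; apply: ler_pM => //; apply: (le_trans (v2_le i)).
    by rewrite ler_wpM2r.
  have h3 : `|v i ^+ 3 * O3 i x| <= e * t ^+ 3 * (2 * (c i * decay beta x)).
    rewrite normrM; apply: ler_pM => //; apply: (le_trans (v3_le i)).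
    by rewrite ler_wpM2r// (le_trans e32).
  have h := le_trans (ler_normD _ _) (lerD (le_trans (ler_normB _ _) (lerD h1 h2)) h3).
  rewrite (le_trans (ler_wpM2l _ h))//.
  have : 0 <= e * (c i * decay beta x) by exact: mulr_ge0.
  by rewrite /T; nra.
have T0 : 0 <= T by rewrite /T mulr_ge0// !addr_ge0.
have mQ i : measurable_fun setT (Q i).
  have [ma _ _] := pa i (isT : (2 < 3)%N); have [mb _ _] := pb i (isT : (2 < 3)%N).
  apply: measurable_funM => //; apply: measurable_osc; first exact: measurableT_comp.
  by apply: measurableT_comp => //; exact: measurableT_comp.
have fQle i x : `|f i x + Q i x| <= c i * (T + T).
  have d1 := decay_le1 x (ltW beta0).
  rewrite mulrDr (le_trans (ler_normD _ _))// lerD//.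
    by rewrite (le_trans (fle i x))// ler_wpM2l// ler_piMr.
  have ed : e ^+ 3 * decay beta x <= 1.
    by rewrite mulr_ile1 ?exprn_ge0 ?decay_ge0// exprn_ile1// ltW.
  by rewrite (le_trans (Qle i x))// ler_wpM2l// -mulrA ler_piMr.
have cvf x := dominated_series_cvg cc (fle ^~ x).
have cvQ x := dominated_series_cvg cc (Qle ^~ x).
have cvP x := dominated_series_cvg cc (Ple ^~ x).
have cvL x := dominated_series_cvg cc (fun i => leading_term_le e i x).
have BE z w : B * z * w = C * (T * z * w) by rewrite -[B]/(C * T) !mulrA.
exists (fsum P), (fsum Q); split.
- exact: (measurable_fsum cc mQ Qle).
- by move=> x; rewrite /B /potential_bound -mulrA (dominated_series_le cc (fle ^~ x)).
- have := primitive_fsum c0 cc pP fQle Ple.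
  apply: eq_primitive => // x; apply: (cvg_lim (@Rhausdorff R)).
  rewrite (_ : series _ = (fun n => series (fun i => f i x) n + series (fun i => Q i x) n)).
    by apply: cvgD; [exact: cvf|exact: cvQ].
  by apply/funext => n; rewrite /series/= big_split.
- move=> x; split.
    by rewrite BE; exact: (dominated_series_le cc (Ple ^~ x)).
  rewrite BE.
  have -> : fsum P x - e * leading e x = limn (series (fun i => P i x - e * ((pi * lam i)^-1 * O1 i x))).
    apply/esym; apply: (cvg_lim (@Rhausdorff R)).
    rewrite (_ : series _ = (fun n => series (fun i => P i x) n - e * series (fun i => (pi * lam i)^-1 * O1 i x) n)).
      by apply: cvgB; [exact: cvP|apply: cvgM; [exact: cvg_cst|exact: cvL]].
    by apply/funext => n; rewrite /series/= mulr_sumr -sumrB.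
  exact: (dominated_series_le cc (Dle ^~ x)).
- move=> x; rewrite BE.
  exact: (dominated_series_le cc (Qle ^~ x)).
Qed.

End Potential.

(** * Averaging the square of the leading term *)

Section LeadingOrder.
Variable R : realType.
Notation mu := (@lebesgue_measure R).
Implicit Types (x y e : R).

Lemma cvg_partial_sum (T : Type) (F : set_system T) (FF : Filter F) (f : nat -> T -> R) (l : nat -> R) n :
  (forall i, f i @ F --> l i) ->
  (fun t => series (fun i => f i t) n) @ F --> series l n.
Proof.
move=> fl; elim: n => [|n IH].
  rewrite (_ : (fun t => _) = cst 0); last by apply/funext => t; rewrite /series/= big_geq.
  by rewrite (_ : series l 0 = 0); [exact: cvg_cst|rewrite /series/= big_geq].
rewrite (_ : (fun t => _) = (fun t => series (fun i => f i t) n + f n t)).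
  by rewrite seriesSr; apply: cvgD; [exact: IH|exact: fl].
by apply/funext => t; rewrite seriesSr.
Qed.

Lemma Rintegral_partial_sum (f : nat -> R -> R) n :
  (forall i, mu.-integrable setT (EFin \o f i)) ->
  mu.-integrable setT (EFin \o (fun x => series (fun i => f i x) n)) /\
  \int[mu]_x series (fun i => f i x) n = series (fun i => \int[mu]_x f i x) n.
Proof.
move=> fi; elim: n => [|n [IH1 IH2]].
  rewrite (_ : (fun x => _) = cst 0); last by apply/funext => t; rewrite /series/= big_geq.
  split; first exact: integrable0.
  by rewrite /Rintegral integral0 /series/= big_geq.
rewrite (_ : (fun x => _) = (fun t => series (fun i => f i t) n + f n t)); last first.
  by apply/funext => t; rewrite seriesSr.
by split; [exact: integrable_EFinD|rewrite RintegralD// IH2 seriesSr].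
Qed.

Lemma decay_mulr_le b M N (f g : R -> R) x : `|f x| <= M * decay b x -> `|g x| <= N * decay b x ->
  `|f x * g x| <= M * N * decay (b + b) x.
Proof.
move=> fM gN; rewrite normrM -decayM (le_trans (ler_pM _ _ fM gN))//.
by rewrite le_eqVlt; apply/orP; left; apply/eqP; ring.
Qed.

(** Amplitudes to which one integration by parts applies. The class is stable under the products met
    below, with doubled decay rate; the factor 4 in [slowly_varying_mulD] counts the four terms in
    the derivative of two products. *)
Definition slowly_varying (d K : R) (u : R -> R) := exists2 u', primitive u u' &
  forall x, `|u x| <= K * decay d x /\ `|u' x| <= K * decay d x.

Lemma slowly_varyingN d K u : slowly_varying d K u -> slowly_varying d K (fun x => - u x).
Proof.
case=> u' pu ub; exists (fun x => - u' x); first exact: primitiveN.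
by move=> x; rewrite !normrN.
Qed.

Lemma slowly_varying_mulD d K L u v w z : 0 <= K -> 0 <= L ->
  slowly_varying d K u -> slowly_varying d L v ->
  slowly_varying d K w -> slowly_varying d L z ->
  slowly_varying (d + d) (4 * (K * L)) (fun x => u x * v x + w x * z x).
Proof.
move=> K0 L0 [u' pu ub] [v' pv vb] [w' pw wb] [z' pz zb].
have := primitiveD (primitiveM pu pv) (primitiveM pw pz).
set h' := (X in primitive _ X) => ph.
exists h' => // x.
have [u1 u2] := ub x; have [v1 v2] := vb x; have [w1 w2] := wb x; have [z1 z2] := zb x.
have e1 := decay_mulr_le u1 v1; have e2 := decay_mulr_le w1 z1.
have e3 := decay_mulr_le u2 v1; have e4 := decay_mulr_le u1 v2.
have e5 := decay_mulr_le w2 z1; have e6 := decay_mulr_le w1 z2.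
have KL : 0 <= K * L * decay (d + d) x by rewrite !mulr_ge0// decay_ge0.
split; first by rewrite (le_trans (ler_normD _ _))// (le_trans (lerD e1 e2))//; lra.
rewrite (le_trans (ler_normD _ _))//.
rewrite (le_trans (lerD (le_trans (ler_normD _ _) (lerD e3 e4)) (le_trans (ler_normD _ _) (lerD e5 e6))))//.
lra.
Qed.

Lemma slowly_varying_mean_le d K k f g : 0 < d -> k != 0 ->
  slowly_varying d K f -> slowly_varying d K g ->
  mu.-integrable setT (EFin \o osc k f g) /\
  `|\int[mu]_x osc k f g x| <= `|k^-1| * (2 * K * decay_mass d).
Proof.
move=> d0 k0 [f' pf fK] [g' pg gK]; split.
  have mo : measurable_fun setT (osc k f g).
    apply: measurable_osc; [exact: continuous_measurable (primitive_continuous pf)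
      |exact: continuous_measurable (primitive_continuous pg)].
  have ole x : `|osc k f g x| <= 2 * K * decay d x.
    by rewrite -mulrA; apply: osc_le; [case: (fK x)|case: (gK x)].
  by case: (decay_integrable d0 mo ole).
by apply: (osc_mean_le d0 k0 pf pg) => x; [case: (fK x)|case: (gK x)|case: (fK x)|case: (gK x)].
Qed.

Variables (beta theta : R) (lam : nat -> R) (a b : nat -> nat -> R -> R) (c : nat -> R).
Hypotheses (beta0 : 0 < beta) (theta0 : 0 < theta) (lam_ge : forall i, theta <= `|lam i|)
  (lamD : forall i j, theta <= `|lam i + lam j|)
  (lamB : forall i j, i != j -> theta <= `|lam i - lam j|).
Hypotheses (c0 : forall i, 0 <= c i) (cc : cvgn (series c)).
Hypotheses (pa : forall l i, (l < 3)%N -> primitive (a l i) (a l.+1 i))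
  (pb : forall l i, (l < 3)%N -> primitive (b l i) (b l.+1 i))
  (ac : forall l i x, (l <= 3)%N -> `|a l i x| <= c i * decay beta x)
  (bc : forall l i x, (l <= 3)%N -> `|b l i x| <= c i * decay beta x).

Let s e i x : R := (pi * lam i)^-1 * osc (freq lam e i) (b 0 i) (fun y => - a 0 i y) x.

(** The diagonal contribution: the square of an oscillating mode averages to half the squared
    amplitude. Summed over positive indices this is the integral of [Lambda_eff], where each
    frequency is counted with both signs. *)
Definition mode_mass i : R :=
  2^-1 * (pi * lam i) ^- 2 * \int[mu]_x (a 0 i x ^+ 2 + b 0 i x ^+ 2).

Let t := theta^-1.

Let s_le e i x : `|s e i x| <= c i * (t * 2 * decay beta x).
Proof. exact: (leading_term_le theta0 lam_ge ac bc). Qed.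

Let pa0 i : primitive (a 0 i) (a 1 i). Proof. exact: pa. Qed.
Let pb0 i : primitive (b 0 i) (b 1 i). Proof. exact: pb. Qed.

Let ms e i : measurable_fun setT (s e i).
Proof.
apply: measurable_funM => //; apply: measurable_osc.
  exact: continuous_measurable (primitive_continuous (pb0 i)).
by apply: measurableT_comp => //; exact: continuous_measurable (primitive_continuous (pa0 i)).
Qed.

Let beta20 : 0 < beta + beta. Proof. exact: addr_gt0. Qed.

Let slow_a i : slowly_varying beta (c i) (a 0 i).
Proof. by exists (a 1 i) => // x; split; exact: ac. Qed.

Let slow_b i : slowly_varying beta (c i) (b 0 i).
Proof. by exists (b 1 i) => // x; split; exact: bc. Qed.

Let slow_mean_le e n f g K : 0 < e -> theta <= `|n| -> 0 <= K ->
  slowly_varying (beta + beta) K f -> slowly_varying (beta + beta) K g ->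
  mu.-integrable setT (EFin \o osc (2 * pi * n / e) f g) /\
  `|\int[mu]_x osc (2 * pi * n / e) f g x| <= t * (2 * K * decay_mass (beta + beta)) * e.
Proof.
move=> e0 nt K0 sf sg.
have n0 : n != 0 by rewrite -normr_gt0 (lt_le_trans theta0).
have p2 : 1 <= 2 * pi :> R by have := pi_ge2 R; lra.
have p0 : 2 * pi != 0 :> R by rewrite gt_eqF// (lt_le_trans ltr01).
have k0 : 2 * pi * n / e != 0.
  by apply: mulf_neq0; [exact: mulf_neq0|rewrite invr_eq0 gt_eqF].
have [h1 h2] := slowly_varying_mean_le beta20 k0 sf sg; split => //.
apply: (le_trans h2).
rewrite [leRHS](_ : _ = t * e * (2 * K * decay_mass (beta + beta))); last by ring.
rewrite ler_wpM2r//; first by rewrite !mulr_ge0// decay_mass_ge0.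
rewrite invf_div normrM (ger0_norm (ltW e0)) mulrC ler_wpM2r ?(ltW e0)//.
have q0 : 0 < `|2 * pi * n| by rewrite normr_gt0; exact: mulf_neq0.
rewrite normfV lef_pV2 ?posrE//.
by rewrite normrM ger0_norm ?(le_trans ler01)// (le_trans nt)// ler_peMl.
Qed.

Let E i j := t ^+ 2 * (t * (2 * (4 * (c i * c j)) * decay_mass (beta + beta))).

Let int_osc0 i : mu.-integrable setT (EFin \o (fun x => b 0 i x * b 0 i x + - a 0 i x * - a 0 i x)).
Proof.
have [h' ph hle] := slowly_varying_mulD (c0 i) (c0 i) (slow_b i) (slow_b i)
  (slowly_varyingN (slow_a i)) (slowly_varyingN (slow_a i)).
have mh := continuous_measurable (primitive_continuous ph).
by case: (decay_integrable beta20 mh (fun x => (hle x).1)).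
Qed.

(* The product of two modes splits into the frequencies lam i + lam j and
   lam i - lam j; only the difference for i = j does not oscillate. *)
Let pair_mean e i j : 0 < e ->
  mu.-integrable setT (EFin \o (fun x => s e i x * s e j x)) /\
  `|\int[mu]_x (s e i x * s e j x) - (if i == j then mode_mass i else 0)| <= E i j * e.
Proof.
move=> e0.
set kap := (pi * lam i)^-1 * (pi * lam j)^-1.
pose f1 y := b 0 i y * b 0 j y - - a 0 i y * - a 0 j y.
pose g1 y := b 0 i y * - a 0 j y + - a 0 i y * b 0 j y.
pose f2 y := b 0 i y * b 0 j y + - a 0 i y * - a 0 j y.
pose g2 y := - a 0 i y * b 0 j y - b 0 i y * - a 0 j y.
have sE : (fun x => s e i x * s e j x) = (fun x => kap * 2^-1 * osc (2 * pi * (lam i + lam j) / e) f1 g1 x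
    + kap * 2^-1 * osc (2 * pi * (lam i - lam j) / e) f2 g2 x).
  have fD : freq lam e i + freq lam e j = 2 * pi * (lam i + lam j) / e.
    by rewrite /freq; move: (pi : R) => p; ring.
  have fB : freq lam e i - freq lam e j = 2 * pi * (lam i - lam j) / e.
    by rewrite /freq; move: (pi : R) => p; ring.
  by apply/funext => x; rewrite /s mulrACA oscM -/kap fD fB mulrDr !(mulrA kap).
have kap_le : `|kap| <= t ^+ 2.
  by rewrite normrM expr2 ler_pM// (invr_lam_le theta0 lam_ge).
have K0 : 0 <= 4 * (c i * c j) by rewrite !mulr_ge0.
have sv := slowly_varying_mulD (c0 i) (c0 j).
have sf1 : slowly_varying (beta + beta) (4 * (c i * c j)) f1.
  have := sv _ _ _ _ _ (slow_b i) (slow_b j) (slow_a i) (slowly_varyingN (slow_a j)).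
  by congr slowly_varying; apply/funext => x; rewrite /f1; ring.
have sg1 : slowly_varying (beta + beta) (4 * (c i * c j)) g1.
  exact: sv _ _ _ _ _ (slow_b i) (slowly_varyingN (slow_a j)) (slowly_varyingN (slow_a i)) (slow_b j).
have sf2 : slowly_varying (beta + beta) (4 * (c i * c j)) f2.
  exact: sv _ _ _ _ _ (slow_b i) (slow_b j) (slowly_varyingN (slow_a i)) (slowly_varyingN (slow_a j)).
have sg2 : slowly_varying (beta + beta) (4 * (c i * c j)) g2.
  have := sv _ _ _ _ _ (slowly_varyingN (slow_a i)) (slow_b j) (slow_b i) (slow_a j).
  by congr slowly_varying; apply/funext => x; rewrite /g2; ring.
have [i1 l1] := slow_mean_le e0 (lamD i j) K0 sf1 sg1.
have half (I1 : R) : `|I1| <= t * (2 * (4 * (c i * c j)) * decay_mass (beta + beta)) * e ->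
    `|kap * 2^-1 * I1| <= 2^-1 * (E i j * e).
  move=> h; rewrite (normrM (kap * 2^-1)) (normrM kap) (@ger0_norm _ 2^-1)// mulrAC mulrC ler_wpM2l//.
  by rewrite /E -mulrA ler_pM.
have Ee0 : 0 <= E i j * e.
  by rewrite /E !mulr_ge0 ?exprn_ge0 ?decay_mass_ge0 ?invr_ge0 ?(ltW theta0) ?(ltW e0).
case: ifPn => [/eqP ij|ij].
  have o2E : osc (2 * pi * (lam i - lam j) / e) f2 g2 = f2.
    by apply/funext => x; rewrite /osc ij subrr mulr0 mul0r mul0r cos0 sin0 mulr1 mulr0 subr0.
  have i2 : mu.-integrable setT (EFin \o f2).
    by rewrite /f2 -ij; exact: int_osc0.
  rewrite sE o2E; split; first by apply: integrable_EFinD => //; exact: integrable_EFinZl.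
  rewrite RintegralD//; [|exact: integrable_EFinZl|exact: integrable_EFinZl].
  rewrite !RintegralZl//.
  have -> : mode_mass i = kap * 2^-1 * \int[mu]_x f2 x.
    rewrite /mode_mass /kap -ij -exprVn expr2 [2^-1 * _]mulrC; congr (_ * _).
    by apply: eq_Rintegral => x _; rewrite /f2 -ij; ring.
  rewrite addrK (le_trans (half _ l1))//; lra.
have [i2 l2] := slow_mean_le e0 (lamB ij) K0 sf2 sg2.
rewrite sE; split; first by apply: integrable_EFinD => //; exact: integrable_EFinZl.
rewrite subr0 RintegralD//; [|exact: integrable_EFinZl|exact: integrable_EFinZl].
rewrite !RintegralZl// (le_trans (ler_normD _ _))// (le_trans (lerD (half _ l1) (half _ l2)))//; lra.
Qed.

Let pair_cvg i j : (fun e => \int[mu]_x (s e i x * s e j x)) @ (0 : R)^'+ -->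
  (if i == j then mode_mass i else 0).
Proof.
apply/cvgrPdist_le => d d0.
have E0 : 0 < E i j + 1.
  by rewrite ltr_wpDl// /E !mulr_ge0 ?exprn_ge0 ?decay_mass_ge0 ?invr_ge0 ?(ltW theta0).
near=> e.
have e0 : 0 < e by [].
have [_ h] := pair_mean i j e0.
rewrite distrC (le_trans h)// (@le_trans _ _ ((E i j + 1) * e))//.
  by rewrite ler_wpM2r ?(ltW e0)// lerDl.
rewrite mulrC -ler_pdivlMr//; near: e; apply: nbhs_right_le; exact: divr_gt0.
Unshelve. all: by end_near. Qed.

Let sumM n e x : series (fun i => s e i x) n ^+ 2 =
  series (fun i => series (fun j => s e i x * s e j x) n) n.
Proof.
rewrite /series/= expr2 mulr_suml; apply: eq_bigr => i _.
by rewrite mulr_sumr.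
Qed.

Let partial_cvg n : (fun e => \int[mu]_x (series (fun i => s e i x) n ^+ 2)) @ (0 : R)^'+ -->
  series mode_mass n.
Proof.
have -> : series mode_mass n = series (fun i => series (fun j => if i == j then mode_mass i else 0) n) n.
  rewrite /series/= !big_mkord; apply: eq_bigr => i _; rewrite big_mkord (bigD1 i)//= eqxx.
  by rewrite big1 ?addr0// => j ji; rewrite ifF//; apply/negbTE; rewrite eq_sym.
have h : (fun e => series (fun i => series (fun j => \int[mu]_x (s e i x * s e j x)) n) n) @ (0 : R)^'+ -->
    series (fun i => series (fun j => if i == j then mode_mass i else 0) n) n.
  by do 2 (apply: cvg_partial_sum => ?); exact: pair_cvg.
apply: cvg_trans h; apply: near_eq_cvg; near=> e.
have e0 : 0 < e by [].
under eq_Rintegral do rewrite sumM.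
have ii i : mu.-integrable setT (EFin \o (fun x => series (fun j => s e i x * s e j x) n)).
  by case: (Rintegral_partial_sum n (fun j => (pair_mean i j e0).1)).
have [_ ->] := Rintegral_partial_sum n ii.
rewrite /series/=; apply: eq_bigr => i _.
by case: (Rintegral_partial_sum n (fun j => (pair_mean i j e0).1)).
Unshelve. all: by end_near. Qed.

Let C := limn (series c).

Lemma measurable_leading e : measurable_fun setT (leading lam a b e).
Proof. exact: (measurable_fsum cc (ms e) (s_le e)). Qed.

Lemma leading_le e x : `|leading lam a b e x| <= C * (t * 2) * decay beta x.
Proof. by rewrite -mulrA; exact: (dominated_series_le cc (fun i => s_le e i x)). Qed.

(** The difference of the squares factors; one factor carries the tail of the series of the [c i],
    the other stays bounded. The estimate is independent of e. *)
Let truncation_le e n : 0 < e ->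
  `|\int[mu]_x (leading lam a b e x ^+ 2) - \int[mu]_x (series (fun i => s e i x) n ^+ 2)| <=
  (C - series c n) * (2 * C * (t * 2) ^+ 2 * decay_mass (beta + beta)).
Proof.
move=> e0; have mn : measurable_fun setT (fun x => series (fun i => s e i x) n).
  exact: (measurable_partial_sum n (ms e)).
have ml := measurable_leading e.
pose S x := series (fun i => s e i x) n.
have nle x : `|S x| <= C * (t * 2) * decay beta x.
  by rewrite -mulrA; exact: (dominated_partial_le c0 cc (fun i => s_le e i x)).
have dle x : `|leading lam a b e x - series (fun i => s e i x) n| <=
    (C - series c n) * (t * 2) * decay beta x.
  by rewrite -mulrA; exact: (dominated_series_tail cc (fun i => s_le e i x)).
have sle x : `|leading lam a b e x + series (fun i => s e i x) n| <=
    2 * C * (t * 2) * decay beta x.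
  rewrite (le_trans (ler_normD _ _))// (le_trans (lerD (leading_le e x) (nle x)))//; lra.
have i1 : mu.-integrable setT (EFin \o (fun x => leading lam a b e x ^+ 2)).
  apply: (decay_integrable beta20 _ _).1; first exact: measurable_funX.
  by move=> x; rewrite expr2; exact: (decay_mulr_le (leading_le e x) (leading_le e x)).
have i2 : mu.-integrable setT (EFin \o (fun x => series (fun i => s e i x) n ^+ 2)).
  apply: (decay_integrable beta20 _ _).1; first exact: measurable_funX.
  by move=> x; rewrite expr2; exact: (@decay_mulr_le beta _ _ S S x (nle x) (nle x)).
rewrite -RintegralB// [leRHS](_ : _ = (C - series c n) * (t * 2) * (2 * C * (t * 2)) * decay_mass (beta + beta)); last by ring.
apply: (decay_integrable beta20 _ _).2.
  by apply: measurable_funB; exact: measurable_funX.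
by move=> x; rewrite subr_sqr; exact: (@decay_mulr_le beta _ _ (fun x => leading lam a b e x - S x)
  (fun x => leading lam a b e x + S x) x (dle x) (sle x)).
Qed.

(** An argument in thirds. The truncation order n is fixed first, which the uniformity of the
    truncation error in e permits; afterwards only finitely many pairs of modes have to be averaged
    as e tends to 0. *)
Lemma leading_mass_cvg (m : R) : series mode_mass @ \oo --> m ->
  (fun e => \int[mu]_x (leading lam a b e x ^+ 2)) @ (0 : R)^'+ --> m.
Proof.
move=> cm; apply/cvgrPdist_le => d d0.
pose W := 2 * C * (t * 2) ^+ 2 * decay_mass (beta + beta).
have d3 : 0 < d / 3 by rewrite divr_gt0.
have h1 : \forall n \near \oo, `|m - series mode_mass n| <= d / 3.
  by move/cvgrPdist_le : cm; exact.
have h2 : \forall n \near \oo, (C - series c n) * W <= d / 3.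
  have : (fun n => (C - series c n) * W) @ \oo --> (C - C) * W.
    by apply: cvgM; [apply: cvgB; [exact: cvg_cst|exact: cc]|exact: cvg_cst].
  by rewrite subrr mul0r => /cvgr_le; exact.
have [n [hn1 hn2]] : exists n, `|m - series mode_mass n| <= d / 3 /\ (C - series c n) * W <= d / 3.
  near \oo => n; exists n; split; near: n => //.
have h3 : \forall e \near (0 : R)^'+,
    `|series mode_mass n - \int[mu]_x (series (fun i => s e i x) n ^+ 2)| <= d / 3.
  by have /cvgrPdist_le := @partial_cvg n; exact.
near=> e.
have e0 : 0 < e by [].
have h4 : `|series mode_mass n - \int[mu]_x (series (fun i => s e i x) n ^+ 2)| <= d / 3.
  by near: e.
have h5 := le_trans (truncation_le n e0) hn2.
have -> : m - \int[mu]_x (leading lam a b e x ^+ 2) = (m - series mode_mass n) +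
  (series mode_mass n - \int[mu]_x (series (fun i => s e i x) n ^+ 2)) -
  (\int[mu]_x (leading lam a b e x ^+ 2) - \int[mu]_x (series (fun i => s e i x) n ^+ 2)) by ring.
rewrite (le_trans (ler_normB _ _))// (le_trans (lerD (le_trans (ler_normD _ _) (lerD hn1 h4)) h5))//; lra.
Unshelve. all: by end_near. Qed.

End LeadingOrder.

(** * Smooth representatives *)

Section WeightedSpaces.
Variable R : realType.
Notation mu := (@lebesgue_measure R).
Local Notation Re := complex.Re.
Local Notation Im := complex.Im.
Implicit Types (x y : R).

Lemma clip_le (D r : R) : 0 <= D -> `|Num.max (- D) (Num.min D r)| <= D.
Proof.
move=> D0; rewrite ler_norml le_max lexx/= ge_max ge_min lexx/= andbT.
by rewrite (le_trans _ D0)// oppr_le0.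
Qed.

Lemma clip_id (D r : R) : `|r| <= D -> Num.max (- D) (Num.min D r) = r.
Proof. by rewrite ler_norml => /andP[h1 h2]; rewrite min_r// max_r. Qed.

Lemma test_function_measurable (phi : R -> R) : test_function phi -> measurable_fun setT phi.
Proof.
move=> [d _]; apply: continuous_measurable => x.
by apply: differentiable_continuous; apply/derivable1_diffP; exact: (d 0%N x).
Qed.

(** The construction goes down from the highest derivative. That one is only measurable and is
    clipped to its almost everywhere bound; each lower one is replaced by the primitive of the
    representative above it, and its bound extends to all x by continuity. Bounds valid everywhere
    are what the pointwise summation over modes needs. *)
Lemma smooth_representatives n (g : nat -> R -> R) (K d : R) : 0 <= K -> 0 <= d ->
  (forall l, (l <= n)%N -> locally_integrable setT (g l)) ->
  (forall l, (l <= n)%N -> {ae mu, forall x, `|g l x| <= K * decay d x}) ->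
  (forall l, (l < n)%N -> forall phi, test_function phi ->
    \int[mu]_x (derive1 phi x * g l x) = - \int[mu]_x (phi x * g l.+1 x)) ->
  exists h : nat -> R -> R, [/\ forall l, (l < n)%N -> primitive (h l) (h l.+1),
    forall l, (l <= n)%N -> measurable_fun setT (h l),
    forall l x, (l <= n)%N -> `|h l x| <= K * decay d x
    & forall l, (l <= n)%N -> {ae mu, forall x, h l x = g l x}].
Proof.
move=> K0 d0; have D0 x : 0 <= K * decay d x by rewrite mulr_ge0// decay_ge0.
have cD : continuous (fun x => K * decay d x).
  by move=> x; apply: cvgM; [exact: cvg_cst|exact: continuous_decay].
elim: n g => [|n IH] g lg gle wg.
  have mg : measurable_fun setT (g 0%N) by case: (lg 0%N isT).
  exists (fun _ x => Num.max (- (K * decay d x)) (Num.min (K * decay d x) (g 0%N x))).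
  split => //.
  - move=> l _; have mD := continuous_measurable cD.
    apply: measurable_maxr; first exact: measurableT_comp.
    exact: measurable_minr.
  - by move=> l x _; exact: clip_le.
  - move=> l; rewrite leqn0 => /eqP ->; apply: ae_mono (gle 0%N isT) => x; exact: clip_id.
have [h [ph mh hle hg]] := IH (fun l => g l.+1) (fun l ln => lg l.+1 ln)
  (fun l ln => gle l.+1 ln) (fun l ln => wg l.+1 ln).
have hK : {ae mu, forall x, `|h 0%N x| <= K}.
  by apply: aeW => x; rewrite (le_trans (hle 0%N x isT))// ler_piMr// decay_le1.
have mg1 : measurable_fun setT (g 1%N) by case: (lg 1%N isT).
have weak phi : test_function phi ->
    \int[mu]_x (derive1 phi x * g 0%N x) = - \int[mu]_x (phi x * h 0%N x).
  move=> tphi; have mphi := test_function_measurable tphi.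
  rewrite (wg 0%N)//; congr (- _); apply: ae_eq_Rintegral => //.
  - exact: measurable_funM.
  - by apply: measurable_funM => //; exact: mh.
  - by apply: ae_mono (hg 0%N isT) => x -> _.
have [G pG Gg] := weak_derivative_primitive (lg 0%N isT) (mh 0%N isT) hK weak.
have cG := primitive_continuous pG.
exists (fun l => if l is l'.+1 then h l' else G); split.
- by case=> [_|l ln]; [exact: pG|exact: ph].
- by case=> [_|l ln]; [exact: continuous_measurable|exact: mh].
- case=> [|l] x ln; last exact: hle.
  apply: (@ae_le_continuous _ (fun x => `|G x|) (fun x => K * decay d x)) => //.
    by move=> y; apply: cvg_norm; exact: cG.
  by apply: ae_mono (ae_and Gg (gle 0%N isT)) => y [->].
- by case=> [_|l ln]; [exact: Gg|exact: hg].
Qed.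

Lemma Re_realM (r : R) (z : R[i]) : Re (r%:C * z) = r * Re z.
Proof. by case: z => u v /=; rewrite mul0r subr0. Qed.

Lemma Im_realM (r : R) (z : R[i]) : Im (r%:C * z) = r * Im z.
Proof. by case: z => u v /=; rewrite mul0r addr0. Qed.

Lemma weak_derivative_parts (g h : R -> R[i]) (phi : R -> R) : is_weak_derivative g h ->
  test_function phi ->
  (\int[mu]_x (derive1 phi x * Re (g x)) = - (\int[mu]_x (phi x * Re (h x)))) /\
  \int[mu]_x (derive1 phi x * Im (g x)) = - \int[mu]_x (phi x * Im (h x)).
Proof.
have re (r : R -> R) (f : R -> R[i]) : \int[mu]_x (r x * Re (f x)) = \int[mu]_x Re ((r x)%:C * f x).
  by apply: eq_Rintegral => x _; rewrite Re_realM.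
have im (r : R -> R) (f : R -> R[i]) : \int[mu]_x (r x * Im (f x)) = \int[mu]_x Im ((r x)%:C * f x).
  by apply: eq_Rintegral => x _; rewrite Im_realM.
by move=> [_ _ w] /w; rewrite /cintegral !re !im => -[-> ->].
Qed.

Lemma Re_le_cmod (z : R[i]) : `|Re z| <= cmod z.
Proof.
case: z => u v; rewrite /cmod /= -sqrtr_sqr ler_wsqrtr// lerDl; exact: sqr_ge0.
Qed.

Lemma Im_le_cmod (z : R[i]) : `|Im z| <= cmod z.
Proof.
case: z => u v; rewrite /cmod /= -sqrtr_sqr ler_wsqrtr// lerDr; exact: sqr_ge0.
Qed.

Lemma cmod_ge0 (z : R[i]) : 0 <= cmod z.
Proof. exact: le_trans (normr_ge0 _) (Re_le_cmod z). Qed.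

Lemma sqr_cmod (z : R[i]) : cmod z ^+ 2 = Re z ^+ 2 + Im z ^+ 2.
Proof. by case: z => u v; rewrite /cmod /= sqr_sqrtr// addr_ge0// sqr_ge0. Qed.

Lemma Linfty_norm_ge0 (d : R) (g : R -> R[i]) : (0 <= Linfty_norm d g)%E.
Proof.
apply: ess_sup_gee.
  apply: (@lt_le_trans _ _ (mu `[0%R, 1%R])); last by rewrite le_measure// inE.
  by rewrite lebesgue_measure_itv/= lte01 oppr0 adde0 lte01.
by apply: aeW => x; rewrite lee_fin mulr_ge0 ?expR_ge0 ?cmod_ge0.
Qed.

Lemma Winfty_norm_ge0 n (d : R) (g : R -> R[i]) : (0 <= Winfty_norm n d g)%E.
Proof. by apply: sume_ge0 => l _; exact: Linfty_norm_ge0. Qed.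

Lemma Linfty_le_Winfty n l (d : R) (g : R -> R[i]) : (l <= n)%N ->
  (Linfty_norm d (weak_derivative_n l g) <= Winfty_norm n d g)%E.
Proof.
move=> ln; rewrite /Winfty_norm (bigD1 (Ordinal (ln : (l < n.+1)%N)))//=.
by rewrite leeDl// sume_ge0// => i _; exact: Linfty_norm_ge0.
Qed.

Lemma Winfty_ae_le n l (d : R) (g : R -> R[i]) : (l <= n)%N -> (Winfty_norm n d g < +oo)%E ->
  {ae mu, forall x, cmod (weak_derivative_n l g x) <= fine (Winfty_norm n d g) * decay d x}.
Proof.
move=> ln fin.
have fnum : Winfty_norm n d g \is a fin_num by rewrite ge0_fin_numE ?Winfty_norm_ge0.
apply: ae_mono (ess_sup_ge mu (fun x => (expR (d * `|x|) * cmod (weak_derivative_n l g x))%:E)) => x h.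
have := le_trans h (Linfty_le_Winfty d g ln).
rewrite -(fineK fnum) lee_fin /decay expRN ler_pdivlMr ?expR_gt0//.
by rewrite mulrC.
Qed.

Lemma Winfty_representatives n (d : R) (g : R -> R[i]) : 0 <= d -> (0 < n)%N -> in_Winfty n d g ->
  exists a b : nat -> R -> R,
  [/\ forall l, (l < n)%N -> primitive (a l) (a l.+1) /\ primitive (b l) (b l.+1),
      forall l x, (l <= n)%N -> `|a l x| <= fine (Winfty_norm n d g) * decay d x /\
                                `|b l x| <= fine (Winfty_norm n d g) * decay d x
    & {ae mu, forall x, a 0%N x = Re (g x) /\ b 0%N x = Im (g x)}].
Proof.
move=> d0 n0 [mg wg fin].
have K0 : 0 <= fine (Winfty_norm n d g) by rewrite fine_ge0// Winfty_norm_ge0.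
have lint l : (l <= n)%N -> clocally_integrable (weak_derivative_n l g).
  case: l => [|l] ln; first by case: (wg 0%N n0).
  by case: (wg l ln).
have ale l : (l <= n)%N -> {ae mu, forall x, cmod (weak_derivative_n l g x) <=
    fine (Winfty_norm n d g) * decay d x} by move=> ln; exact: Winfty_ae_le.
have [a [pa ma aK ag]] := @smooth_representatives n (fun l x => Re (weak_derivative_n l g x)) _ d K0 d0
  (fun l ln => (lint l ln).1)
  (fun l ln => ae_mono (fun x h => le_trans (Re_le_cmod _) h) (ale l ln))
  (fun l ln phi tphi => (weak_derivative_parts (wg l ln) tphi).1).
have [b [pb mb bK bg]] := @smooth_representatives n (fun l x => Im (weak_derivative_n l g x)) _ d K0 d0
  (fun l ln => (lint l ln).2)
  (fun l ln => ae_mono (fun x h => le_trans (Im_le_cmod _) h) (ale l ln))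
  (fun l ln phi tphi => (weak_derivative_parts (wg l ln) tphi).2).
exists a, b; split.
- by move=> l ln; split; [exact: pa|exact: pb].
- by move=> l x ln; split; [exact: aK|exact: bK].
- by apply: ae_mono (ae_and (ag 0%N isT) (bg 0%N isT)) => x.
Qed.

End WeightedSpaces.

(** * The potential q_eps *)

Section ComplexLimits.
Variable R : realType.
Local Notation Re := complex.Re.
Local Notation Im := complex.Im.

Lemma cvg_Re (T : Type) (F : set_system T) (FF : Filter F) (f : T -> R[i]) (l : R[i]) :
  (fun t => f t : R[i]^o) @ F --> (l : R[i]^o) -> (fun t => Re (f t)) @ F --> Re l.
Proof.
move/cvgrPdist_le => H; apply/cvgrPdist_le => d d0.
have d0' : 0 < d%:C :> R[i] by rewrite ltcR.
apply: filterS (H _ d0') => t h.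
by rewrite -ReN -ReD -lecR (le_trans (normc_ge_Re _)).
Qed.

Lemma norm_le_l1norm (z : R[i]) : `|z| <= (l1norm z)%:C.
Proof.
case: z => u v; rewrite /l1norm /= normc_def lecR /=.
rewrite -[leRHS]ger0_norm ?addr_ge0// -sqrtr_sqr ler_wsqrtr//.
by rewrite sqrrD !real_normK ?num_real// addrAC lerDl mulrn_wge0// mulr_ge0.
Qed.

Lemma cvg_l1norm (T : Type) (F : set_system T) (FF : Filter F) (f : T -> R[i]) (l : R[i]) :
  (forall d : R, 0 < d -> \forall t \near F, l1norm (l - f t) <= d) ->
  (fun t => f t : R[i]^o) @ F --> (l : R[i]^o).
Proof.
move=> H; apply/cvgrPdist_le => e e0.
have [r r0 ->] : exists2 r : R, 0 < r & e = r%:C.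
  by case: e e0 => u v; rewrite ltcE/= => /andP[/eqP -> u0]; exists u.
apply: filterS (H r r0) => t h.
by rewrite (le_trans (norm_le_l1norm _))// lecR.
Qed.

End ComplexLimits.

Section PotentialV.
Variable R : realType.
Notation mu := (@lebesgue_measure R).
Local Notation Re := complex.Re.
Local Notation Im := complex.Im.
Implicit Types (x y e : R).

Lemma esum_nonzero_ints (f : int -> \bar R) : (forall j, (0 <= f j)%E) ->
  (\esum_(j in nonzero_ints) f j =
   \sum_(0 <= i <oo) f i.+1%:Z + \sum_(0 <= i <oo) f (- i.+1%:Z)%R)%E.
Proof.
move=> f0; rewrite (esumID [set j : int | 0 < j]); last by move=> j _; exact: f0.
have -> : nonzero_ints `&` [set j : int | 0 < j] = (fun i : nat => i.+1%:Z) @` setT.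
  apply/seteqP; split => [j [j0 jp]|_ [n _ <-]] //.
  by case: j j0 jp => [[|n]|n] // _ _; exists n.
have -> : nonzero_ints `&` ~` [set j : int | 0 < j] = (fun i : nat => - i.+1%:Z) @` setT.
  apply/seteqP; split => [j [j0 jp]|_ [n _ <-]] //.
  by case: j j0 jp => [[|n]|n] // _ _; exists n; rewrite ?NegzE.
rewrite !esum_image ?nneseries_esumT//.
- by move=> n m _ _ /oppr_inj [].
- by move=> n m _ _ [].
Qed.

Lemma nneseries_cvgn (c : nat -> R) : (forall i, 0 <= c i) ->
  (\sum_(0 <= i <oo) (c i)%:E < +oo)%E -> cvgn (series c).
Proof.
move=> c0 fin; apply: nondecreasing_is_cvgn.
  by apply/nondecreasing_seqP => n; rewrite seriesSr lerDl.
have s0 : (0 <= \sum_(0 <= i <oo) (c i)%:E)%E by apply: nneseries_ge0 => i _ _; rewrite lee_fin.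
exists (fine (\sum_(0 <= i <oo) (c i)%:E)) => _ [n _ <-].
rewrite -lee_fin fineK; last by rewrite ge0_fin_numE.
rewrite /series/= -sumEFin; apply: nneseries_lim_ge => i _; by rewrite lee_fin.
Qed.

Lemma fine_nneseries (c : nat -> R) : cvgn (series c) ->
  (\sum_(0 <= i <oo) (c i)%:E)%E = (limn (series c))%:E.
Proof.
move=> cc; rewrite -EFin_lim//; congr (limn _); apply/funext => n.
by rewrite /series/= sumEFin.
Qed.

(** Symmetric summation pairs each term with its conjugate, so its partial sums are exactly those of
    twice the real parts. *)
Lemma nonzero_sum_re (u : int -> R[i]) (v : R) :
  (forall n : nat, u (- n.+1%:Z) = conjc (u n.+1%:Z)) ->
  nonzero_sum u v%:C ->
  series (fun i : nat => 2 * Re (u i.+1%:Z)) @ \oo --> v.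
Proof.
move=> uc /cvg_Re /=; apply: cvg_trans; apply: near_eq_cvg; apply: nearW => n.
rewrite big_add1 /= /series/= ; elim: n => [|n IH]; first by rewrite !big_geq.
by rewrite !big_nat_recr//= ReD IH uc; case: (u _) => p r /=; rewrite mulr2n mulrDl mul1r.
Qed.

Variables (q : int -> R -> R[i]) (lambda : int -> R) (V : R -> R -> R).
Hypothesis hV : hypotheses_V q lambda V.

Let lam (i : nat) := lambda i.+1%:Z.

Let conj_mode e x n :
  let u j := q j x * cexp ('i * (2 * pi * lambda j * (x / e))%:C) in
  u (- n.+1%:Z) = conjc (u n.+1%:Z) /\
  Re (u n.+1%:Z) = osc (freq lam e n) (fun x => Re (q n.+1%:Z x)) (fun x => Im (q n.+1%:Z x)) x.
Proof.
case: hV => _ qc lc _ u; rewrite /u.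
have -> : 2 * pi * lambda n.+1%:Z * (x / e) = freq lam e n * x by rewrite /freq /lam; move: (pi : R) => p; ring.
have -> : 2 * pi * lambda (- n.+1%:Z) * (x / e) = - (freq lam e n * x).
  by rewrite lc// /freq /lam; move: (pi : R) => p; ring.
rewrite -qc//; set w := freq lam e n * x.
have ce (r : R) : cexp ('i * r%:C) = cos r +i* sin r.
  by rewrite /cexp /= !mul0r !mul1r subrr add0r expR0 mul1r.
rewrite !ce cosN sinN /osc -/w; case: (q n.+1%:Z x) => p r /=; split => //.
by congr (_ +i* _); ring.
Qed.

Lemma q_eps_cvg e x : series (fun i => 2 * osc (freq lam e i) (fun x => Re (q i.+1%:Z x))
  (fun x => Im (q i.+1%:Z x)) x) @ \oo --> q_eps V e x.
Proof.
have [hs _ _ _] := hV.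
have := nonzero_sum_re (fun n => (conj_mode e x n).1) (hs x (x / e)).
rewrite /q_eps; apply: cvg_trans; apply: near_eq_cvg; apply: nearW => n.
by rewrite /series/=; apply: eq_bigr => i _; rewrite (conj_mode e x i).2.
Qed.

(** Here the hypotheses on V take the form required by the Wronskian estimate, with eta = beta / 8.
    S is the integral of the squared leading term. The integral of p^2 is e^2 S up to O(e^3),
    because p minus e times the leading term is O(e^2) and their sum is O(e). *)
Lemma potential_asymptotics : exists eta B : R, [/\ 0 < eta, 0 <= B &
  exists2 S : R -> R, S @ (0 : R)^'+ --> total_Lambda_eff q lambda &
  forall e : R, 0 < e -> e < 1 -> exists p r : R -> R,
    [/\ measurable_fun setT (q_eps V e), measurable_fun setT r,
      {ae mu, forall y, `|q_eps V e y| <= B * expR (- (8 * eta * `|y|))} &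
    [/\ primitive p (fun y => q_eps V e y + r y),
      forall y, `|p y| <= B * e * expR (- (8 * eta * `|y|)),
      {ae mu, forall y, `|r y| <= B * e ^+ 3 * expR (- (8 * eta * `|y|))} &
      `|\int[mu]_y (p y ^+ 2) - e ^+ 2 * S e| <= B * e ^+ 3]]].
Proof.
have [hs qc lc [theta [beta [[theta0 beta0] sep low win sumW]]]] := hV.
pose c i := fine (Winfty_norm 3 beta (q i.+1%:Z)).
have c0 i : 0 <= c i by rewrite fine_ge0// Winfty_norm_ge0.
have cc : cvgn (series c).
  apply: nneseries_cvgn => //.
  apply: le_lt_trans sumW; rewrite esum_nonzero_ints; last by move=> j; exact: Winfty_norm_ge0.
  rewrite (eq_eseriesr (g := fun i : nat => Winfty_norm 3 beta (q i.+1%:Z))).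
    by rewrite leeDl// nneseries_ge0// => i _ _; exact: Winfty_norm_ge0.
  move=> i _; rewrite fineK// ge0_fin_numE ?Winfty_norm_ge0//.
  by have [] := win i.+1%:Z isT.
have /choice [ab hab] : forall i : nat, exists ab : (nat -> R -> R) * (nat -> R -> R),
  [/\ forall l, (l < 3)%N -> primitive (ab.1 l) (ab.1 l.+1) /\ primitive (ab.2 l) (ab.2 l.+1),
      forall l x, (l <= 3)%N -> `|ab.1 l x| <= c i * decay beta x /\ `|ab.2 l x| <= c i * decay beta x
    & {ae mu, forall x, ab.1 0%N x = Re (q i.+1%:Z x) /\ ab.2 0%N x = Im (q i.+1%:Z x)}].
  move=> i; have [a [b H]]
    := @Winfty_representatives R 3 beta _ (ltW beta0) isT (win i.+1%:Z isT).
  by exists (a, b).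
pose a l i := (ab i).1 l; pose b l i := (ab i).2 l.
have pa l i : (l < 3)%N -> primitive (a l i) (a l.+1 i) by move=> l3; case: (hab i) => /(_ l l3) [].
have pb l i : (l < 3)%N -> primitive (b l i) (b l.+1 i) by move=> l3; case: (hab i) => /(_ l l3) [].
have ac l i x : (l <= 3)%N -> `|a l i x| <= c i * decay beta x.
  by move=> l3; case: (hab i) => _ /(_ l x l3) [].
have bc l i x : (l <= 3)%N -> `|b l i x| <= c i * decay beta x.
  by move=> l3; case: (hab i) => _ /(_ l x l3) [].
(* The exceptional null sets of the countably many modes are merged, so that the whole series can be
   compared at almost every x. *)
have abq : {ae mu, forall x, forall i, a 0%N i x = Re (q i.+1%:Z x) /\ b 0%N i x = Im (q i.+1%:Z x)}.
  by apply: ae_foralln => i; case: (hab i).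
have lam_ge i : theta <= `|lam i| by exact: low.
have lamB i j : i != j -> theta <= `|lam i - lam j| by move=> ij; apply: sep.
(* A sum of two frequencies is the difference of those of indices i + 1 and -(j + 1). These indices
   differ even when i = j, so the separation hypothesis applies. *)
have lamD i j : theta <= `|lam i + lam j|.
  by rewrite -[lam j]opprK -lc//; apply: sep.
have mq i : cmeasurable (q i.+1%:Z) by have [] := win i.+1%:Z isT.
have mU e : measurable_fun setT (q_eps V e).
  apply: (@measurable_fun_cvg _ (measurableTypeR R) R setT (fun n x => series (fun i => 2 *
    osc (freq lam e i) (fun x => Re (q i.+1%:Z x)) (fun x => Im (q i.+1%:Z x)) x) n)).
    move=> n; apply: measurable_partial_sum => i; apply: measurable_funM => //.
    by have [? ?] := mq i; exact: measurable_osc.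
  by move=> x _; exact: q_eps_cvg.
have Uae e : {ae mu, forall x, q_eps V e x = potential lam a b e x}.
  apply: ae_mono abq => x abx; apply/esym; apply: (cvg_lim (@Rhausdorff R)).
  have := @q_eps_cvg e x; apply: cvg_trans; apply: near_eq_cvg; apply: nearW => n.
  rewrite /series/=; apply: eq_bigr => i _.
  by rewrite /osc; case: (abx i) => -> ->.
pose C := limn (series c); pose t := theta^-1 : R.
have C0 : 0 <= C by exact: (sum_limit_ge0 c0 cc).
have t0 : 0 <= t by rewrite invr_ge0 ltW.
have bb0 : 0 < beta + beta by exact: addr_gt0.
pose dens i x := 2^-1 * (pi * lam i) ^- 2 * (a 0%N i x ^+ 2 + b 0%N i x ^+ 2).
have c_le i : c i <= C.
  apply: le_trans (partial_sum_le c0 cc i.+1); rewrite seriesSr lerDr.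
  by rewrite /series/=; exact: sumr_ge0.
have sq_le (f : R) i x : `|f| <= c i * decay beta x -> `|f ^+ 2| <= c i * (C * decay (beta + beta) x).
  move=> h; rewrite expr2; have := @decay_mulr_le R beta _ _ (fun=> f) (fun=> f) x h h.
  move=> /le_trans; apply; rewrite mulrA ler_wpM2r ?decay_ge0// ler_wpM2l//.
have ma i : measurable_fun setT (a 0%N i).
  exact: continuous_measurable (primitive_continuous (pa 0%N i isT)).
have mb i : measurable_fun setT (b 0%N i).
  exact: continuous_measurable (primitive_continuous (pb 0%N i isT)).
have mab i : measurable_fun setT (fun x => a 0%N i x ^+ 2 + b 0%N i x ^+ 2).
  by apply: measurable_funD; exact: measurable_funX.
have ab_le i x : `|a 0%N i x ^+ 2 + b 0%N i x ^+ 2| <= 2 * (c i * (C * decay (beta + beta) x)).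
  by rewrite (le_trans (ler_normD _ _))// mulr2n mulrDl mul1r lerD// sq_le// ?ac ?bc.
have iab i : mu.-integrable setT (EFin \o (fun x => a 0%N i x ^+ 2 + b 0%N i x ^+ 2)).
  apply: (@decay_integrable R _ (beta + beta) (2 * (c i * C)) bb0 (mab i) _).1 => x.
  by rewrite (le_trans (ab_le i x))// !mulrA.
have mdens i : measurable_fun setT (dens i) by apply: measurable_funM.
have dens_le i x : `|dens i x| <= c i * (C * t ^+ 2 * decay (beta + beta) x).
  rewrite /dens normrM.
  have h : `|2^-1 * (pi * lam i) ^- 2| <= 2^-1 * t ^+ 2.
    rewrite normrM (@ger0_norm _ 2^-1)// ler_wpM2l// -exprVn normrX lerXn2r ?nnegrE//.
    exact: (invr_lam_le theta0 lam_ge).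
  rewrite (le_trans (ler_pM _ _ h (ab_le i x)))//.
  by rewrite le_eqVlt; apply/orP; left; apply/eqP; field.
have idens i : mu.-integrable setT (EFin \o dens i) by exact: integrable_EFinZl.
have massE i : mode_mass lam a b i = \int[mu]_x dens i x by rewrite RintegralZl.
(* Indices j and -j contribute equally, which turns the factor 1 / (4 pi^2) over all nonzero
   integers into the 1 / (2 pi^2) contained in [dens]. *)
have totalE : total_Lambda_eff q lambda = \int[mu]_x fsum dens x.
  rewrite /total_Lambda_eff; have mf : measurable_fun setT (fsum dens).
    exact: (measurable_fsum cc mdens dens_le).
  have f0 x j : (0 <= (cmod (q j x) ^+ 2 / lambda j ^+ 2)%:E)%E.
    by rewrite lee_fin divr_ge0 ?sqr_ge0.
  have fneg x (i : nat) : (cmod (q (- i.+1%:Z) x) ^+ 2 / lambda (- i.+1%:Z) ^+ 2)%:E =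
      (cmod (q i.+1%:Z x) ^+ 2 / lam i ^+ 2)%:E.
    rewrite -qc// lc// sqrrN !sqr_cmod; congr (_ / _)%:E.
    by case: (q i.+1%:Z x) => u v /=; rewrite sqrrN.
  have LE x : Lambda_eff q lambda x = (4 * pi ^+ 2)^-1 *
      fine (\sum_(0 <= i <oo) (cmod (q i.+1%:Z x) ^+ 2 / lam i ^+ 2)%:E +
            \sum_(0 <= i <oo) (cmod (q i.+1%:Z x) ^+ 2 / lam i ^+ 2)%:E)%E.
    rewrite /Lambda_eff esum_nonzero_ints//; congr (_ * fine (_ + _)%E).
    by apply: eq_eseriesr => i _; rewrite fneg.
  apply: (@ae_eq_Rintegral R setT (Lambda_eff q lambda) (fsum dens)) => //.
    rewrite (_ : Lambda_eff q lambda = (fun x => (4 * pi ^+ 2)^-1 *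
      fine (\sum_(0 <= i <oo) (cmod (q i.+1%:Z x) ^+ 2 / lam i ^+ 2)%:E +
            \sum_(0 <= i <oo) (cmod (q i.+1%:Z x) ^+ 2 / lam i ^+ 2)%:E)%E)); last exact/funext.
    apply: measurable_funM => //; apply: (measurableT_comp (fine_measurable measurableT)).
    have ms : measurable_fun setT (fun x : measurableTypeR R =>
        \sum_(0 <= i <oo) (cmod (q i.+1%:Z x) ^+ 2 / lam i ^+ 2)%:E)%E.
      apply: ge0_emeasurable_sum; first by move=> i x _ _; rewrite lee_fin divr_ge0 ?sqr_ge0.
      move=> i _; apply/measurable_EFinP; apply: measurable_funM => //.
      rewrite (_ : (fun x => _) = (fun x => Re (q i.+1%:Z x) ^+ 2 + Im (q i.+1%:Z x) ^+ 2)).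
        by have [? ?] := mq i; apply: measurable_funD; exact: measurable_funX.
      by apply/funext => x; rewrite sqr_cmod.
    exact: emeasurable_funD.
  apply: ae_mono abq => x abx _; rewrite LE.
  pose g (i : nat) := cmod (q i.+1%:Z x) ^+ 2 / lam i ^+ 2.
  have cd := dominated_series_cvg cc (dens_le ^~ x).
  have cg : series g @ \oo --> 2 * pi ^+ 2 * fsum dens x.
    rewrite (_ : series g = (fun n => 2 * pi ^+ 2 * series (fun i => dens i x) n)).
      by apply: cvgM; [exact: cvg_cst|exact: cd].
    apply/funext => n; rewrite /series/= mulr_sumr; apply: eq_bigr => i _.
    rewrite /g /dens sqr_cmod; case: (abx i) => -> ->.
    have := lam_neq0 theta0 lam_ge i; have := lt0r_neq0 (pi_gt0 R).
    by move: (pi : R) (lam i) => p l p0 l0; field; rewrite p0 l0.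
  rewrite (fine_nneseries (c := g)); last by apply/cvg_ex; eexists; exact: cg.
  rewrite (cvg_lim (@Rhausdorff R) cg) -EFinD /=.
  have := lt0r_neq0 (pi_gt0 R); move: (pi : R) => p p0; by field.
have mass_cvg : series (mode_mass lam a b) @ \oo --> total_Lambda_eff q lambda.
  rewrite totalE (_ : series _ = (fun n => \int[mu]_x series (fun i => dens i x) n)).
    have Dint := integrable_decay bb0.
    apply: (@dominated_cvg_Rintegral _ setT _ _ (fun x => C * (C * t ^+ 2) * decay (beta + beta) x)) => //.
    - by move=> n; exact: measurable_partial_sum.
    - exact: (measurable_fsum cc mdens dens_le).
    - by apply: aeW => x _; exact: (dominated_series_cvg cc (dens_le ^~ x)).
    - exact: integrable_EFinZl.
    - move=> n; apply: aeW => x _; rewrite -mulrA.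
      exact: (dominated_partial_le c0 cc (dens_le ^~ x)).
  apply/funext => n; have [_ ->] := Rintegral_partial_sum n idens.
  by rewrite /series/=; apply: eq_bigr => i _; rewrite massE.
pose B0 := potential_bound theta c.
(* [B1] bounds the error in the integral of p^2: B0 from p minus e times the leading term, the
   parenthesis from their sum, and the mass of the squared decay from the integration. *)
pose B1 := B0 * (B0 + 2 * (C * (t * 2))) * decay_mass (beta + beta).
have B00 : 0 <= B0 by rewrite /B0 /potential_bound !mulr_ge0// !addr_ge0// exprn_ge0.
have B2 : 0 <= B0 + 2 * (C * (t * 2)) by apply: addr_ge0 => //; rewrite !mulr_ge0.
have B10 : 0 <= B1 by apply: mulr_ge0; [exact: mulr_ge0|exact: decay_mass_ge0].
have e8 : 8 * (beta / 8) = beta by field.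
have leB (u v w : R) : 0 <= v -> u <= B0 * v * decay beta w ->
    u <= (B0 + B1) * v * expR (- (8 * (beta / 8) * `|w|)).
  by move=> v0 /le_trans; apply; rewrite e8 ler_wpM2r ?expR_ge0// ler_wpM2r// lerDl.
exists (beta / 8), (B0 + B1); split; [by rewrite divr_gt0|exact: addr_ge0|].
exists (fun e => \int[mu]_x (leading lam a b e x ^+ 2)).
  exact: (leading_mass_cvg beta0 theta0 lam_ge lamD lamB c0 cc pa pb ac bc mass_cvg).
move=> e e0 e1; have ee0 := ltW e0.
have [p [r [mr Ule pp ple rle]]] := oscillating_primitive beta0 theta0 lam_ge c0 cc pa pb ac bc e0 e1.
exists p, r; split => //.
  apply: ae_mono (Uae e) => y ->.
  by rewrite -[B0 + B1]mulr1; apply: leB; rewrite ?ler01// mulr1; exact: Ule.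
split.
- apply: ae_eq_primitive pp; first by apply: measurable_funD.
  by apply: ae_mono (Uae e) => y ->.
- by move=> y; apply: leB => //; case: (ple y).
- by apply: aeW => y; apply: leB; [exact: exprn_ge0|exact: rle].
have mL := measurable_leading theta0 lam_ge cc pa pb ac bc e.
have Lle := leading_le theta0 lam_ge cc ac bc e.
have mp : measurable_fun setT p by exact: continuous_measurable (primitive_continuous pp).
have ip : mu.-integrable setT (EFin \o (fun y => p y ^+ 2)).
  apply: (@decay_integrable R _ _ (B0 * e * (B0 * e)) bb0 _ _).1; first exact: measurable_funX.
  by move=> y; rewrite expr2; apply: decay_mulr_le; case: (ple y).
have iL : mu.-integrable setT (EFin \o (fun y => leading lam a b e y ^+ 2)).
  apply: (@decay_integrable R _ _ (C * (t * 2) * (C * (t * 2))) bb0 _ _).1; first exact: measurable_funX.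
  by move=> y; rewrite expr2; apply: decay_mulr_le; exact: Lle.
rewrite -RintegralZl// -RintegralB//; last exact: integrable_EFinZl.
apply: (@le_trans _ _ (B0 * e ^+ 2 * ((B0 + 2 * (C * (t * 2))) * e) * decay_mass (beta + beta))); last first.
  rewrite (_ : _ * decay_mass _ = B1 * e ^+ 3); last by rewrite /B1; ring.
  by rewrite ler_wpM2r ?exprn_ge0// lerDr.
apply: (decay_integrable bb0 _ _).2.
  apply: measurable_funB; first exact: measurable_funX.
  by apply: measurable_funM => //; exact: measurable_funX.
move=> y; rewrite -exprMn subr_sqr.
have [p1 p2] := ple y.
apply: (@decay_mulr_le R beta _ _ (fun y => p y - e * leading lam a b e y)
  (fun y => p y + e * leading lam a b e y) y p2).
have -> : p y + e * leading lam a b e y = (p y - e * leading lam a b e y) + 2 * e * leading lam a b e y.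
  by ring.
have h : `|2 * e * leading lam a b e y| <= 2 * e * (C * (t * 2) * decay beta y).
  by rewrite normrM ger0_norm ?mulr_ge0// ler_wpM2l ?mulr_ge0//; exact: Lle.
rewrite (le_trans (ler_normD _ _))// (le_trans (lerD p2 h))//.
rewrite [leRHS](_ : _ = B0 * e * decay beta y + 2 * e * (C * (t * 2) * decay beta y)); last by ring.
rewrite lerD2r ler_wpM2r ?decay_ge0// ler_wpM2l// expr2 ler_piMl// ltW//.
Qed.

End PotentialV.

(** * The limit of the transmission coefficient *)

Section TransmissionLimit.
Variable R : realType.
Notation mu := (@lebesgue_measure R).
Local Notation Re := complex.Re.
Local Notation Im := complex.Im.

(** Numerator and denominator are multiplied by - 2 i. The excluded value of kappa is exactly the
    zero of - 2 i kappa - m, which is the limit of the rescaled Wronskian and also the Wronskian of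
    the point interaction. *)
Lemma tstarE (kappa : R[i]) (m : R) : kappa != 'i / 2 * m%:C ->
  - ('i *+ 2 * kappa) - m%:C != 0 /\
  tstar kappa m = - ('i *+ 2 * kappa) / (- ('i *+ 2 * kappa) - m%:C).
Proof.
move=> hk; set D := kappa - 'i / 2 * m%:C.
have D0 : D != 0 by rewrite subr_eq0.
have -> : - ('i *+ 2 * kappa) - m%:C = - ('i *+ 2) * D.
  have i2 := sqrci R; rewrite /D mulrBr !mulNr opprK; congr (_ + _).
  have -> : 'i *+ 2 * ('i / 2 * m%:C) = ('i ^+ 2) * m%:C :> R[i] by rewrite mulr2n; field.
  by rewrite expr2 i2 mulN1r.
have i0 : - ('i *+ 2) != 0 :> R[i] by rewrite oppr_eq0 mulrn_eq0/= ci_neq0.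
split; first by rewrite mulf_neq0.
by rewrite /tstar -/D -mulNr -mulf_div divff// mul1r.
Qed.

(** The Wronskian divided by eps^2 converges to a nonzero number. It is therefore nonzero for small
    eps, so [transmission] is given by its quotient, in which the powers of eps cancel. *)
Lemma transmission_limit (q : int -> R -> R[i]) (lambda : int -> R)
    (V : R -> R -> R) (kappa : R[i]) :
  hypotheses_V q lambda V ->
  kappa != 'i / 2 * (total_Lambda_eff q lambda)%:C ->
  (transmission mu (q_eps V eps) ((eps ^+ 2)%:C * kappa) : R[i]^o) @[eps --> (0 : R)^'+]
    --> (tstar kappa (total_Lambda_eff q lambda) : R[i]^o).
Proof.
move=> hV hk; set m := total_Lambda_eff q lambda in hk *.
have [w0 tE] := tstarE hk.
set z0 := - ('i *+ 2 * kappa) - m%:C in w0 tE.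
have [eta [B [eta0 B0 [S Sm asy]]]] := potential_asymptotics hV.
have [C [e0 [C0 e00 wasy]]] := @jost_wronskian_asymptotics R eta B (l1norm kappa) eta0 B0 (l1norm_ge0 _).
pose W (e : R) := jost_wronskian mu (q_eps V e) ((e ^+ 2)%:C * kappa).
pose w (e : R) := W e / (e ^+ 2)%:C.
have l1Z (r : R) (z : R[i]) : l1norm (r%:C * z) <= `|r| * l1norm z.
  by rewrite (le_trans (l1normM _ _))// l1norm_real.
have w_le e : 0 < e -> e < Num.min 1 e0 -> l1norm (w e + 'i *+ 2 * kappa + (S e)%:C) <= (C + B) * e.
  move=> epos; rewrite lt_min => /andP[e1 ee0].
  have [p [r [mU mr Ule [pp ple rle int_le]]]] := asy e epos e1.
  have kle : l1norm ((e ^+ 2)%:C * kappa) <= l1norm kappa * e ^+ 2.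
    by rewrite (le_trans (l1Z _ _))// ger0_norm ?sqr_ge0// mulrC.
  have [_ Wle] := wasy e _ _ p r epos ee0 kle mU mr Ule pp ple rle.
  set I := \int[mu]_y p y ^+ 2 in int_le Wle.
  have e2 : 0 < e ^+ 2 by rewrite exprn_gt0.
  have e20 : (e ^+ 2)%:C != 0 :> R[i] by rewrite eq_complex /= gt_eqF.
  have -> : w e + 'i *+ 2 * kappa + (S e)%:C = ((e ^+ 2)^-1)%:C *
     ((W e + 'i *+ 2 * ((e ^+ 2)%:C * kappa) + I%:C) - (I - e ^+ 2 * S e)%:C).
    rewrite fmorphV rmorphB rmorphM /= /w; field.
    by rewrite -[X in X != 0]/(e%:C) eq_complex /= gt_eqF.
  apply: (le_trans (l1Z _ _)).
  rewrite ger0_norm ?invr_ge0 ?(ltW e2)// mulrC ler_pdivrMr//.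
  rewrite (le_trans (l1normB _ _))// l1norm_real (le_trans (lerD Wle int_le))//.
  by rewrite le_eqVlt; apply/orP; left; apply/eqP; ring.
have wz : (fun e => w e : R[i]^o) @ (0 : R)^'+ --> (z0 : R[i]^o).
  apply: cvg_l1norm => d d0.
  have d2 : 0 < d / 2 by rewrite divr_gt0.
  have CB : 0 < C + B + 1 by rewrite ltr_wpDl// addr_ge0.
  near=> e.
  have epos : 0 < e by [].
  have h : l1norm (w e + 'i *+ 2 * kappa + (S e)%:C) <= d / 2.
    apply: (@le_trans _ _ ((C + B) * e)).
      apply: w_le => //; near: e; apply: nbhs_right_lt; by rewrite lt_min ltr01.
    apply: (@le_trans _ _ ((C + B + 1) * e)); first by rewrite ler_wpM2r ?(ltW epos)// lerDl.
    rewrite mulrC -ler_pdivlMr//; near: e; apply: nbhs_right_le; exact: divr_gt0.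
  have h' : `|m - S e| <= d / 2 by near: e; move/cvgrPdist_le : Sm; exact.
  have -> : z0 - w e = - (w e + 'i *+ 2 * kappa + (S e)%:C) - (m - S e)%:C.
    by rewrite /z0 rmorphB /=; ring.
  rewrite (le_trans (l1normB _ _))// l1normN l1norm_real (le_trans (lerD h h'))//.
  by rewrite -splitr.
have nz : \forall e \near (0 : R)^'+, w e != 0.
  exact: (cvgr_neq0 z0 wz w0).
rewrite tE.
have lim : (fun e => - ('i *+ 2 * kappa) * (w e)^-1 : R[i]^o) @ (0 : R)^'+ -->
   (- ('i *+ 2 * kappa) / z0 : R[i]^o).
  by apply: cvgM; [exact: cvg_cst|exact: cvgV].
apply: cvg_trans lim; apply: near_eq_cvg; near=> e.
have epos : 0 < e by [].
have we : w e != 0 by near: e.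
have e20 : (e ^+ 2)%:C != 0 :> R[i] by rewrite eq_complex /= gt_eqF ?exprn_gt0.
have W0 : W e != 0 by apply: contraNneq we => h; rewrite /w h mul0r.
rewrite /transmission -/(W e) W0 /transmission_quotient -/(W e) /w.
by move: ((e ^+ 2)%:C) e20 (W e) W0 => y y0 z z0'; field; rewrite y0 z0'.
Unshelve. all: by end_near. Qed.

End TransmissionLimit.

(** * The point interaction *)

Section PointInteraction.
Variable R : realType.
Local Notation Re := complex.Re.
Local Notation Im := complex.Im.
Let delta := point_mass R.

Lemma point_mass_integral (D : set R) (f : R -> R) : measurable D -> measurable_fun D f ->
  delta.-integrable D (fun x => (f x)%:E) /\
  Rintegral delta D f = if 0 \in D then f 0 else 0.
Proof.
move=> mD mf; have mf' : measurable_fun D (fun x => (f x)%:E) by apply/measurable_EFinP.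
split.
  apply/integrableP; split => //; rewrite integral_dirac//; last exact: measurableT_comp.
  by rewrite /dirac/= indicE; case: (_ \in _); rewrite ?mul1e ?mul0e// ltry.
rewrite /Rintegral integral_dirac// /dirac/= indicE.
by case: (_ \in _); rewrite ?mul1r ?mul0r.
Qed.

Lemma point_mass_cintegral (D : set R) (f : R -> R[i]) : measurable D -> cmeasurable f ->
  cintegrable delta D f.
Proof.
move=> mD [rf jf]; split; apply: (point_mass_integral mD _).1; exact: measurable_funTS.
Qed.

Lemma point_mass_cintegralE (D : set R) (f : R -> R[i]) : measurable D -> cintegrable delta D f ->
  cintegral delta D f = if 0 \in D then f 0 else 0.
Proof.
move=> mD [/integrableP[rf _] /integrableP[jf _]].
rewrite /cintegral (point_mass_integral mD ((measurable_EFinP _ _).1 rf)).2.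
rewrite (point_mass_integral mD ((measurable_EFinP _ _).1 jf)).2.
by case: (_ \in _) => //; case: (f 0).
Qed.

Variables (m : R) (k : R[i]).

Let kernel_max (s : R) : cmeasurable (fun x => jost_kernel k (Num.max 0 (s * x))).
Proof.
have [rK jK] := cprimitive_cmeasurable (jost_kernel_cprimitive k).
have ms : measurable_fun setT (fun x : R => Num.max 0 (s * x)).
  by apply: measurable_maxr => //; exact: measurable_funM.
by split; [exact: (measurableT_comp rK ms)|exact: (measurableT_comp jK ms)].
Qed.

Let cmeasurable_integrand x (f : R -> R[i]) : cmeasurable f ->
  cmeasurable (fun y => jost_kernel k (y - x) * (- m)%:C * f y).
Proof.
have [rK jK] := cprimitive_cmeasurable (jost_kernel_cprimitive k).
have ms : measurable_fun setT (fun y : R => y - x) by exact: measurable_funB.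
move=> mf; apply: cmeasurableM => //; apply: cmeasurableM; last exact: cmeasurable_cst.
by split; [exact: (measurableT_comp rK ms)|exact: (measurableT_comp jK ms)].
Qed.

(** Integration against the point mass evaluates at 0 when 0 lies in the half-line. At x = 0 the
    kernel vanishes, so f 0 = 1, and the equation then gives f at every x. Since the kernel is 0 at
    0, [Num.max] encodes the case distinction on the sign of x. *)
Lemma jost_plus_point_mass :
  jost_plus delta (fun=> - m) k = (fun x => expp k x - m%:C * jost_kernel k (Num.max 0 (-1 * x))).
Proof.
set g := (RHS).
have mg : cmeasurable g.
  apply: cmeasurableD; first exact: cprimitive_cmeasurable (expp_cprimitive k).
  apply: cmeasurableN; apply: cmeasurableM; first exact: cmeasurable_cst.
  exact: kernel_max.
have gE x : g x = expp k x + if x <= 0 then jost_kernel k (0 - x) * (- m)%:C else 0.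
  rewrite /g sub0r mulN1r; case: ifPn => [x0|]; last first.
    rewrite -ltNge => x0; rewrite max_l ?oppr_le0 ?(ltW x0)//.
    by rewrite jost_kernel0 mulr0 subr0 addr0.
  by rewrite max_r ?oppr_ge0// rmorphN mulrN mulrC.
have g0 : g 0 = 1 by rewrite gE lexx subr0 jost_kernel0 mul0r addr0 expp0.
have inE' x : (0 \in `[x, +oo[%classic) = (x <= 0) by rewrite mem_setE in_itv/= andbT.
have sol f : is_jost_plus delta (fun=> - m) k f <-> f = g.
  split => [hf|->].
    have fE x : f x = expp k x + if x <= 0 then jost_kernel k (0 - x) * (- m)%:C * f 0 else 0.
      by have [i1 ->] := hf x; rewrite (point_mass_cintegralE _ i1)// inE'.
    have f0 : f 0 = 1 by rewrite fE lexx subr0 jost_kernel0 !mul0r addr0 expp0.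
    by apply/funext => x; rewrite gE fE f0 mulr1.
  move=> x; have i1 := @point_mass_cintegral `[x, +oo[%classic _ (measurable_itv _) (cmeasurable_integrand x mg).
  by split => //; rewrite (point_mass_cintegralE _ i1)// inE' g0 mulr1 gE.
rewrite /jost_plus; apply/sol; exact: (@xgetPex _ (fun=> 0) [set f | is_jost_plus delta (fun=> - m) k f] (ex_intro _ g ((sol g).2 erefl))).
Qed.

Lemma jost_minus_point_mass :
  jost_minus delta (fun=> - m) k = (fun x => expm k x - m%:C * jost_kernel k (Num.max 0 (1 * x))).
Proof.
set g := (RHS).
have mg : cmeasurable g.
  apply: cmeasurableD; first exact: cprimitive_cmeasurable (expm_cprimitive k).
  apply: cmeasurableN; apply: cmeasurableM; first exact: cmeasurable_cst.
  exact: kernel_max.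
have gE x : g x = expm k x - if 0 <= x then jost_kernel k (0 - x) * (- m)%:C else 0.
  rewrite /g sub0r mul1r jost_kernelN; case: ifPn => [x0|]; last first.
    rewrite -ltNge => x0; rewrite max_l ?(ltW x0)//.
    by rewrite jost_kernel0 mulr0.
  by rewrite max_r// rmorphN mulrNN mulrC.
have g0 : g 0 = 1 by rewrite gE lexx subr0 jost_kernel0 mul0r subr0 expm0.
have inE' x : (0 \in `]-oo, x]%classic) = (0 <= x) by rewrite mem_setE in_itv.
have sol f : is_jost_minus delta (fun=> - m) k f <-> f = g.
  split => [hf|->].
    have fE x : f x = expm k x - if 0 <= x then jost_kernel k (0 - x) * (- m)%:C * f 0 else 0.
      by have [i1 ->] := hf x; rewrite (point_mass_cintegralE _ i1)// inE'.
    have f0 : f 0 = 1 by rewrite fE lexx subr0 jost_kernel0 !mul0r subr0 expm0.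
    by apply/funext => x; rewrite gE fE f0 mulr1.
  move=> x; have i1 := @point_mass_cintegral `]-oo, x]%classic _ (measurable_itv _) (cmeasurable_integrand x mg).
  by split => //; rewrite (point_mass_cintegralE _ i1)// inE' g0 mulr1 gE.
rewrite /jost_minus; apply/sol; exact: (@xgetPex _ (fun=> 0) [set f | is_jost_minus delta (fun=> - m) k f] (ex_intro _ g ((sol g).2 erefl))).
Qed.

Lemma near_eq_cderive (f g : R -> R[i]) (x : R) : (\forall y \near x, f y = g y) ->
  cderive f x = cderive g x.
Proof.
move=> fg; rewrite /cderive !derive1E; congr (_ +i* _); apply: near_eq_derive;
  by apply: filterS fg => y ->.
Qed.

Let cderive_cprimitive (F f f' : R -> R[i]) x : cprimitive F f -> cprimitive f f' -> cderive F x = f x.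
Proof.
move=> pF [rf jf]; apply: (cderiveE pF); [exact: (primitive_continuous rf)|exact: (primitive_continuous jf)].
Qed.

(** Near the point 1 the right solution is the free wave e^(ikx), so m enters only through the left
    solution, which has already crossed the point mass. The products of opposite exponentials equal
    1 and leave - 2 i k - m. *)
Lemma jost_wronskian_point_mass : jost_wronskian delta (fun=> - m) k = - ('i *+ 2 * k) - m%:C.
Proof.
rewrite /jost_wronskian /wronskian jost_plus_point_mass jost_minus_point_mass.
have near_pos : \forall y \near (1 : R), 0 < y by apply: lt_nbhsr; exact: ltr01.
have -> : cderive (fun x => expp k x - m%:C * jost_kernel k (Num.max 0 (-1 * x))) 1 = 'i * k * expp k 1.
  rewrite -(@cderive_cprimitive (expp k) _ _ 1 (expp_cprimitive k) (cprimitiveZ ('i * k) (expp_cprimitive k))).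
  apply: near_eq_cderive; apply: filterS near_pos => y y0.
  by rewrite mulN1r max_l ?oppr_le0 ?(ltW y0)// jost_kernel0 mulr0 subr0.
have -> : cderive (fun x => expm k x - m%:C * jost_kernel k (Num.max 0 (1 * x))) 1 =
    - ('i * k) * expm k 1 + - m%:C * ccos k 1.
  rewrite -(@cderive_cprimitive (fun x => expm k x + - m%:C * jost_kernel k x) _ _ 1
    (cprimitiveD (expm_cprimitive k) (cprimitiveZ (- m%:C) (jost_kernel_cprimitive k)))
    (cprimitiveD (cprimitiveZ (- ('i * k)) (expm_cprimitive k)) (cprimitiveZ (- m%:C) (ccos_cprimitive k)))).
  apply: near_eq_cderive; apply: filterS near_pos => y y0.
  by rewrite mul1r max_r ?(ltW y0)// mulNr.
rewrite mulN1r mul1r (max_l (_ : -1 <= 0)) ?lerN10// (max_r ler01) jost_kernel0 mulr0 subr0.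
have e1 := expp_expm k 1; have e2 := expm_ccos k 1.
have -> : ccos k 1 = expm k 1 + 'i * k * jost_kernel k 1 by rewrite e2 subrK.
rewrite (_ : _ - _ = - ('i *+ 2 * k) * (expp k 1 * expm k 1) - m%:C * (expp k 1 * expm k 1)).
  by rewrite e1 !mulr1.
by rewrite mulr2n; ring.
Qed.

Lemma transmission_point_mass : k != 'i / 2 * m%:C ->
  transmission delta (fun=> - m) k = tstar k m.
Proof.
move=> hk; have [W0 ->] := tstarE hk.
by rewrite /transmission /transmission_quotient jost_wronskian_point_mass W0.
Qed.

End PointInteraction.

Theorem corollary3p6 (R : realType) (q : int -> R -> R[i]) (lambda : int -> R)
    (V : R -> R -> R) (kappa : R[i])
    (hV : hypotheses_V q lambda V)
    (hkappa : kappa != 'i / 2 * (total_Lambda_eff q lambda)%:C) :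
  (transmission (@lebesgue_measure R) (q_eps V eps) ((eps ^+ 2)%:C * kappa)
     : R[i]^o) @[eps --> (0 : R)^'+]
    --> (tstar kappa (total_Lambda_eff q lambda) : R[i]^o)
  /\ (forall (m : R) (k : R[i]), 0 < m -> k != 'i / 2 * m%:C ->
        transmission (point_mass R) (fun=> - m) k = tstar k m).
Proof.
split; first exact: transmission_limit.
by move=> m k _; exact: transmission_point_mass.
Qed.
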